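(* Let $d\ge1$, let $h:\mathbf{T}^d\to\mathbf{R}$ be a smooth function, and set $$J(h)=\int_{\mathbf{T}^d}\kappa\,G(h)h\,dx .$$ Then $$J(h)=\iint_\Omega\frac{|\nabla_{x,y}Q|^2\,|\nabla_{x,y}^2Q|^2-|\nabla_{x,y}Q\cdot\nabla_{x,y}\nabla_{x,y}Q|^2}{|\nabla_{x,y}Q|^3}\,dy\,dx\ \ge\ 0 .$$
   Context: $\mathbf{T}^d$ is a $d$-dimensional (flat) torus, $\nabla=\nabla_x$, $\operatorname{div}=\operatorname{div}_x$. $\Omega=\{(x,y)\in\mathbf{T}^d\times\mathbf{R}:y<h(x)\}$ and $\kappa=-\operatorname{div}\Big(\frac{\nabla h}{\sqrt{1+|\nabla h|^2}}\Big)$. The harmonic extension $\varphi$ of $h$ is the unique $\varphi\in C^\infty(\overline\Omega)$ with $\nabla_{x,y}\varphi\in L^2(\Omega)$, $\Delta_{x,y}\varphi=0$ in $\Omega$ and $\varphi(x,h(x))=h(x)$; $Q(x,y)=\varphi(x,y)-y$. The Dirichlet-to-Neumann operator applied to $h$ is $G(h)h(x)=\big(\partial_y\varphi-\nabla h\cdot\nabla\varphi\big)\big|_{y=h(x)}$. With $\partial_i=\partial_{x_i}$ for $1\le i\le d$ and $\partial_{d+1}=\partial_y$, $$|\nabla_{x,y}^2Q|^2=\sum_{1\le i,j\le d+1}(\partial_i\partial_jQ)^2,\qquad |\nabla_{x,y}Q\cdot\nabla_{x,y}\nabla_{x,y}Q|^2=\sum_{1\le i\le d+1}\Big(\sum_{1\le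 j\le d+1}(\partial_jQ)\,\partial_i\partial_jQ\Big)^2.$$ (It is known that $|\nabla_{x,y}Q|$ is bounded below by a positive constant on $\overline\Omega$.) *)

(* Defs.v *)
From HB Require Import structures.
From mathcomp Require Import all_boot all_order all_algebra.
From mathcomp Require Import all_classical all_reals all_analysis.
Set Implicit Arguments.
Unset Strict Implicit.
Unset Printing Implicit Defensive.
Import Order.TTheory GRing.Theory Num.Theory.
Import numFieldNormedType.Exports.
Local Open Scope classical_set_scope.
Local Open Scope ring_scope.

Section lebesgue_tuple.
Variable R : realType.
Local Notation mR := (measurableTypeR R).

Definition cons_pair n (p : mR * n.-tuple mR) : n.+1.-tuple mR :=
  [the n.+1.-tuple mR of p.1 :: p.2].

Lemma measurable_cons_pair n : measurable_fun setT (@cons_pair n).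
Proof. exact: measurable_cons. Qed.

Section lebesgue_cons.
Variables (n : nat) (mu : {sigma_finite_measure set (n.-tuple mR) -> \bar R}).

Definition lebesgue_cons : set (n.+1.-tuple mR) -> \bar R :=
  pushforward (@lebesgue_measure R \x mu)%E (@cons_pair n).

Let lebesgue_cons0 : lebesgue_cons set0 = 0%E.
Proof. by rewrite /lebesgue_cons /pushforward preimage_set0 measure0. Qed.

Let lebesgue_cons_ge0 A : (0 <= lebesgue_cons A)%E.
Proof. by rewrite /lebesgue_cons /pushforward; exact: measure_ge0. Qed.

Let lebesgue_cons_sigma_additive : semi_sigma_additive lebesgue_cons.
Proof.
have := @measure_semi_sigma_additive _ _ _
  (pushforward (@lebesgue_measure R \x mu)%E (@cons_pair n)).
by apply; exact: measurable_cons_pair.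
Qed.

HB.instance Definition _ := isMeasure.Build _ _ _ lebesgue_cons
  lebesgue_cons0 lebesgue_cons_ge0 lebesgue_cons_sigma_additive.

Let lebesgue_cons_sigma_finite : sigma_finite setT lebesgue_cons.
Proof.
have /sigma_finiteP[F [TF ndF Foo]] := @sigma_finiteT _ _ _ (@lebesgue_measure R).
have /sigma_finiteP[G [TG ndG Goo]] := sigma_finiteT mu.
pose uncons (t : n.+1.-tuple mR) : mR * n.-tuple mR :=
  (thead t, [tuple of behead t]).
have muncons : measurable_fun setT uncons.
  apply/measurable_fun_pairP; split; first exact: measurable_tnth.
  exact: measurable_behead.
exists (fun k => uncons @^-1` (F k `*` G k)).
  apply/seteqP; split => // t _.
  have [i _ Fi] : (\bigcup_i F i) (thead t) by rewrite -TF.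
  have [j _ Gj] : (\bigcup_j G j) [tuple of behead t] by rewrite -TG.
  exists (maxn i j) => //; split => /=.
  - by move: Fi; apply/subsetPset/ndF/leq_maxl.
  - by move: Gj; apply/subsetPset/ndG/leq_maxr.
move=> k; have [mF ltF] := Foo k; have [mG ltG] := Goo k; split.
  by rewrite -[X in measurable X]setTI; apply: muncons => //; exact: measurableX.
rewrite /lebesgue_cons /pushforward -comp_preimage.
rewrite (_ : uncons \o _ = id) ?preimage_id.
  by rewrite product_measure1E// lte_mul_pinfty// ge0_fin_numE.
by apply/funext => -[x t]; congr pair; exact/val_inj.
Qed.

HB.instance Definition _ := Measure_isSigmaFinite.Build _ _ _ lebesgue_cons
  lebesgue_cons_sigma_finite.

End lebesgue_cons.

(* Lebesgue measure on R^n, by R^(n+1) = R x R^n and R^0 = a point *)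
Fixpoint lebesgue_tuple n : {sigma_finite_measure set (n.-tuple mR) -> \bar R} :=
  match n with
  | 0 => \d_([tuple] : 0.-tuple mR)
  | m.+1 => lebesgue_cons (lebesgue_tuple m)
  end.

End lebesgue_tuple.
Arguments lebesgue_tuple R n : clear implicits.

Section smooth.
Context {R : realType} {n : nat}.
Implicit Types (f : 'rV[R]_n -> R) (U : set 'rV[R]_n).

Definition partial (i : 'I_n) f : 'rV[R]_n -> R := 'D_(delta_mx 0 i) f.

Definition iter_partial (s : seq 'I_n) f := foldr partial f s.

(* C^oo(U), for U open *)
Definition smooth_on U f :=
  forall s x, U x -> {for x, continuous (iter_partial s f)} /\
    forall i, derivable (iter_partial s f) x (delta_mx 0 i).

(* C^oo(closure U), for U open: all the partial derivatives on U extend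
   continuously to closure U. The values of f outside closure U are
   irrelevant. *)
Definition smooth_on_closure U f :=
  [/\ smooth_on U f, {within closure U, continuous f} &
    forall s, exists2 g : 'rV[R]_n -> R, {within closure U, continuous g} &
      forall x, U x -> g x = iter_partial s f x].

(* value at a point of closure U of the continuous extension of f|U *)
Definition boundary_value U f (x : 'rV[R]_n) : R := lim (f @ within U (nbhs x)).

(* |.| is the Euclidean norm here, whereas `|.| is the sup norm on 'rV *)
Definition grad_sqnorm f x := \sum_i partial i f x ^+ 2.

Definition grad_norm f x := Num.sqrt (grad_sqnorm f x).

Definition laplacian f x := \sum_i partial i (partial i f) x.

Definition hess_sqnorm f x := \sum_i \sum_j partial i (partial j f) x ^+ 2.

Definition grad_hess_sqnorm f x :=
  \sum_i (\sum_j partial j f x * partial i (partial j f) x) ^+ 2.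

End smooth.

(* The flat torus R^d / Z^d A, where the rows of the invertible matrix A are a
   basis of the lattice; functions on it are A-periodic functions on R^d. A
   point z of R^d x R is a row vector of length d + 1, with x = lsubmx z and
   y = z 0 ycoord. *)
Section torus.
Context {R : realType} {d : nat}.
Variable A : 'M[R]_d.
Implicit Types (h : 'rV[R]_d -> R) (phi : 'rV[R]_(d + 1) -> R).

Definition lattice_periodic h := forall i x, h (x + row i A) = h x.

Definition xy_point (x : 'rV[R]_d) (y : R) : 'rV[R]_(d + 1) := row_mx x y%:M.

Definition ycoord : 'I_(d + 1) := rshift d ord0.

Definition subgraph h : set 'rV[R]_(d + 1) :=
  [set z : 'rV[R]_(d + 1) | z 0 ycoord < h (lsubmx z)].

Definition unit_cube : set (d.-tuple (measurableTypeR R)) :=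
  [set t | forall i, 0 <= tnth t i < 1].

(* t |-> t A maps [0,1[^d bijectively onto a fundamental domain of the lattice,
   with Jacobian |det A| *)
Definition lattice_chart (t : d.-tuple (measurableTypeR R)) : 'rV[R]_d :=
  (\row_i tnth t i) *m A.

Definition torus_integral (f : 'rV[R]_d -> R) : \bar R :=
  (`|\det A|%:E * \int[lebesgue_tuple R d]_(t in unit_cube)
     (f (lattice_chart t))%:E)%E.

Definition subgraph_integral h (f : 'rV[R]_(d + 1) -> R) : \bar R :=
  (`|\det A|%:E * \int[lebesgue_tuple R d \x @lebesgue_measure R]_(p in
       [set p | unit_cube p.1 /\
         subgraph h (xy_point (lattice_chart p.1) p.2)])
     (f (xy_point (lattice_chart p.1) p.2))%:E)%E.

Definition harmonic_extension h phi :=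
  [/\ smooth_on_closure (subgraph h) phi,
      forall i z, closure (subgraph h) z -> phi (z + xy_point (row i A) 0) = phi z,
      (subgraph_integral h (grad_sqnorm phi) < +oo)%E,
      forall z, subgraph h z -> laplacian phi z = 0 &
      forall x, phi (xy_point x (h x)) = h x].

Definition curvature h (x : 'rV[R]_d) : R :=
  - \sum_i partial i (fun x' =>
      partial i h x' / Num.sqrt (1 + grad_sqnorm h x')) x.

(* G(h)h, where phi is the harmonic extension of h *)
Definition dirichlet_neumann h phi (x : 'rV[R]_d) : R :=
  boundary_value (subgraph h) (partial ycoord phi) (xy_point x (h x)) -
  \sum_i partial i h x *
    boundary_value (subgraph h) (partial (lshift 1 i) phi) (xy_point x (h x)).

Definition J_functional h phi : \bar R :=
  torus_integral (fun x => curvature h x * dirichlet_neumann h phi x).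

End torus.

(* Main.v *)
Require Import Defs.
From HB Require Import structures.
From mathcomp Require Import all_boot all_order all_algebra.
From mathcomp Require Import all_classical all_reals all_analysis.
From mathcomp Require Import measurable_realfun ring lra.
Import Order.TTheory GRing.Theory Num.Theory.
Import numFieldNormedType.Exports.
Local Open Scope classical_set_scope.
Local Open Scope ring_scope.

(* With [q = grad Q] and [F = sqrt (eps^2 + |q|^2)], harmonicity of [Q] gives
   [Delta F = ((eps^2 + |q|^2) |hess Q|^2 - |q . hess Q|^2) / F^3]. Integrate
   this against the cutoff [chi = (1 + (y - M) / L)_+^3], [M >= h], with Green's
   formula below the graph of [h].
   - On the graph [Q = 0], hence [q = a (grad h, -1)], and the normal flux of
     [F] tends to [- kappa a (1 + |grad h|^2)] when [eps] tends to [0], provided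
     that [a >= 0]; there [G(h)h = 1 - a (1 + |grad h|^2)], and [kappa] has
     integral zero.
   - [a >= 0] because [Q >= 0], by the maximum principle in energy form.
   - The terms in which [chi] is differentiated are [O(1 / L)] by the finite
     energy of the harmonic extension.
   - With [eps = 2^-k], [chi eps^2 |hess Q|^2 / F^3] is at most a constant times
     the increment of the nondecreasing sequence [chi |hess Q|^2 / F]. Kato's
     inequality [|q . hess Q|^2 <= c |q|^2 |hess Q|^2], [c < 1], bounds the
     integrals of the latter by those of [chi Delta F]; hence the increments
     tend to [0].
   - What is left, [chi (|q|^2 |hess Q|^2 - |q . hess Q|^2) / F^3], increases
     with [k], and monotone convergence applies; where [q = 0], all the
     terms vanish, and so does the integrand because [x / 0 = 0]. *)

Set Implicit Arguments.
Unset Strict Implicit.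
Unset Printing Implicit Defensive.

(** * Directional derivatives and the chain rule *)

(** All integrals are computed on the half-cylinder [s < 0] through [(t, s) |-> (t A, h (t A) + s)].
    At fixed [t] this is a vertical translation, so Fubini and one-dimensional calculus take the
    place of a change of variables. The graph is the obstacle: derivatives are available only
    strictly below it. Each derivative of the harmonic extension is therefore replaced by a
    continuous function on the whole space. Identities then reach the graph as limits, and an
    integrand carrying a cutoff is continuous and vanishes at large depth, hence integrable. The
    cutoff is a cube because Green's formula differentiates it twice and the result has to be
    continuous. Its width [L = k + 1] and [eps = 2^-k] share one index, with [eps <= 1 / L], so that
    the error on the graph and the error from the cutoff vanish together. The second derivatives are
    controlled only through the bounded integrals of [chi Delta F]; Kato's constant is
    [c = (d + 1) / (d + 2)]. *)

Section line.
Context {R : realType} {V : normedModType R}.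
Implicit Types (f : V -> R) (x v : V).

Lemma is_derive_lineP f x v (df : R) :
  is_derive x v f df <-> is_derive (0 : R) 1 (fun k : R => f (k *: v + x)) df.
Proof.
have e : 'D_v f x = 'D_1 (fun k : R => f (k *: v + x)) 0.
  rewrite /derive; set F1 := fun k => _; set F2 := fun k => _.
  suff -> : F1 = F2 by [].
  by apply/funext => k; rewrite /F1 /F2 /= addr0 scale0r add0r [_%:A]mulr1.
have [d1 d2] := derivable1P f x v.
split=> -[fd <-]; split.
- exact: d1.
- exact: esym e.
- exact: d2.
- exact: e.
Qed.

End line.

Lemma continuous_bigsum {R : realType} {T : topologicalType} {I : Type}
    (r : seq I) (F : I -> T -> R) :
  (forall i, continuous (F i)) -> continuous (fun x => \sum_(i <- r) F i x).
Proof.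
move=> cF; elim: r => [|i r ih] x.
  by under eq_fun do rewrite big_nil; exact: cvg_cst.
by under eq_fun do rewrite big_cons; apply: cvgD; [exact: cF|exact: ih].
Qed.

Lemma is_diff_littleo {R : realType} {V W : normedModType R} (f : V -> W)
    (l : {linear V -> W}) (z : V) : continuous l ->
  (forall e, 0 < e -> \forall v \near (0 : V),
    `|f (v + z) - f z - l v| <= e * `|v|) -> is_diff z f l.
Proof.
move=> lc fl.
have lo : f \o shift z = cst (f z) + l +o_ (0 : V) id.
  apply/eqaddoP => e e0; have := fl e e0; apply: filterS => v.
  suff -> : (f \o shift z - (cst (f z) + l)) v = f (v + z) - f z - l v by [].
  by rewrite -[LHS]/(f (v + z) - (f z + l v)) opprD addrA.
have dE := diff_unique lc lo.
apply: DiffDef; last exact: dE.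
by apply/diff_locallyP; rewrite dE.
Qed.

Section calculus.
Context {R : realType} {V : normedModType R}.
Implicit Types (f : V -> R) (x v : V).

Lemma is_derive_line f x v (df k : R) :
  is_derive (k *: v + x) v f df ->
  is_derive k 1 (fun k : R => f (k *: v + x)) df.
Proof.
move=> /is_derive_lineP fd; apply/is_derive_lineP.
rewrite (_ : (fun _ => _) = (fun k0 : R => f (k0 *: v + (k *: v + x)))) //.
by apply/funext => l /=; rewrite [_%:A]mulr1 scalerDl addrA.
Qed.

Lemma is_derive_comp f x v (g : R -> R) (df dg : R) :
  is_derive (f x) 1 g dg -> is_derive x v f df ->
  is_derive x v (g \o f) (dg * df).
Proof.
move=> gd /is_derive_lineP fd; apply/is_derive_lineP.
apply: (@is_derive1_comp _ g (fun k : R => f (k *: v + x))).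
by rewrite scale0r add0r.
Qed.

(** The range of [k] is symmetric about [0], so that increments [b] of either sign are covered at
    once. *)
Lemma mvt_line f (df : V -> R) x v (b : R) :
  (forall k : R, `|k| <= `|b| -> is_derive (k *: v + x) v f (df (k *: v + x))) ->
  exists2 k : R, `|k| <= `|b| & f (b *: v + x) - f x = b * df (k *: v + x).
Proof.
move=> fd; pose g k := f (k *: v + x).
have gd (k : R) : `|k| <= `|b| -> is_derive k 1 g (df (k *: v + x)).
  by move=> /fd /is_derive_line.
have gc : {within `[- `|b|, `|b|], continuous g}.
  apply: derivable_within_continuous => k; rewrite in_itv/= -ler_norml => kb.
  by have [] := gd k kb.
have gx : g 0 = f x by rewrite /g scale0r add0r.
have [b0|b0] := leP 0 b.
  have [||c] := @MVT_segment _ g (fun k => df (k *: v + x)) _ _ b0.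
  - move=> k; rewrite in_itv/= => /andP[k0 kb].
    by apply: gd; rewrite !ger0_norm ?(ltW k0) ?(ltW kb).
  - apply: continuous_subspaceW gc => k /=; rewrite !in_itv/= ger0_norm//.
    by move=> /andP[k0 ->]; rewrite (le_trans _ k0)// oppr_le0.
  rewrite in_itv/= => /andP[c0 cb]; rewrite gx subr0 => gE.
  by exists c; [rewrite !ger0_norm|rewrite gE mulrC].
have [||c] := @MVT_segment _ g (fun k => df (k *: v + x)) _ _ (ltW b0).
- move=> k; rewrite in_itv/= => /andP[k0 kb].
  by apply: gd; rewrite !ler0_norm ?(ltW b0) ?(ltW kb)// lerN2 ltW.
- apply: continuous_subspaceW gc => k /=; rewrite !in_itv/= ltr0_norm// opprK.
  by move=> /andP[-> k0]/=; rewrite (le_trans k0)// oppr_ge0 ltW.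
rewrite in_itv/= => /andP[c0 cb]; rewrite gx sub0r => gE.
exists c; first by rewrite !ler0_norm ?lerN2 // ltW.
by rewrite -opprB gE mulrN opprK mulrC.
Qed.

(* A tangential derivative passes to the boundary [s = 0] of [s < 0]. *)
Lemma is_derive_trace (G dG : V -> R -> R) x v :
  continuous (fun z : V * R => G z.1 z.2) ->
  continuous (fun z : V * R => dG z.1 z.2) ->
  (forall y (s : R), s < 0 -> is_derive y v (G ^~ s) (dG y s)) ->
  is_derive x v (G ^~ 0) (dG x 0).
Proof.
move=> cG cdG Gd.
suff h : (fun k : R => k^-1 *: (G (k *: v + x) 0 - G x 0)) @ 0^' --> dG x 0.
  by split; [apply/cvg_ex; exists (dG x 0)|apply: cvg_lim].
apply/cvgrPdist_le => e e0.
have /cvgrPdist_le /(_ e e0) := cdG (x, 0).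
case=> -[/= A B] [nA nB] AB.
have {}AB y s : A y -> B s -> `|dG x 0 - dG y s| <= e.
  by move=> Ay Bs; apply: (AB (y, s)).
have /nbhs_ballP[r /= r0 rA] := nA.
have /nbhs_ballP[r' /= r'0 rB] := nB.
near=> k.
have k0 : k != 0 by near: k; exact: nbhs_dnbhs_neq.
have kA (l : R) : `|l| <= `|k| -> A (l *: v + x).
  move=> lk; apply: rA; rewrite -ball_normE /= opprD addrCA subrr addr0 normrN.
  rewrite normrZ (@le_lt_trans _ _ (`|k| * (`|v| + 1)))//.
    by rewrite ler_pM ?lerDl.
  rewrite -ltr_pdivlMr ?ltr_wpDl//.
  near: k; apply: dnbhs0_lt.
  by rewrite divr_gt0// ltr_wpDl.
have main (s : R) : s < 0 -> B s ->
    `|k * dG x 0 - (G (k *: v + x) s - G x s)| <= e * `|k|.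
  move=> s0 Bs; have [] := @mvt_line (G ^~ s) (dG ^~ s) x v k.
    by move=> l _; exact: Gd.
  move=> l lk ->; rewrite -mulrBr normrM mulrC ler_wpM2r// AB//.
  exact: kA.
(* The mean value estimate [main] is uniform in [s < 0], so it survives the limit [s --> 0^-]; this
   limit needs only the continuity of [G]. *)
have lim0 : `|k * dG x 0 - (G (k *: v + x) 0 - G x 0)| <= e * `|k|.
  have cs y : (G y s) @[s --> 0^'-] --> G y 0.
    apply: cvg_at_left_filter.
    apply: (@continuous_comp _ _ _ (fun s : R => (y, s)) (fun z : V * R => G z.1 z.2)).
      by apply: (@cvg_pair _ _ _ _ (nbhs y) (nbhs 0)); [exact: cvg_cst|exact: cvg_id].
    exact: cG.
  have : `|k * dG x 0 - (G (k *: v + x) s - G x s)| @[s --> 0^'-] -->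
     `|k * dG x 0 - (G (k *: v + x) 0 - G x 0)|.
    apply: cvg_norm; apply: cvgB; first exact: cvg_cst.
    exact: cvgB.
  move=> /(@cvg_lim _ _) <- //.
  apply: limr_le; first by apply/cvg_ex; eexists; apply: cvg_norm; apply: cvgB;
    [exact: cvg_cst|exact: cvgB].
  near=> s; apply: main.
    by near: s; exact: nbhs_left_lt.
  apply: rB; rewrite -ball_normE /= sub0r normrN ltr0_norm; last first.
    by near: s; exact: nbhs_left_lt.
  by rewrite ltrNl; near: s; apply: nbhs_left_gt; rewrite oppr_lt0.
have -> : dG x 0 - k^-1 *: (G (k *: v + x) 0 - G x 0) =
    k^-1 * (k * dG x 0 - (G (k *: v + x) 0 - G x 0)).
  by rewrite mulrBr mulKf.
by rewrite normrM normfV mulrC ler_pdivrMr ?normr_gt0.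
Unshelve. all: by end_near. Qed.

End calculus.

Section partials.
Context {R : realType} {n : nat}.
Implicit Types (f : 'rV[R]_n -> R) (x z v : 'rV[R]_n).

Lemma row_mx_norm_le z (r : R) : 0 <= r ->
  (`|z| <= r) <-> (forall i, `|z 0 i| <= r).
Proof.
move=> r0; rewrite [`|z|]/Num.norm/= mx_normrE; split=> [h i|h].
  apply: le_trans h; exact: (le_bigmax _ (fun i : 'I_1 * 'I_n => `|z i.1 i.2|) (0, i)).
by apply: bigmax_le => // -[i j] _ /=; rewrite ord1; exact: h.
Qed.

Lemma coord_norm_le z i : `|z 0 i| <= `|z|.
Proof. exact: (row_mx_norm_le z (normr_ge0 z)).1. Qed.

(** One moves from [z] to [v + z] one coordinate at a time. The mean value theorem on each leg
    produces [v 0 i] times [df i] at a nearby point, and the continuity of [df i] makes the [n]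
    errors small. *)
Lemma differentiable_partials f (df : 'I_n -> 'rV[R]_n -> R) z :
  (\forall y \near z, forall i, is_derive y (delta_mx 0 i) f (df i y)) ->
  (forall i, {for z, continuous (df i)}) ->
  forall e, 0 < e -> \forall v \near (0 : 'rV[R]_n),
    `|f (v + z) - f z - \sum_i v 0 i * df i z| <= e * `|v|.
Proof.
move=> fd cdf e e0.
(* Each of the [n] legs costs [e'] times the norm of [v]; the [+ 1] keeps the denominator positive
   when [n = 0]. *)
pose e' := e / (n%:R + 1).
have e'0 : 0 < e' by rewrite divr_gt0// ltr_wpDl.
have : \forall y \near z, forall i, is_derive y (delta_mx 0 i) f (df i y) /\
    `|df i z - df i y| <= e'.
  have : \forall y \near z, forall i, `|df i z - df i y| <= e'.
    apply: (@filter_forall _ 'I_n (fun i y => `|df i z - df i y| <= e') (nbhs z)) => i.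
    exact: (cvgr_dist_le _ _ (cdf i)).
  by apply: filterS2 fd => y fd yd i; split.
move=> /nbhs_ballP[r /= r0 rP].
near=> v.
have vr : `|v| < r.
  near: v; apply/nbhs_ballP; exists r => //= v.
  by rewrite -ball_normE /= sub0r normrN.
pose w (k : nat) : 'rV[R]_n := \row_i (if (i < k)%N then v 0 i else 0).
have w0 : w 0%N = 0 by apply/rowP => i; rewrite !mxE.
have wn : w n = v by apply/rowP => i; rewrite !mxE ltn_ord.
have step (i : 'I_n) : `|f (w i.+1 + z) - f (w i + z) - v 0 i * df i z| <= e' * `|v|.
  have wS : w i.+1 = v 0 i *: delta_mx 0 i + w i.
    apply/rowP => j; rewrite !mxE eqxx/= ltnS leq_eqVlt (val_eqE j i).
    have [->|ji] := eqVneq j i; first by rewrite ltnn/= mulr1 addr0.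
    by rewrite mulr0 add0r.
  have inb k : `|k| <= `|v 0 i| -> `|k *: delta_mx 0 i + w i| <= `|v|.
    move=> kv; apply/row_mx_norm_le => // j; rewrite !mxE eqxx/=.
    have vj := coord_norm_le v j.
    have [->|ji] := eqVneq j i; first by rewrite ltnn addr0 mulr1 (le_trans kv)// coord_norm_le.
    by rewrite mulr0 add0r; case: ifP => // _; rewrite normr0.
  have inB k : `|k| <= `|v 0 i| -> ball z r (k *: delta_mx 0 i + (w i + z)).
    move=> /inb kv; rewrite -ball_normE/= addrA opprD addrCA subrr addr0 normrN.
    exact: le_lt_trans vr.
  rewrite wS -(addrA _ (w i) z).
  have [k kv ->] := @mvt_line _ _ f (df i) (w i + z) (delta_mx 0 i) (v 0 i)
    (fun k kv => (rP _ (inB k kv) i).1).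
  rewrite -mulrBr normrM mulrC ler_pM ?coord_norm_le//.
  by rewrite distrC; exact: (rP _ (inB k kv) i).2.
have -> : f (v + z) - f z = \sum_(i < n) (f (w i.+1 + z) - f (w i + z)).
  rewrite -(big_mkord xpredT (fun i => f (w i.+1 + z) - f (w i + z))).
  by rewrite telescope_sumr// wn w0 add0r.
rewrite -sumrB (le_trans (ler_norm_sum _ _ _))//.
apply: (@le_trans _ _ (\sum_(i < n) e' * `|v|)); first exact: ler_sum.
rewrite sumr_const card_ord -mulr_natl mulrA ler_wpM2r// /e' mulrA ler_pdivrMr ?ltr_wpDl//.
by rewrite mulrC ler_wpM2l ?lerDl// ltW.
Unshelve. all: by end_near. Qed.

Lemma is_diff_partials f (df : 'I_n -> 'rV[R]_n -> R) z :
  (\forall y \near z, forall i, is_derive y (delta_mx 0 i) f (df i y)) ->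
  (forall i, {for z, continuous (df i)}) ->
  is_diff z f (fun v => \sum_i v 0 i * df i z).
Proof.
move=> fd cdf; pose l v := \sum_i v 0 i * df i z.
have lin : linear l.
  move=> k u v; rewrite /l scaler_sumr -big_split; apply: eq_bigr => i _ /=.
  by rewrite !mxE mulrDl [_ *: _]mulrA.
pose ll : {linear 'rV[R]_n -> R} := HB.pack l (GRing.isLinear.Build _ _ _ _ _ lin).
apply: (@is_diff_littleo _ _ _ f ll).
  apply: continuous_bigsum => i v.
  apply: continuousM; first exact: coord_continuous.
  exact: cst_continuous.
by move=> e e0; exact: differentiable_partials.
Qed.

Lemma is_derive_partials f (df : 'I_n -> 'rV[R]_n -> R)
    (c : R -> 'rV[R]_n) (c' : 'rV[R]_n) (s : R) :
  (\forall y \near c s, forall i, is_derive y (delta_mx 0 i) f (df i y)) ->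
  (forall i, {for c s, continuous (df i)}) ->
  is_derive s 1 c c' ->
  is_derive s 1 (f \o c) (\sum_i c' 0 i * df i (c s)).
Proof.
move=> fd cdf [cd <-].
have fD := is_diff_partials fd cdf.
have cD : differentiable c s by apply/derivable1_diffP.
have fcD : differentiable (f \o c) s by apply: differentiable_comp.
split; first exact/derivable1_diffP.
by rewrite [LHS]deriveE// diff_comp//= [in RHS]deriveE//; case: fD => _ ->.
Qed.

Lemma norm_delta_mx_le1 (i : 'I_n) : `|delta_mx 0 i : 'rV[R]_n| <= 1.
Proof.
apply/row_mx_norm_le => // j; rewrite mxE.
by case: (_ && _); rewrite /= ?normr1 ?normr0.
Qed.

(** The mean value theorem is applied in direction [i] to the increment of [f] along [j], then in
    direction [j] to [fi i]. The condition [b + b < r] keeps all the intermediate points in the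
    ball. *)
Lemma mixed_difference f (fi : 'I_n -> 'rV[R]_n -> R)
    (fij : 'I_n -> 'I_n -> 'rV[R]_n -> R) (i j : 'I_n) z (b r : R) :
  (forall y, ball z r y ->
    (forall i, is_derive y (delta_mx 0 i) f (fi i y)) /\
    (forall i j, is_derive y (delta_mx 0 i) (fi j) (fij i j y))) ->
  0 < b -> b + b < r ->
  exists2 y, ball z r y &
    f (b *: delta_mx 0 j + (b *: delta_mx 0 i + z)) - f (b *: delta_mx 0 i + z)
      - (f (b *: delta_mx 0 j + z) - f z) = b ^+ 2 * fij j i y.
Proof.
move=> rP b0 br.
pose e_ k : 'rV[R]_n := delta_mx 0 k.
have in_ball (a k : R) : `|a| <= b -> `|k| <= b ->
    ball z r (a *: e_ j + (k *: e_ i + z)).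
  move=> ab kb; rewrite -ball_normE/= addrA opprD addrCA subrr addr0 normrN.
  rewrite (le_lt_trans (ler_normD _ _))// !normrZ.
  apply: le_lt_trans br; apply: lerD.
    by rewrite -[leRHS]mulr1 ler_pM// norm_delta_mx_le1.
  by rewrite -[leRHS]mulr1 ler_pM// norm_delta_mx_le1.
have nb : `|b| = b by rewrite gtr0_norm.
pose G x := f (b *: e_ j + x) - f x.
pose dG x := fi i (b *: e_ j + x) - fi i x.
have [k kb Gk] : exists2 k : R, `|k| <= `|b| &
    G (b *: e_ i + z) - G z = b * dG (k *: e_ i + z).
  apply: mvt_line => k; rewrite nb => kb.
  apply: is_deriveB.
    apply/is_derive_lineP.
    have h := (rP _ (in_ball b k _ kb)).1 i; rewrite nb lexx in h.
    have /is_derive_lineP := h erefl.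
    by under eq_fun do rewrite addrCA.
  have := (rP _ (in_ball 0 k _ kb)).1 i; rewrite normr0 ltW// scale0r add0r.
  exact.
have [l lb Gl] : exists2 l : R, `|l| <= `|b| &
    fi i (b *: e_ j + (k *: e_ i + z)) - fi i (k *: e_ i + z) =
    b * fij j i (l *: e_ j + (k *: e_ i + z)).
  apply: mvt_line => l lb; rewrite nb in lb kb.
  exact: (rP _ (in_ball l k lb kb)).2.
rewrite nb in lb kb.
exists (l *: e_ j + (k *: e_ i + z)); first exact: in_ball.
by rewrite -/(G _) -/(G _) Gk /dG Gl mulrA.
Qed.

(** The second difference in [mixed_difference] is symmetric in the two directions. Hence the two
    mixed derivatives take a common value at two points close to [z], and continuity moves both
    points to [z]. *)
Lemma schwarz f (fi : 'I_n -> 'rV[R]_n -> R)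
    (fij : 'I_n -> 'I_n -> 'rV[R]_n -> R) (i j : 'I_n) z :
  (\forall y \near z, forall i, is_derive y (delta_mx 0 i) f (fi i y)) ->
  (\forall y \near z, forall i j, is_derive y (delta_mx 0 i) (fi j) (fij i j y)) ->
  (forall i j, {for z, continuous (fij i j)}) ->
  fij i j z = fij j i z.
Proof.
move=> fd fid cfij; apply/eqP; rewrite -subr_eq0 -normr_le0.
apply/ler_addgt0Pl => e e0; rewrite addr0.
have e20 : 0 < e / 2 by rewrite divr_gt0.
have /nbhs_ballP[r /= r0 rP] : \forall y \near z,
   ((forall i, is_derive y (delta_mx 0 i) f (fi i y)) /\
    (forall i j, is_derive y (delta_mx 0 i) (fi j) (fij i j y))) /\
   (`|fij i j z - fij i j y| <= e / 2 /\ `|fij j i z - fij j i y| <= e / 2).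
  have cd k l : \forall y \near z, `|fij k l z - fij k l y| <= e / 2.
    exact: (cvgr_dist_le _ _ (cfij k l)).
  have h1 := cd i j; have h2 := cd j i.
  by near=> y; split; split; near: y.
have b0 : 0 < r / 3 by rewrite divr_gt0.
have br : r / 3 + r / 3 < r by lra.
have [y zy ey] := mixed_difference i j (fun y zy => (rP y zy).1) b0 br.
have [x zx ex] := mixed_difference j i (fun y zy => (rP y zy).1) b0 br.
have xy : fij j i y = fij i j x.
  apply: (@mulfI _ ((r / 3) ^+ 2)); first by rewrite expf_neq0// gt_eqF.
  rewrite -ey -ex [r / 3 *: delta_mx 0 j + (_ + _)]addrCA; ring.
have [_ [_ h1]] := rP _ zy; have [_ [h2 _]] := rP _ zx.
rewrite (_ : _ - _ = (fij i j z - fij i j x) - (fij j i z - fij j i y)); last first.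
  by rewrite xy; ring.
by rewrite (le_trans (ler_normB _ _))// [leRHS]splitr lerD.
Unshelve. all: by end_near. Qed.

End partials.

(** * Powers of the positive part *)

Section positive_part.
Context {R : realType}.

(** [ppow 3] is the profile of the cutoff, being twice continuously differentiable. Since [ppow 0]
    is [1] even at negative arguments, vanishing is asserted only for successor exponents. *)
Definition ppow n (x : R) := Num.max x 0 ^+ n.

Lemma ppow_ge0 n x : 0 <= ppow n x.
Proof. by rewrite exprn_ge0// le_max lexx orbT. Qed.

Lemma ppow0 n x : x <= 0 -> ppow n.+1 x = 0.
Proof. by move=> x0; rewrite /ppow (elimT max_idPr)// expr0n. Qed.

Lemma ppow_pos n x : 0 <= x -> ppow n x = x ^+ n.
Proof. by move=> x0; rewrite /ppow (elimT max_idPl). Qed.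

Lemma continuous_ppow n : continuous (ppow n).
Proof.
move=> x; apply: (@continuous_comp _ _ _ (fun x : R => Num.max x 0) (fun x => x ^+ n)).
  by apply: continuous_max; [exact: cvg_id|exact: cvg_cst].
exact: exprn_continuous.
Qed.

Lemma is_derive_ppow n (x : R) :
  is_derive x 1 (ppow n.+2) (n.+2%:R * ppow n.+1 x).
Proof.
have [x0|x0|->] := ltgtP x 0.
- rewrite (ppow0 _ (ltW x0)) mulr0.
  apply: (@near_eq_is_derive _ _ _ (cst 0)).
  near=> y; rewrite ppow0//; apply: ltW; near: y; exact: lt_nbhsl.
- rewrite (ppow_pos _ (ltW x0)).
  apply: (@near_eq_is_derive _ _ _ (fun y : R => y ^+ n.+2)).
    near=> y; rewrite ppow_pos//; apply: ltW; near: y; exact: lt_nbhsr.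
  by split; [exact: exprn_derivable|rewrite -derive1E exp_derive1].
rewrite ppow0// mulr0.
(* At [0] the difference quotient of [ppow n.+2] is [ppow n.+1] itself, which tends to [0]. *)
suff h : (fun k : R => k^-1 *: (ppow n.+2 (k *: 1 + 0) - ppow n.+2 0)) @ 0^' --> (0 : R).
  by split; [apply/cvg_ex; exists 0|apply: cvg_lim].
have h : ppow n.+1 @ 0^' --> (0 : R).
  rewrite -[X in _ --> X](ppow0 n (lexx 0)).
  by apply: cvg_within_filter; exact: continuous_ppow.
apply: cvg_trans h; apply: near_eq_cvg; near=> k.
have k0 : k != 0 by near: k; exact: nbhs_dnbhs_neq.
rewrite (ppow0 _ (lexx 0)) subr0 addr0 [_%:A]mulr1 -[_ *: _]/(_ * _).
have [kn|kp] := leP k 0; first by rewrite !ppow0// mulr0.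
by rewrite !(ppow_pos _ (ltW kp)) [k ^+ n.+2]exprS mulKf.
Unshelve. all: by end_near. Qed.

End positive_part.

Section pointwise_rules.
Context {R : realType} {V : normedModType R}.
Implicit Types (f g : V -> R) (x v : V) (a b : R).

Lemma is_derive_funD f g x v a b : is_derive x v f a -> is_derive x v g b ->
  is_derive x v (fun y => f y + g y) (a + b).
Proof. by move=> fa gb; exact: is_deriveD. Qed.

Lemma is_derive_funB f g x v a b : is_derive x v f a -> is_derive x v g b ->
  is_derive x v (fun y => f y - g y) (a - b).
Proof. by move=> fa gb; exact: is_deriveB. Qed.

Lemma is_derive_funM f g x v a b : is_derive x v f a -> is_derive x v g b ->
  is_derive x v (fun y => f y * g y) (f x * b + g x * a).
Proof. by move=> fa gb; exact: is_deriveM. Qed.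

Lemma is_derive_funcst x v a : is_derive x v (fun=> a) 0.
Proof. exact: is_derive_cst. Qed.

Lemma is_derive_funsum (I : Type) (r : seq I) (f : I -> V -> R) x v (df : I -> R) :
  (forall i, is_derive x v (f i) (df i)) ->
  is_derive x v (fun y => \sum_(i <- r) f i y) (\sum_(i <- r) df i).
Proof.
move=> fd; elim: r => [|i r ih].
  by under eq_fun do rewrite big_nil; rewrite big_nil; exact: is_derive_funcst.
by under eq_fun do rewrite big_cons; rewrite big_cons; exact: is_derive_funD.
Qed.

Lemma is_derive_funV f x v a : f x != 0 -> is_derive x v f a ->
  is_derive x v (fun y => (f y)^-1) (- (a / f x ^+ 2)).
Proof.
move=> fx0 [fd <-]; split; first exact: derivableV.
by rewrite deriveV// -[_ *: _]/(_ * _) mulNr mulrC.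
Qed.

Lemma is_derive_fun_sqrt f x v a : 0 < f x -> is_derive x v f a ->
  is_derive x v (fun y => Num.sqrt (f y)) (a / (2 * Num.sqrt (f x))).
Proof.
move=> fx0 fa.
have := is_derive_comp (is_derive1_sqrt fx0) fa.
by rewrite mulrC.
Qed.

End pointwise_rules.

Lemma is_derive_affine {R : realType} (k a b : R) :
  is_derive k 1 (fun k : R => k * a + b) a.
Proof.
have h1 : is_derive k 1 (id : R -> R) 1 by exact: is_derive_id.
apply: is_derive_eq (is_derive_funD (is_derive_funM h1 (is_derive_funcst k 1 a))
  (is_derive_funcst k 1 b)) _.
by rewrite mulr0 add0r mulr1 addr0.
Qed.

Section pointwise_continuity.
Context {R : realType} {T : topologicalType}.
Implicit Types f g : T -> R.

Lemma continuous_funD f g : continuous f -> continuous g ->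
  continuous (fun x => f x + g x).
Proof. by move=> cf cg x; apply: cvgD; [exact: cf|exact: cg]. Qed.

Lemma continuous_funB f g : continuous f -> continuous g ->
  continuous (fun x => f x - g x).
Proof. by move=> cf cg x; apply: cvgB; [exact: cf|exact: cg]. Qed.

Lemma continuous_funN f : continuous f -> continuous (fun x => - f x).
Proof. by move=> cf x; apply: cvgN; exact: cf. Qed.

Lemma continuous_funM f g : continuous f -> continuous g ->
  continuous (fun x => f x * g x).
Proof. by move=> cf cg x; apply: cvgM; [exact: cf|exact: cg]. Qed.

Lemma continuous_funX f n : continuous f -> continuous (fun x => f x ^+ n).
Proof.
move=> cf x; apply: (@continuous_comp _ _ _ f (fun y => y ^+ n)); first exact: cf.
exact: exprn_continuous.
Qed.

Lemma continuous_funV f : (forall x, f x != 0) -> continuous f ->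
  continuous (fun x => (f x)^-1).
Proof. by move=> f0 cf x; apply: cvgV; [exact: f0|exact: cf]. Qed.

Lemma continuous_fun_sqrt f : continuous f -> continuous (fun x => Num.sqrt (f x)).
Proof.
move=> cf x; apply: (@continuous_comp _ _ _ f (@Num.sqrt R)); first exact: cf.
exact: sqrt_continuous.
Qed.

Lemma continuous_funcst (a : R) : continuous (fun _ : T => a).
Proof. by move=> x; exact: cvg_cst. Qed.

Lemma continuous_funcomp {U W : topologicalType} (f : T -> U) (g : U -> W) :
  continuous f -> continuous g -> continuous (fun x => g (f x)).
Proof. by move=> cf cg x; apply: continuous_comp; [exact: cf|exact: cg]. Qed.

End pointwise_continuity.

Lemma continuous_pair {T U V : topologicalType} (f : T -> U) (g : T -> V) x :
  {for x, continuous f} -> {for x, continuous g} ->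
  {for x, continuous (fun x => (f x, g x))}.
Proof. by move=> cf cg; apply: (cvg_pair cf cg). Qed.

Section fubini_rectangle.
Context (d1 d2 : measure_display) (T1 : measurableType d1) (T2 : measurableType d2)
  (R : realType) (m1 : {sigma_finite_measure set T1 -> \bar R})
  (m2 : {sigma_finite_measure set T2 -> \bar R}).
Variables (A : set T1) (B : set T2) (mA : measurable A) (mB : measurable B).
Implicit Types f : T1 * T2 -> \bar R.
Local Open Scope ereal_scope.

Let restrictX1 f x :
  \int[m2]_y (f \_ (A `*` B)) (x, y) = ((fun x => \int[m2]_(y in B) f (x, y)) \_ A) x.
Proof.
rewrite patchE; case: ifPn => xA.
  rewrite [RHS]integral_mkcond; apply: eq_integral => y _; rewrite !patchE.
  by rewrite in_setX xA.
apply: integral0_eq => y _; rewrite patchE in_setX (negbTE xA).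
by [].
Qed.

Let restrictX2 f y :
  \int[m1]_x (f \_ (A `*` B)) (x, y) = ((fun y => \int[m1]_(x in A) f (x, y)) \_ B) y.
Proof.
rewrite patchE; case: ifPn => yB.
  rewrite [RHS]integral_mkcond; apply: eq_integral => x _; rewrite !patchE.
  by rewrite in_setX yB andbT.
apply: integral0_eq => x _; rewrite patchE in_setX (negbTE yB) andbF.
by [].
Qed.

Lemma integral_rectangle12 f : (m1 \x m2).-integrable (A `*` B) f ->
  \int[m1 \x m2]_(z in A `*` B) f z = \int[m1]_(x in A) \int[m2]_(y in B) f (x, y).
Proof.
move=> /(integrable_mkcond _ (measurableX mA mB)) fi.
rewrite integral_mkcond -(integral12_prod_meas1 fi) [RHS]integral_mkcond.
by apply: eq_integral => x _; rewrite /fubini_F restrictX1.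
Qed.

Lemma integral_rectangle21 f : (m1 \x m2).-integrable (A `*` B) f ->
  \int[m1 \x m2]_(z in A `*` B) f z = \int[m2]_(y in B) \int[m1]_(x in A) f (x, y).
Proof.
move=> /(integrable_mkcond _ (measurableX mA mB)) fi.
rewrite integral_mkcond -(integral21_prod_meas1 fi) [RHS]integral_mkcond.
by apply: eq_integral => x _; rewrite /fubini_G restrictX2.
Qed.

End fubini_rectangle.

Lemma continuous_row {R : realType} {T : topologicalType} n (c : T -> 'rV[R]_n) x :
  (forall i, {for x, continuous (fun x => c x 0 i)}) -> {for x, continuous c}.
Proof.
move=> cc; apply/(@cvgrPdist_le _ 'rV[R]_n) => e e0.
have : \forall y \near x, forall i : 'I_n, `|c x 0 i - c y 0 i| <= e.
  apply: (@filter_forall _ 'I_n (fun i y => `|c x 0 i - c y 0 i| <= e) (nbhs x)) => i.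
  exact: (cvgr_dist_le _ _ (cc i)).
apply: filterS => y xy; apply/row_mx_norm_le; first exact: ltW.
by move=> i; rewrite !mxE.
Qed.

(** * Integration over the unit cube and the half-cylinder *)

Section measurability.
Context {R : realType}.

Lemma cvg_row {T : Type} {F : set_system T} {FF : Filter F} n
    (c : T -> 'rV[R]_n) (l : 'rV[R]_n) :
  (forall i, c x 0 i @[x --> F] --> l 0 i) -> c @ F --> l.
Proof.
move=> cl; apply/cvgrPdist_le => e e0.
have : \forall x \near F, forall i : 'I_n, `|l 0 i - c x 0 i| <= e.
  apply: (@filter_forall _ 'I_n (fun i x => `|l 0 i - c x 0 i| <= e)) => i.
  exact: (cvgr_dist_le _ _ (cl i)).
apply: filterS => x lx; apply/row_mx_norm_le; first exact: ltW.
by move=> i; rewrite !mxE.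
Qed.

(** Rounding each coordinate down to a multiple of [1 / (m + 1)] leaves countably many points, so
    the rounded function is measurable whatever [f] is; by continuity it converges to the composite
    as [m] grows. No sigma-algebra on row vectors is involved. *)
Lemma measurable_continuous_coords (dT : measure_display) (T : measurableType dT)
    n (c : 'I_n -> T -> R) (f : 'rV[R]_n -> R) :
  (forall i, measurable_fun setT (c i)) -> continuous f ->
  measurable_fun setT (fun x => f (\row_i c i x)).
Proof.
move=> mc cf.
pose q (m : nat) (k : {ffun 'I_n -> int}) : 'rV[R]_n :=
  \row_i ((k i)%:~R / m.+1%:R).
pose cell (m : nat) (k : {ffun 'I_n -> int}) : set T :=
  [set x | forall i, Num.floor (c i x * m.+1%:R) = k i].
have mcell m k : measurable (cell m k).
  have -> : cell m k = \bigcap_(i in [set: 'I_n])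
      (c i @^-1` `[(k i)%:~R / m.+1%:R, (k i + 1)%:~R / m.+1%:R[).
    apply/seteqP; split => x /= kx i => [_|].
      have /eqP := kx i; rewrite floor_eq /= in_itv/=.
      by rewrite ler_pdivrMr ?ltr0n// ltr_pdivlMr ?ltr0n.
    apply/eqP; rewrite floor_eq; have := kx i I; rewrite /= in_itv/=.
    by rewrite ler_pdivrMr ?ltr0n// ltr_pdivlMr ?ltr0n.
  apply: fin_bigcap_measurable => // i _; rewrite -[X in measurable X]setTI.
  exact: mc.
apply: (@measurable_fun_cvg _ _ _ _
  (fun m x => f (q m [ffun i => Num.floor (c i x * m.+1%:R)]))).
  move=> m _ Y mY; rewrite setTI.
  have -> : (fun x => f (q m [ffun i => Num.floor (c i x * m.+1%:R)])) @^-1` Y =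
      \bigcup_k (if `[< Y (f (q m k)) >] then cell m k else set0).
    apply/seteqP; split => x /=.
      move=> Yx; exists [ffun i => Num.floor (c i x * m.+1%:R)] => //.
      by case: asboolP => // _ i; rewrite ffunE.
    move=> [k _]; case: asboolP => // Yk kx.
    suff -> : [ffun i => Num.floor (c i x * m.+1%:R)] = k by [].
    by apply/ffunP => i; rewrite ffunE kx.
  apply: countable_bigcupT_measurable; first exact: countableP.
  by move=> k; case: asboolP.
move=> x _.
apply: (@cvg_comp _ _ _ (fun m => q m [ffun i => Num.floor (c i x * m.+1%:R)]) f
  \oo (nbhs (\row_i c i x))).
  apply: cvg_row => i; rewrite mxE.
  under eq_fun do rewrite mxE ffunE.
  apply/cvgrPdist_le => e e0.
  have /cvgr0_norm_le /(_ _ e0) : (@harmonic R) @ \oo --> (0 : R) by exact: cvg_harmonic.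
  apply: filterS => m; rewrite /harmonic/= ger0_norm// => me.
  apply: le_trans me.
  have /andP[fl fu] := floor_itv (c i x * m.+1%:R).
  rewrite -[X in X - _](@mulfK _ m.+1%:R) ?pnatr_eq0// -mulrBl normrM.
  rewrite [X in _ * X]ger0_norm// -[leRHS]mul1r ler_wpM2r// ger0_norm ?subr_ge0//.
  by rewrite lerBlDr addrC ltW// (lt_le_trans fu)// intrD.
exact: cf.
Qed.

End measurability.

Section cube.
Context {R : realType} {n : nat}.
Local Notation mR := (measurableTypeR R).
Local Notation mu := (lebesgue_tuple R n).

Definition row_of_tuple (t : n.-tuple mR) : 'rV[R]_n := \row_i tnth t i.

Lemma measurable_unit_cube : measurable (@unit_cube R n).
Proof.
rewrite (_ : unit_cube = \bigcap_(i in [set: 'I_n]) ((tnth (T:=mR))^~ i @^-1` `[0, 1[)).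
  apply: fin_bigcap_measurable => // i _.
  rewrite -[X in measurable X]setTI; apply: measurable_tnth => //.
apply/seteqP; split => t /= ht i; first by move=> _ /=; rewrite in_itv/= ht.
by have := ht i I; rewrite /= in_itv.
Qed.

Lemma measurable_continuous_tuple (f : 'rV[R]_n -> R) : continuous f ->
  measurable_fun setT (f \o row_of_tuple).
Proof.
by apply: measurable_continuous_coords => i; exact: measurable_tnth.
Qed.

Lemma measurable_continuous_pair (G : 'rV[R]_n * R -> R) : continuous G ->
  measurable_fun setT (fun p : n.-tuple mR * mR => G (row_of_tuple p.1, p.2)).
Proof.
move=> cG.
pose c (i : 'I_(n + 1)) (p : n.-tuple mR * mR) : R :=
  match fintype.split i with inl j => tnth p.1 j | inr _ => p.2 end.
have mc i : measurable_fun setT (c i).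
  rewrite /c; case: fintype.split => j; last exact: measurable_snd.
  exact: (measurableT_comp (measurable_tnth j) measurable_fst).
pose f (v : 'rV[R]_(n + 1)) := G (lsubmx v, v 0 (rshift n ord0)).
have cf : continuous f.
  move=> v; apply: (@continuous_comp _ _ _
    (fun v : 'rV[R]_(n + 1) => (lsubmx v, v 0 (rshift n ord0))) G); last exact: cG.
  apply: continuous_pair; last exact: coord_continuous.
  apply: continuous_row => i.
  rewrite (_ : (fun w => _) = (fun w : 'rV[R]_(n + 1) => w 0 (lshift 1 i))).
    exact: coord_continuous.
  by apply/funext => w; rewrite mxE.
rewrite (_ : (fun _ => _) = (fun p => f (\row_i c i p))).
  exact: measurable_continuous_coords.
apply/funext => p; rewrite /f mxE /c; case: (splitP (rshift n ord0)) => [j /= jn|k _].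
  by have := ltn_ord j; rewrite -jn addn0 ltnn.
congr (G (_, _)); apply/rowP => i; rewrite !mxE.
case: (splitP (lshift 1 i)) => [j /= ij|l /= il]; first by congr tnth; exact: val_inj.
by have := ltn_ord i; rewrite il ltnNge leq_addr.
Qed.

Lemma compact_unit_cube :
  compact [set v : 'rV[R]_n | forall i, `[0, 1]%classic (v 0 i)].
Proof.
by apply: (@rV_compact _ _ (fun=> `[(0 : R), 1]%classic)) => i; exact: segment_compact.
Qed.

Lemma bounded_on_compact (T : topologicalType) (A : set T) (f : T -> R) :
  continuous f -> compact A -> exists C, forall x, A x -> `|f x| <= C.
Proof.
move=> cf cA.
have /compact_bounded[M [_ hM]] :=
  continuous_compact (@continuous_subspaceT _ _ A f cf) cA.
by exists (M + 1) => x Ax; apply: (hM (M + 1)); [rewrite ltrDl|exists x].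
Qed.

Lemma unit_cube_row (t : n.-tuple mR) : unit_cube t ->
  forall i, `[0, 1]%classic (row_of_tuple t 0 i).
Proof.
by move=> ct i; rewrite /= mxE in_itv/=; have /andP[-> /ltW] := ct i.
Qed.

Lemma bounded_on_cube (f : 'rV[R]_n -> R) : continuous f ->
  exists C, forall t, unit_cube t -> `|f (row_of_tuple t)| <= C.
Proof.
move=> /bounded_on_compact/(_ compact_unit_cube)[C hC].
by exists C => t /unit_cube_row ct; exact: hC.
Qed.

Lemma bounded_on_box (G : 'rV[R]_n * R -> R) (S : R) : continuous G ->
  exists C, forall t s, unit_cube t -> - S <= s <= 0 ->
    `|G (row_of_tuple t, s)| <= C.
Proof.
have cA := compact_setX compact_unit_cube (@segment_compact R (- S) 0).
move=> /bounded_on_compact/(_ cA)[C hC].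
by exists C => t s /unit_cube_row ct sS; apply: hC; split => //=; rewrite in_itv.
Qed.

End cube.

Section cube_measure.
Context {R : realType}.
Local Notation mR := (measurableTypeR R).

Lemma preimage_cons_box n (J : 'I_n.+1 -> set mR) :
  @cons_pair R n @^-1` [set t | forall i, J i (tnth t i)] =
  J ord0 `*` [set t | forall i : 'I_n, J (lift ord0 i) (tnth t i)].
Proof.
apply/seteqP; split => -[x t] /=.
  move=> h; split => /=; first by have := h ord0.
  by move=> i; have := h (lift ord0 i); rewrite tnthS.
by move=> [/= h0 h] i; case: (unliftP ord0 i) => [j ->|->]; rewrite ?tnthS.
Qed.

Lemma measurable_box n (J : 'I_n -> set mR) : (forall i, measurable (J i)) ->
  measurable [set t : n.-tuple mR | forall i, J i (tnth t i)].
Proof.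
move=> mJ.
rewrite (_ : mkset _ = \bigcap_(i in [set: 'I_n]) ((tnth (T:=mR))^~ i @^-1` J i)).
  apply: fin_bigcap_measurable => // i _.
  by rewrite -[X in measurable X]setTI; apply: measurable_tnth.
by apply/seteqP; split => t /= ht i; [move=> _; exact: ht|exact: ht].
Qed.

Lemma lebesgue_tuple_box n (J : 'I_n -> set mR) : (forall i, measurable (J i)) ->
  lebesgue_tuple R n [set t | forall i, J i (tnth t i)] =
  (\prod_i @lebesgue_measure R (J i))%E.
Proof.
elim: n J => [|n ih] J mJ.
  by rewrite big_ord0 /= /dirac indicE mem_set// => -[].
rewrite big_ord_recl/= /lebesgue_cons /pushforward preimage_cons_box.
rewrite product_measure1E//; last exact: (@measurable_box n (fun i => J (lift ord0 i))).
by rewrite -ih.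
Qed.

Lemma lebesgue_tuple_cube n : lebesgue_tuple R n (@unit_cube R n) = 1%E.
Proof.
rewrite (_ : unit_cube = [set t : n.-tuple mR | forall i, `[0, 1[%classic (tnth t i)]).
  rewrite (@lebesgue_tuple_box n (fun=> `[0, 1[%classic)) ?big1// => i _.
  by rewrite lebesgue_measure_itv/= lte_fin ltr01 oppr0 adde0.
by apply/seteqP; split => t /= ht i; have := ht i; rewrite in_itv.
Qed.

End cube_measure.

Section box.
Context {R : realType} {d : nat}.
Local Notation mR := (measurableTypeR R).
Local Notation mu := (lebesgue_tuple R d).
Local Notation lam := (@lebesgue_measure R).
Local Notation P := (lebesgue_tuple R d \x @lebesgue_measure R)%E.
Implicit Types (G : 'rV[R]_d * R -> R) (f : 'rV[R]_d -> R).

(** Flattened coordinates: [t] runs over a fundamental cell of the lattice, and [s < 0] is the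
    height relative to the graph. *)
Definition half_cylinder : set (d.-tuple mR * mR) := unit_cube `*` `]-oo, 0[.

Definition on_tuples G (p : d.-tuple mR * mR) : R := G (row_of_tuple p.1, p.2).

Definition cube_int f : R := \int[mu]_(t in unit_cube) f (row_of_tuple t).

Definition cyl_int G : R := \int[P]_(p in half_cylinder) on_tuples G p.

Definition cyl_integrable G := P.-integrable half_cylinder (EFin \o on_tuples G).

(** Vanishing is required in depth only. The base being a bounded cube, continuity and this property
    together bound the function on the half-cylinder and make it integrable there. *)
Definition supported (S : R) G :=
  forall t s, unit_cube t -> s <= - S -> G (row_of_tuple t, s) = 0.

Lemma measurable_half_cylinder : measurable half_cylinder.
Proof. by apply: measurableX => //; exact: measurable_unit_cube. Qed.

Lemma cube_integrable f : continuous f ->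
  mu.-integrable unit_cube (EFin \o (f \o row_of_tuple)).
Proof.
move=> cf; apply: measurable_bounded_integrable.
- exact: measurable_unit_cube.
- suff : (lebesgue_tuple R d unit_cube < +oo)%E by [].
  by rewrite lebesgue_tuple_cube ltry.
- by apply: measurable_funTS; exact: measurable_continuous_tuple.
have [C hC] := bounded_on_cube cf.
exists C; split; first exact: num_real.
by move=> x Cx t ct; apply: (le_trans (hC _ ct)); exact: ltW.
Qed.

Lemma integral_cube f : continuous f ->
  (\int[mu]_(t in unit_cube) (f (row_of_tuple t))%:E = (cube_int f)%:E)%E.
Proof.
move=> cf; rewrite /cube_int /Rintegral fineK//.
apply: integrable_fin_num; first exact: measurable_unit_cube.
exact: (cube_integrable cf).
Qed.

Lemma supported_integrable S G : 0 < S -> continuous G -> supported S G ->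
  cyl_integrable G.
Proof.
move=> S0 cG GS.
pose box : set (d.-tuple mR * mR) := unit_cube `*` `[- S, 0[.
have mbox : measurable box by apply: measurableX => //; exact: measurable_unit_cube.
apply/(integrable_mkcond _ measurable_half_cylinder).
have -> : (EFin \o on_tuples G) \_ half_cylinder = (EFin \o on_tuples G) \_ box.
  apply/funext => -[t s]; rewrite !patchE !in_setX.
  case: (boolP (t \in unit_cube)) => //= /set_mem ct.
  rewrite !mem_setE !in_itv/=; case: ltP => //= s0; last by rewrite andbF.
  by rewrite andbT; case: leP => // /ltW sS; rewrite /on_tuples/= GS.
apply/(integrable_mkcond _ mbox).
apply: measurable_bounded_integrable => //.
- suff : (P box < +oo)%E by [].
  have -> : (P box = lebesgue_tuple R d unit_cube * lam `[(- S)%R, 0%R[)%E.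
    by apply: product_measure1E => //; exact: measurable_unit_cube.
  rewrite lebesgue_tuple_cube mul1e lebesgue_measure_itv/=.
  by case: ifP => _; rewrite ?ltry.
- by apply: measurable_funTS; exact: measurable_continuous_pair.
have [C hC] := bounded_on_box S cG.
exists C; split; first exact: num_real.
move=> x Cx [t s] [/= ct]; rewrite in_itv/= => /andP[sS s0].
by apply: (le_trans (hC _ _ ct _)); [rewrite sS ltW|exact: ltW].
Qed.

Lemma ftc_supported (g g' : R -> R) (S : R) : 0 < S ->
  continuous g -> continuous g' ->
  (forall s : R, s < 0 -> is_derive s 1 g (g' s)) ->
  g (- S) = 0 -> (forall s, s <= - S -> g' s = 0) ->
  (\int[lam]_(s in `]-oo, 0%R[) (g' s)%:E = (g 0)%:E)%E.
Proof.
move=> S0 cg cg' gd gS g'S.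
have -> : (\int[lam]_(s in `]-oo, 0%R[) (g' s)%:E = \int[lam]_(s in `[(- S)%R, 0%R[) (g' s)%:E)%E.
  rewrite integral_mkcond [RHS]integral_mkcond; apply: eq_integral => s _.
  rewrite !patchE !mem_setE !in_itv/=; case: ltP => //= s0; last by rewrite andbF.
  by rewrite andbT; case: leP => // /ltW sS; rewrite g'S.
rewrite integral_itv_bndo_bndc; last first.
  by apply/measurable_EFinP; apply: measurable_funTS; exact: continuous_measurable_fun.
rewrite (@continuous_FTC2 _ g' g).
- by rewrite gS sube0.
- by rewrite oppr_lt0.
- exact: continuous_subspaceT.
- split.
  + by move=> s; rewrite in_itv/= => /andP[_ s0]; have [] := gd s s0.
  + by apply: cvg_at_right_filter; exact: cg.
  + by apply: cvg_at_left_filter; exact: cg.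
- move=> s; rewrite in_itv/= => /andP[_ s0]; have [_ <-] := gd s s0.
  by rewrite derive1E.
Qed.

Lemma continuous_section G t : continuous G -> continuous (fun s => G (t, s)).
Proof.
move=> cG s; apply: (@continuous_comp _ _ _ (fun s : R => (t, s)) G); last exact: cG.
by apply: continuous_pair; [exact: cst_continuous|exact: cvg_id].
Qed.

Lemma continuous_slice G s : continuous G -> continuous (fun t => G (t, s)).
Proof.
move=> cG t; apply: (@continuous_comp _ _ _ (fun t : 'rV[R]_d => (t, s)) G); last exact: cG.
by apply: continuous_pair; [exact: cvg_id|exact: cst_continuous].
Qed.

(** Fubini with the depth innermost: the fundamental theorem of calculus leaves the value at
    [s = 0], the value at depth [S] being zero. *)
Lemma cyl_int_vertical S G G' : 0 < S -> continuous G -> continuous G' ->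
  (forall t (s : R), unit_cube t -> s < 0 ->
    is_derive s 1 (fun s => G (row_of_tuple t, s)) (G' (row_of_tuple t, s))) ->
  (forall t, unit_cube t -> G (row_of_tuple t, - S) = 0) ->
  supported S G' ->
  cyl_int G' = cube_int (fun x => G (x, 0)).
Proof.
move=> S0 cG cG' GG' GS G'S; rewrite /cyl_int /cube_int /Rintegral; congr fine.
rewrite integral_rectangle12//; last 2 first.
- exact: measurable_unit_cube.
- exact: supported_integrable G'S.
apply: eq_integral => t /set_mem ct.
apply: (@ftc_supported (fun s => G (row_of_tuple t, s))
  (fun s => G' (row_of_tuple t, s)) S) => //.
- exact: continuous_section.
- exact: continuous_section.
- by move=> s s0; exact: GG'.
- exact: GS.
- by move=> s sS; exact: G'S.
Qed.

Lemma cyl_int_slices0 S G : 0 < S -> continuous G -> supported S G ->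
  (forall s, s < 0 -> cube_int (fun x => G (x, s)) = 0) -> cyl_int G = 0.
Proof.
move=> S0 cG GS G0; rewrite /cyl_int /Rintegral integral_rectangle21//; last 2 first.
- exact: measurable_unit_cube.
- exact: supported_integrable GS.
rewrite (eq_integral (cst 0%E)) ?integral_cst ?mul0e// => s.
rewrite inE/= in_itv/= => s0.
have := integral_cube (@continuous_slice G s cG).
by rewrite (G0 s s0).
Qed.

End box.

(** * Derivatives of periodic functions have mean zero *)

Section cube_derivative.
Context {R : realType}.
Local Notation mR := (measurableTypeR R).

Definition row_cons n (z : R * 'rV[R]_n) : 'rV[R]_n.+1 :=
  \row_i if unlift ord0 i is Some j then z.2 0 j else z.1.

Lemma continuous_row_cons n : continuous (@row_cons n).
Proof.
move=> z; apply: continuous_row => i.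
case: (unliftP ord0 i) => [j|] ij.
  rewrite (_ : (fun w => _) = (fun w : R * 'rV[R]_n => w.2 0 j)).
    apply: (@continuous_comp _ _ _ snd (fun v : 'rV[R]_n => v 0 j)); first exact: cvg_snd.
    exact: coord_continuous.
  by apply/funext => w; rewrite mxE ij liftK.
rewrite (_ : (fun w => _) = (fun w : R * 'rV[R]_n => w.1)); first exact: cvg_fst.
by apply/funext => w; rewrite mxE ij unlift_none.
Qed.

Lemma row_of_cons n x (t : n.-tuple mR) :
  row_of_tuple (cons_pair (x, t)) = row_cons (x, row_of_tuple t).
Proof.
apply/rowP => i; rewrite !mxE; case: (unliftP ord0 i) => [j|] -> /=.
  by rewrite mxE tnthS.
by rewrite tnth0.
Qed.

(** The measure on [n.+1]-tuples is by construction the image of a product measure under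
    [cons_pair], which exposes the first coordinate to Fubini. *)
Lemma integral_cubeS n (f : 'rV[R]_n.+1 -> R) : continuous f ->
  let g (p : mR * n.-tuple mR) := f (row_cons (p.1, row_of_tuple p.2)) in
  (@lebesgue_measure R \x lebesgue_tuple R n)%E.-integrable
    (`[0, 1[ `*` unit_cube) (EFin \o g) /\
  (\int[lebesgue_tuple R n.+1]_(t in unit_cube) (f (row_of_tuple t))%:E =
   \int[@lebesgue_measure R \x lebesgue_tuple R n]_(p in `[0%R, 1%R[ `*` unit_cube)
     (g p)%:E)%E.
Proof.
move=> cf g.
have mE : measurable (`[(0 : R), 1[ `*` (@unit_cube R n)).
  by apply: measurableX => //; exact: measurable_unit_cube.
have gE : g = (f \o row_of_tuple) \o @cons_pair R n.
  by apply/funext => -[x t]; rewrite /= row_of_cons.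
have mg : measurable_fun setT g.
  rewrite gE; apply: measurableT_comp; first exact: measurable_continuous_tuple.
  exact: measurable_cons_pair.
have preE : @cons_pair R n @^-1` unit_cube = `[(0 : R), 1[ `*` unit_cube.
  apply/seteqP; split => -[x t] /=; rewrite /unit_cube/= in_itv/=.
    move=> h; split; first by have := h ord0; rewrite tnth0.
    by move=> i; have := h (lift ord0 i); rewrite tnthS.
  by move=> [hx ht] i; case: (unliftP ord0 i) => [j|] ->; rewrite ?tnthS ?tnth0.
have gi : (@lebesgue_measure R \x lebesgue_tuple R n)%E.-integrable
    (`[0, 1[ `*` unit_cube) (EFin \o g).
  apply: measurable_bounded_integrable => //.
  - suff : ((@lebesgue_measure R \x lebesgue_tuple R n) (`[0%R, 1%R[ `*` unit_cube) < +oo)%E by [].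
    have -> : ((@lebesgue_measure R \x lebesgue_tuple R n) (`[0%R, 1%R[ `*` unit_cube) =
        @lebesgue_measure R `[0%R, 1%R[ * lebesgue_tuple R n unit_cube)%E.
      by apply: product_measure1E => //; exact: measurable_unit_cube.
    by rewrite lebesgue_tuple_cube mule1 lebesgue_measure_itv/=; case: ifP => _; rewrite ?ltry.
  - exact: measurable_funTS.
  have [C hC] := bounded_on_cube cf.
  exists C; split; first exact: num_real.
  move=> x Cx p /=; rewrite -/(unit_cube p.2) => pE.
  apply: le_trans (ltW Cx); rewrite gE; apply: hC.
  by have : (@cons_pair R n @^-1` unit_cube) p by rewrite preE.
split => //.
transitivity (\int[pushforward (@lebesgue_measure R \x lebesgue_tuple R n)%E
  (@cons_pair R n)]_(t in unit_cube) (f (row_of_tuple t))%:E)%E.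
  apply: eq_measure_integral => [|mc B mB BC]; first exact: measurable_cons_pair.
  by [].
rewrite integral_pushforward.
- rewrite preE; apply: eq_integral => -[x t] _; rewrite /g/=.
  by rewrite row_of_cons.
- exact: measurable_cons_pair.
- by apply/measurable_EFinP; exact: measurable_continuous_tuple.
- rewrite preE; move: gi; rewrite gE; exact.
- exact: measurable_unit_cube.
Qed.

Lemma row_consZl n (x : R) (v : 'rV[R]_n) :
  row_cons (x, v) = x *: delta_mx 0 ord0 + row_cons (0, v).
Proof.
apply/rowP => i; rewrite !mxE eqxx; case: (unliftP ord0 i) => [j|] -> /=.
  by rewrite mulr0 add0r.
by rewrite mulr1 addr0.
Qed.

Lemma row_consZr n (x k : R) (j : 'I_n) (v : 'rV[R]_n) :
  row_cons (x, k *: delta_mx 0 j + v) =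
  k *: delta_mx 0 (lift ord0 j) + row_cons (x, v).
Proof.
apply/rowP => i; rewrite !mxE eqxx; case: (unliftP ord0 i) => [l|] -> /=.
  by rewrite !mxE eqxx (inj_eq lift_inj).
by rewrite mulr0 add0r.
Qed.

(** Induction on the dimension. If [j] is the first coordinate, that variable is integrated first
    and periodicity cancels the two end values; otherwise the first coordinate is frozen and the
    induction hypothesis handles the others. *)
Lemma cube_int_derive n (f f' : 'rV[R]_n -> R) (j : 'I_n) :
  continuous f -> continuous f' ->
  (forall t, is_derive t (delta_mx 0 j) f (f' t)) ->
  (forall t, f (delta_mx 0 j + t) = f t) ->
  cube_int f' = 0.
Proof.
elim: n f f' j => [f f' []//|n ih f f' j] cf cf' ff' fper.
have [gi gE] := integral_cubeS cf'; rewrite /cube_int /Rintegral gE.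
case: (unliftP ord0 j) => [i|] ij.
  rewrite integral_rectangle12//; last exact: measurable_unit_cube.
  rewrite (eq_integral (cst 0%E)) ?integral_cst ?mul0e// => x _.
  have cc (F : 'rV[R]_n.+1 -> R) : continuous F -> continuous (fun v => F (row_cons (x, v))).
    move=> cF v; apply: (@continuous_comp _ _ _ (fun v : 'rV[R]_n => row_cons (x, v)) F).
      apply: (@continuous_comp _ _ _ (fun v : 'rV[R]_n => (x, v)) (@row_cons n)).
        by apply: continuous_pair; [exact: cst_continuous|exact: cvg_id].
      exact: continuous_row_cons.
    exact: cF.
  have := integral_cube (cc _ cf'); rewrite /= => ->; congr (_%:E).
  apply: (ih (fun v => f (row_cons (x, v))) _ i) => //; do ?exact: cc.
    move=> v; apply/is_derive_lineP.
    have := ff' (row_cons (x, v)); rewrite ij => /is_derive_lineP.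
    by under eq_fun do rewrite -row_consZr.
  by move=> v; rewrite -[X in X + v]scale1r row_consZr scale1r -ij fper.
rewrite integral_rectangle21//; last exact: measurable_unit_cube.
rewrite (eq_integral (cst 0%E)) ?integral_cst ?mul0e//; first exact: measurable_unit_cube.
move=> t _; set v := row_of_tuple t.
have cc (F : 'rV[R]_n.+1 -> R) : continuous F -> continuous (fun x => F (row_cons (x, v))).
  move=> cF x; apply: (@continuous_comp _ _ _ (fun x : R => row_cons (x, v)) F).
    apply: (@continuous_comp _ _ _ (fun x : R => (x, v)) (@row_cons n)).
      by apply: continuous_pair; [exact: cvg_id|exact: cst_continuous].
    exact: continuous_row_cons.
  exact: cF.
have gd (x : R) : is_derive x 1 (fun x : R => f (row_cons (x, v))) (f' (row_cons (x, v))).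
  have := ff' (row_cons (x, v)); rewrite {1}row_consZl ij => /is_derive_line.
  by under eq_fun do rewrite -row_consZl.
rewrite /= integral_itv_bndo_bndc; last first.
  by apply/measurable_EFinP; apply: measurable_funTS;
    apply: continuous_measurable_fun; exact: cc.
rewrite (@continuous_FTC2 _ (fun x => f' (row_cons (x, v))) (fun x => f (row_cons (x, v)))).
- rewrite [in X in (X - _)%E]row_consZl scale1r -ij fper.
  by rewrite subee.
- exact: ltr01.
- by apply: continuous_subspaceT; exact: cc.
- split.
  + by move=> x _; have [] := gd x.
  + by apply: cvg_at_right_filter; exact: cc.
  + by apply: cvg_at_left_filter; exact: cc.
- by move=> x _; have [_ <-] := gd x; rewrite derive1E.
Qed.

End cube_derivative.

Section cylinder.
Context {R : realType} {d : nat}.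
Local Notation mR := (measurableTypeR R).
Local Notation mu := (lebesgue_tuple R d).
Local Notation lam := (@lebesgue_measure R).
Local Notation P := (lebesgue_tuple R d \x @lebesgue_measure R)%E.
Implicit Types (G : 'rV[R]_d * R -> R) (f : 'rV[R]_d -> R).

Lemma integral_cyl G : cyl_integrable G ->
  (\int[P]_(p in half_cylinder) (on_tuples G p)%:E = (cyl_int G)%:E)%E.
Proof.
move=> Gi; rewrite /cyl_int /Rintegral fineK//.
exact: (integrable_fin_num measurable_half_cylinder Gi).
Qed.

(** A positive value persists, up to a factor [2], on a small box of positive measure, which would
    make the integral positive. *)
Lemma cyl_int_eq0 G : continuous G -> cyl_integrable G ->
  (forall t s, unit_cube t -> s < 0 -> 0 <= G (row_of_tuple t, s)) ->
  cyl_int G = 0 ->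
  forall t s, unit_cube t -> s < 0 -> G (row_of_tuple t, s) = 0.
Proof.
move=> cG Gi G0 intG0 t0 s0 ct0 s00; apply/eqP.
have := G0 _ _ ct0 s00; rewrite le_eqVlt => /predU1P[<-//|c0].
set c := G _ in c0.
have c20 : 0 < c / 2 by rewrite divr_gt0.
have /cvgrPdist_le /(_ _ c20) := cG (row_of_tuple t0, s0).
case=> -[/= U W] [/nbhs_ballP[r /= r0 rU] /nbhs_ballP[r' /= r'0 rW]] UW.
(* The unit cube contains only its lower faces, so the box extends upwards from [t0] and is cut at
   [1]; in depth it extends downwards from [s0], away from the level [0]. *)
pose J i : set mR := `[tnth t0 i, tnth t0 i + Num.min (r / 2) (1 - tnth t0 i)[%classic.
pose K : set mR := `]s0 - r', s0[%classic.
pose box := [set t : d.-tuple mR | forall i, J i (tnth t i)].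
have mJ i : measurable (J i) by exact: measurable_itv.
have mbox : measurable box by exact: measurable_box.
have mK : measurable K by exact: measurable_itv.
have mE : measurable (box `*` K) by exact: measurableX.
have ED : box `*` K `<=` half_cylinder.
  move=> -[t s] [/= tb]; rewrite /K/= in_itv/= => /andP[_ ss0].
  split; last by rewrite /= in_itv/= (lt_trans ss0).
  move=> i; have /andP[t00 t01] := ct0 i; have := tb i.
  rewrite /J/= in_itv/= => /andP[t0t tr]; rewrite (le_trans t00 t0t)/=.
  rewrite (lt_le_trans tr)// -lerBrDl ge_min; apply/orP; right.
  by rewrite lexx.
have GE p : (box `*` K) p -> c / 2 <= on_tuples G p.
  move=> -[tb Ks]; have : `|c - G (row_of_tuple p.1, p.2)| <= c / 2.
    apply: (UW (row_of_tuple p.1, p.2)); split => /=.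
      apply: rU; rewrite -ball_normE/=; apply: (@le_lt_trans _ _ (r / 2)); last by lra.
      apply/row_mx_norm_le; first by rewrite divr_ge0// ltW.
      move=> i; rewrite !mxE; have := tb i; rewrite /J/= in_itv/= => /andP[t1 t2].
      rewrite distrC ger0_norm ?subr_ge0// lerBlDl ltW// (lt_le_trans t2)// lerD2l.
      by rewrite ge_min lexx.
    apply: rW; move: Ks; rewrite /K /= in_itv/= -ball_normE/= => /andP[s1 s2].
    rewrite ger0_norm ?subr_ge0 ?ltW//; lra.
  rewrite ler_distl => /andP[_]; rewrite /on_tuples; lra.
have PE : (0 < P (box `*` K))%E.
  have -> : (P (box `*` K) = lebesgue_tuple R d box * lam K)%E by exact: product_measure1E.
  rewrite /box lebesgue_tuple_box// mule_gt0//; last first.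
    rewrite /K lebesgue_measure_itv/= lte_fin ltrBlDr ltrDl r'0 -EFinD lte_fin; lra.
  elim/big_ind : _ => //; first exact: mule_gt0.
  move=> i _; rewrite /J lebesgue_measure_itv/= lte_fin ltrDl.
  have /andP[t00 t01] := ct0 i.
  have m0 : 0 < Num.min (r / 2) (1 - tnth t0 i) by rewrite lt_min divr_gt0// subr_gt0.
  by rewrite m0 -EFinD lte_fin addrAC subrr add0r.
have : ((c / 2)%:E * P (box `*` K) <= (cyl_int G)%:E)%E.
  rewrite -integral_cyl//.
  have mG : measurable_fun setT (on_tuples G) by exact: measurable_continuous_pair.
  apply: (@le_trans _ _ (\int[P]_(p in box `*` K) (on_tuples G p)%:E)%E); last first.
    apply: ge0_subset_integral => //; first exact: measurable_half_cylinder.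
      by apply/measurable_EFinP; exact: measurable_funTS.
    by move=> p [ct ps]; rewrite lee_fin G0//; move: ps; rewrite /= in_itv.
  rewrite -integral_cst//; apply: ge0_le_integral => //.
  - by move=> p _; rewrite lee_fin ltW.
  - by apply/measurable_EFinP; exact: measurable_funTS.
by rewrite intG0 leNgt => /negP[]; rewrite mule_gt0.
Qed.

Lemma integral_shift_ray (g : R -> R) (k : R) : continuous g ->
  (forall s, 0 <= g s) ->
  (\int[lam]_(s in `]-oo, k[) (g s)%:E =
   \int[lam]_(s in `]-oo, 0%R[) (g (k + s))%:E)%E.
Proof.
move=> cg g0.
have mg : measurable_fun setT g by exact: continuous_measurable_fun.
have ck : continuous (fun s : R => g (k + s)).
  move=> s; apply: (@continuous_comp _ _ _ (fun s : R => k + s) g); last exact: cg.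
  by apply: cvgD; [exact: cvg_cst|exact: cvg_id].
have kd (s : R) : is_derive s 1 (fun s : R => k + s) 1.
  have h : is_derive s 1 (cst k + id : R -> R) (0 + 1) by exact: is_deriveD.
  by rewrite add0r in h; exact: h.
have kE : (fun s : R => k + s)^`()%classic = cst 1.
  by apply/funext => s; have [_ e] := kd s; rewrite derive1E e.
rewrite integral_itv_bndo_bndc; last by apply/measurable_EFinP; exact: measurable_funTS.
rewrite [RHS]integral_itv_bndo_bndc; last first.
  by apply/measurable_EFinP; apply: measurable_funTS; exact: continuous_measurable_fun.
have := @increasing_ge0_integration_by_substitutionNy R (fun s : R => k + s) g 0.
rewrite kE addr0 => -> //.
- by apply: eq_integral => s _; rewrite /= mulr1.
- by move=> x y _ _ xy; rewrite ltrD2l.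
- by move=> x _; exact: cst_continuous.
- exact: is_cvg_cst.
- exact: cvg_cst.
- split; first by move=> x _; have [] := kd x.
  apply: cvg_at_left_filter; apply: cvgD; [exact: cvg_cst|exact: cvg_id].
- apply/cvgrNyPle => A; near=> x; rewrite -lerBrDl; near: x.
  by apply: nbhs_ninfty_le; exact: num_real.
- exact: continuous_subspaceT.
Unshelve. all: by end_near. Qed.

(** At each [t] the map [s |-> k t + s] is a translation, so Tonelli and [integral_shift_ray]
    suffice and no Jacobian enters. Both sides may be [+oo]. *)
Lemma integral_subgraph (k : 'rV[R]_d -> R) G : continuous k -> continuous G ->
  (forall z, 0 <= G z) ->
  measurable [set p : d.-tuple mR * mR | unit_cube p.1 /\ p.2 < k (row_of_tuple p.1)] /\
  (\int[P]_(p in [set p | unit_cube p.1 /\ (p.2 < k (row_of_tuple p.1))%R])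
     (G (row_of_tuple p.1, p.2))%:E =
  \int[P]_(p in half_cylinder)
     (G (row_of_tuple p.1, k (row_of_tuple p.1) + p.2)%R)%:E)%E.
Proof.
move=> ck cG G0.
have ck1 : continuous (fun z : 'rV[R]_d * R => z.2 - k z.1).
  move=> z; apply: cvgB; first exact: cvg_snd.
  by apply: (@continuous_comp _ _ _ fst k); [exact: cvg_fst|exact: ck].
set E := [set p | _].
have mE : measurable E.
  have -> : E = (unit_cube `*` setT) `&`
      (fun p : d.-tuple mR * mR => p.2 - k (row_of_tuple p.1)) @^-1` `]-oo, 0[.
    apply/seteqP; split => -[t s] /=; rewrite in_itv/= subr_lt0.
      by move=> -[].
    by move=> [[]].
  apply: measurableI; first by apply: measurableX => //; exact: measurable_unit_cube.
  rewrite -[X in measurable X]setTI.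
  exact: (measurable_continuous_pair ck1).
have ckG : continuous (fun z : 'rV[R]_d * R => G (z.1, k z.1 + z.2)).
  move=> z; apply: (@continuous_comp _ _ _ (fun z : 'rV[R]_d * R => (z.1, k z.1 + z.2)) G).
    apply: continuous_pair; first exact: cvg_fst.
    apply: cvgD; last exact: cvg_snd.
    by apply: (@continuous_comp _ _ _ fst k); [exact: cvg_fst|exact: ck].
  exact: cG.
split => //.
rewrite integral_mkcond [RHS]integral_mkcond.
rewrite fubini_tonelli1; last 2 first.
- apply/(measurable_restrictT _ mE)/measurable_EFinP/measurable_funTS.
  exact: measurable_continuous_pair.
- by move=> p; rewrite patchE; case: ifP => _ //; rewrite lee_fin.
rewrite fubini_tonelli1; last 2 first.
- apply/(measurable_restrictT _ measurable_half_cylinder)/measurable_EFinP/measurable_funTS.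
  exact: (measurable_continuous_pair ckG).
- by move=> p; rewrite patchE; case: ifP => _ //; rewrite lee_fin.
apply: eq_integral => t _; rewrite /fubini_F.
case: (pselect (unit_cube t)) => ct.
  transitivity (\int[lam]_(s in `]-oo, k (row_of_tuple t)[) (G (row_of_tuple t, s))%:E)%E.
    rewrite [RHS]integral_mkcond; apply: eq_integral => s _; rewrite !patchE.
    suff -> : ((t, s) \in E) = (s \in `]-oo, k (row_of_tuple t)[%classic) by [].
    rewrite mem_setE in_itv/=; apply/idP/idP => [/set_mem[]//|sk].
    exact/mem_set.
  rewrite integral_shift_ray//; last exact: continuous_section.
  rewrite [LHS]integral_mkcond; apply: eq_integral => s _; rewrite !patchE.
  by rewrite in_setX (mem_set ct).
rewrite !integral0_eq// => s _; rewrite patchE memNset//; by move=> [].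
Qed.

End cylinder.

Lemma is_derive_row {R : realType} {n : nat} (c : R -> 'rV[R]_n) (c' : 'rV[R]_n) (s : R) :
  (forall i, is_derive s 1 (fun k => c k 0 i) (c' 0 i)) -> is_derive s 1 c c'.
Proof.
move=> cd; have dc : derivable c s 1.
  by apply/derivable_mxP => i j; rewrite ord1; have [] := cd j.
split => //; rewrite derive_mx//; apply/rowP => j; rewrite mxE.
by have [_ ->] := cd j.
Qed.

Section linear_integrals.
Context {R : realType} {d : nat}.
Implicit Types (G : 'rV[R]_d * R -> R) (f : 'rV[R]_d -> R).

Lemma cube_intD f g : continuous f -> continuous g ->
  cube_int (fun t => f t + g t) = cube_int f + cube_int g.
Proof.
move=> cf cg; apply: RintegralD; first exact: measurable_unit_cube.
  exact: (cube_integrable cf).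
exact: (cube_integrable cg).
Qed.

Lemma cube_intB f g : continuous f -> continuous g ->
  cube_int (fun t => f t - g t) = cube_int f - cube_int g.
Proof.
move=> cf cg; apply: RintegralB; first exact: measurable_unit_cube.
  exact: (cube_integrable cf).
exact: (cube_integrable cg).
Qed.

Lemma cube_intZ k f : continuous f -> cube_int (fun t => k * f t) = k * cube_int f.
Proof.
move=> cf; apply: RintegralZl; first exact: measurable_unit_cube.
exact: (cube_integrable cf).
Qed.

Lemma eq_cube_int f g : (forall t, unit_cube t -> f (row_of_tuple t) = g (row_of_tuple t)) ->
  cube_int f = cube_int g.
Proof. by move=> fg; apply: eq_Rintegral => t /set_mem ct; exact: fg. Qed.

Lemma le_cube_int f g : continuous f -> continuous g ->
  (forall t, unit_cube t -> f (row_of_tuple t) <= g (row_of_tuple t)) ->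
  cube_int f <= cube_int g.
Proof.
move=> cf cg fg; apply: le_Rintegral => //; first exact: measurable_unit_cube.
  exact: (cube_integrable cf).
exact: (cube_integrable cg).
Qed.

Lemma cube_int_cst (k : R) : @cube_int R d (fun=> k) = k.
Proof.
rewrite /cube_int Rintegral_cst; last exact: measurable_unit_cube.
by have /= -> := @lebesgue_tuple_cube R d; rewrite mulr1.
Qed.

Lemma cube_int_sum (I : Type) (r : seq I) (f : I -> 'rV[R]_d -> R) :
  (forall i, continuous (f i)) ->
  cube_int (fun t => \sum_(i <- r) f i t) = \sum_(i <- r) cube_int (f i).
Proof.
move=> cf; elim: r => [|i r ih].
  by under eq_fun do rewrite big_nil; rewrite big_nil cube_int_cst.
under eq_fun do rewrite big_cons; rewrite big_cons cube_intD ?ih//.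
exact: continuous_bigsum.
Qed.

Lemma cyl_intD F G : cyl_integrable F -> cyl_integrable G ->
  cyl_int (fun z => F z + G z) = cyl_int F + cyl_int G.
Proof. by move=> iF iG; apply: RintegralD => //; exact: measurable_half_cylinder. Qed.

Lemma cyl_intB F G : cyl_integrable F -> cyl_integrable G ->
  cyl_int (fun z => F z - G z) = cyl_int F - cyl_int G.
Proof. by move=> iF iG; apply: RintegralB => //; exact: measurable_half_cylinder. Qed.

Lemma cyl_intZ k G : cyl_integrable G ->
  cyl_int (fun z => k * G z) = k * cyl_int G.
Proof. by move=> iG; apply: RintegralZl => //; exact: measurable_half_cylinder. Qed.

Lemma cyl_integrableZ k G : cyl_integrable G -> cyl_integrable (fun z => k * G z).
Proof.
move=> iG; have := integrableZl measurable_half_cylinder k iG.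
by apply: eq_integrable => [|p _]; [exact: measurable_half_cylinder|rewrite /= EFinM].
Qed.

Lemma cyl_integrableD F G : cyl_integrable F -> cyl_integrable G ->
  cyl_integrable (fun z => F z + G z).
Proof.
move=> iF iG; have := integrableD measurable_half_cylinder iF iG.
by apply: eq_integrable => [|p _]; [exact: measurable_half_cylinder|rewrite /= EFinD].
Qed.

Lemma eq_cyl_int F G :
  (forall t s, unit_cube t -> s < 0 -> F (row_of_tuple t, s) = G (row_of_tuple t, s)) ->
  cyl_int F = cyl_int G.
Proof.
move=> FG; apply: eq_Rintegral => -[t s] /set_mem [/= ct].
by rewrite in_itv/= => s0; exact: FG.
Qed.

Lemma le_cyl_int F G : cyl_integrable F -> cyl_integrable G ->
  (forall t s, unit_cube t -> s < 0 -> F (row_of_tuple t, s) <= G (row_of_tuple t, s)) ->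
  cyl_int F <= cyl_int G.
Proof.
move=> iF iG FG; apply: le_Rintegral => //; first exact: measurable_half_cylinder.
by move=> -[t s] [/= ct]; rewrite in_itv/= => s0; exact: FG.
Qed.

Lemma cyl_int_sum (I : Type) (r : seq I) (G : I -> 'rV[R]_d * R -> R) S :
  0 < S -> (forall i, continuous (G i)) -> (forall i, supported S (G i)) ->
  cyl_int (fun z => \sum_(i <- r) G i z) = \sum_(i <- r) cyl_int (G i).
Proof.
move=> S0 cG sG; elim: r => [|i r ih].
  under eq_fun do rewrite big_nil; rewrite big_nil.
  rewrite (_ : (fun=> 0) = (fun z : 'rV[R]_d * R => 0 * cst 0 z)); last first.
    by apply/funext => z; rewrite mul0r.
  rewrite cyl_intZ ?mul0r//; apply: (supported_integrable S0); first exact: cst_continuous.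
  by move=> t s.
under eq_fun do rewrite big_cons; rewrite big_cons cyl_intD ?ih//.
  exact: (supported_integrable S0).
apply: (supported_integrable S0); first exact: continuous_bigsum.
by move=> t s ct sS; apply: big1 => j _; exact: sG.
Qed.

End linear_integrals.

(** * The region below a graph *)

Section graph.
Context {R : realType} {d : nat}.
Variable h : 'rV[R]_d -> R.
Hypothesis h_smooth : smooth_on setT h.
Local Notation e_ i := (delta_mx 0 i).
Implicit Types (f : 'rV[R]_(d + 1) -> R) (x : 'rV[R]_d).

Definition graph_map (z : 'rV[R]_d * R) : 'rV[R]_(d + 1) :=
  xy_point z.1 (h z.1 + z.2).

Lemma xy_point_x x (y : R) i : xy_point x y 0 (lshift 1 i) = x 0 i.
Proof. by rewrite row_mxEl. Qed.

Lemma xy_point_y x (y : R) : xy_point x y 0 ycoord = y.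
Proof. by rewrite row_mxEr !mxE eqxx. Qed.

Lemma lsubmx_xy_point x (y : R) : lsubmx (xy_point x y) = x.
Proof. exact: row_mxKl. Qed.

Lemma xy_point_eta (z : 'rV[R]_(d + 1)) : xy_point (lsubmx z) (z 0 ycoord) = z.
Proof.
rewrite -[RHS]hsubmxK; congr row_mx; apply/rowP => i; rewrite ord1 !mxE eqxx.
by congr (z 0 _); apply/val_inj.
Qed.

Lemma ord_add1P (i : 'I_(d + 1)) :
  (exists j, i = lshift 1 j) \/ i = ycoord.
Proof.
case: (fintype.split_ordP i) => [j ->|j ->]; first by left; exists j.
by right; congr rshift; exact: ord1.
Qed.

Lemma lshift_neq_ycoord (i : 'I_d) : (lshift 1 i == ycoord) = false.
Proof. exact: eq_lrshift. Qed.

Lemma xy_pointD x w (y k : R) : xy_point (w + x) (k + y) = xy_point w k + xy_point x y.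
Proof. by rewrite /xy_point raddfD add_row_mx. Qed.

Lemma xy_pointy (k : R) : xy_point 0 k = k *: (e_ ycoord : 'rV[R]_(d + 1)).
Proof.
apply/rowP => i; rewrite [RHS]mxE mulrC; case: (ord_add1P i) => [[j]|] ->.
  by rewrite xy_point_x !mxE lshift_neq_ycoord mul0r.
by rewrite xy_point_y mxE !eqxx mul1r.
Qed.

Lemma continuous_xy_point : continuous (fun z : 'rV[R]_d * R => xy_point z.1 z.2).
Proof.
move=> z; apply: continuous_row => i; case: (ord_add1P i) => [[j]|] ->.
  rewrite (_ : (fun w => _) = (fun w : 'rV[R]_d * R => w.1 0 j)).
    apply: (@continuous_comp _ _ _ fst (fun v : 'rV[R]_d => v 0 j)); first exact: cvg_fst.
    exact: coord_continuous.
  by apply/funext => w; rewrite xy_point_x.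
rewrite (_ : (fun w => _) = (fun w : 'rV[R]_d * R => w.2)); first exact: cvg_snd.
by apply/funext => w; rewrite xy_point_y.
Qed.

Lemma continuous_lsubmx1 : continuous (@lsubmx R 1 d 1).
Proof.
move=> v; apply: continuous_row => i.
rewrite (_ : (fun w => _) = (fun w : 'rV[R]_(d + 1) => w 0 (lshift 1 i))).
  exact: coord_continuous.
by apply/funext => w; rewrite mxE.
Qed.

Lemma smooth_continuous : continuous h.
Proof. by move=> x; have [] := h_smooth [::] (I : setT x). Qed.

Lemma smooth_partial_continuous i : continuous (partial i h).
Proof. by move=> x; have [] := h_smooth [:: i] (I : setT x). Qed.

Lemma smooth_partial2_continuous i j : continuous (partial i (partial j h)).
Proof. by move=> x; have [] := h_smooth [:: i; j] (I : setT x). Qed.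

Lemma smooth_is_derive x i : is_derive x (e_ i) h (partial i h x).
Proof. by have [_ hd] := h_smooth [::] (I : setT x); exact/derivableP. Qed.

Lemma smooth_is_derive2 x i j : is_derive x (e_ i) (partial j h) (partial i (partial j h) x).
Proof. by have [_ hd] := h_smooth [:: j] (I : setT x); exact/derivableP. Qed.

Lemma continuous_graph_map : continuous graph_map.
Proof.
move=> z; apply: (@continuous_comp _ _ _ (fun z : 'rV[R]_d * R => (z.1, h z.1 + z.2))
  (fun z => xy_point z.1 z.2)); last exact: continuous_xy_point.
apply: continuous_pair; first exact: cvg_fst.
apply: cvgD; last exact: cvg_snd.
by apply: (@continuous_comp _ _ _ fst h); [exact: cvg_fst|exact: smooth_continuous].
Qed.

Lemma subgraph_graph_map x (s : R) : s < 0 -> subgraph h (graph_map (x, s)).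
Proof. by move=> s0; rewrite /subgraph/= lsubmx_xy_point xy_point_y gtrDl. Qed.

Lemma open_subgraph : open (subgraph h).
Proof.
rewrite (_ : subgraph h =
    (fun z : 'rV[R]_(d + 1) => z 0 ycoord - h (lsubmx z)) @^-1` [set y | y < 0]).
  apply: open_comp; last exact: open_lt.
  move=> z _; apply: continuous_funB; first exact: coord_continuous.
  apply: (continuous_funcomp continuous_lsubmx1); exact: smooth_continuous.
by apply/seteqP; split => z /=; rewrite subr_lt0.
Qed.

Lemma near_subgraph z : subgraph h z -> \forall y \near z, subgraph h y.
Proof. by move=> hz; apply: open_nbhs_nbhs; split => //; exact: open_subgraph. Qed.

(** Continuity holds on the whole space, while [df] is a derivative of [f] only below the graph:
    such functions are continuous extensions from the open region, and their values on the graph are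
    the boundary values. *)
Definition C1 f (df : 'I_(d + 1) -> 'rV[R]_(d + 1) -> R) :=
  [/\ continuous f, forall i, continuous (df i) &
      forall z, subgraph h z -> forall i, is_derive z (e_ i) f (df i z)].

Lemma is_derive_vertical f df x (s : R) : C1 f df -> s < 0 ->
  is_derive s 1 (fun s => f (graph_map (x, s))) (df ycoord (graph_map (x, s))).
Proof.
move=> [_ _ fd] s0.
have gE k : graph_map (x, k) = k *: e_ ycoord + graph_map (x, 0).
  by rewrite /graph_map/= -xy_pointy -xy_pointD add0r addr0 addrC.
have := fd _ (subgraph_graph_map x s0) ycoord; rewrite {1}gE => /is_derive_line.
by under eq_fun do rewrite -gE.
Qed.

(** Derivative along [(e_i, d_i h)], which is tangent to every vertical translate of the graph. *)
Definition graph_deriv (df : 'I_(d + 1) -> 'rV[R]_(d + 1) -> R) i (z : 'rV[R]_d * R) :=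
  df (lshift 1 i) (graph_map z) + partial i h z.1 * df ycoord (graph_map z).

Lemma continuous_graph_deriv df i : (forall i, continuous (df i)) ->
  continuous (graph_deriv df i).
Proof.
move=> cdf; apply: continuous_funD.
  exact: (continuous_funcomp continuous_graph_map).
apply: continuous_funM; last exact: (continuous_funcomp continuous_graph_map).
by apply: (continuous_funcomp (f := fst)); [move=> z; exact: cvg_fst|
  exact: smooth_partial_continuous].
Qed.

Lemma is_derive_graph f df x w (s : R) : C1 f df -> s < 0 ->
  is_derive x w (fun x => f (graph_map (x, s))) (\sum_i w 0 i * graph_deriv df i (x, s)).
Proof.
move=> [cf cdf fd] s0; apply/is_derive_lineP.
pose c (k : R) := graph_map (k *: w + x, s).
have c0 : c 0 = graph_map (x, s) by rewrite /c scale0r add0r.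
have hd : is_derive (0 : R) 1 (fun k : R => h (k *: w + x)) (\sum_i w 0 i * partial i h x).
  have wd : is_derive (0 : R) 1 (fun k : R => k *: w + x) w.
    apply: is_derive_row => i.
    by under eq_fun do rewrite !mxE; exact: is_derive_affine.
  have := @is_derive_partials _ _ h (fun i => partial i h) _ _ 0 _ _ wd.
  rewrite scale0r add0r; apply.
    by near=> y => i; exact: smooth_is_derive.
  by move=> i; exact: smooth_partial_continuous.
have cd : is_derive (0 : R) 1 c (xy_point w (\sum_i w 0 i * partial i h x)).
  apply: is_derive_row => i; case: (ord_add1P i) => [[j]|] ->.
    rewrite xy_point_x; under eq_fun do rewrite xy_point_x !mxE.
    exact: is_derive_affine.
  rewrite xy_point_y; under eq_fun do rewrite xy_point_y.
  by apply: is_derive_eq (is_derive_funD hd (is_derive_funcst _ _ _)) _; rewrite addr0.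
have := @is_derive_partials _ _ f df _ _ 0 _ _ cd.
rewrite c0 big_split_ord/= big_ord1 => fcd.
apply: is_derive_eq (fcd _ _) _.
- by near=> y => i; apply: fd; near: y; apply: near_subgraph; exact: subgraph_graph_map.
- by move=> i; exact: cdf.
under eq_bigr do rewrite xy_point_x.
rewrite xy_point_y big_distrl -big_split/=; apply: eq_bigr => i _.
by rewrite /graph_deriv mulrDr mulrA.
Unshelve. all: by end_near. Qed.

(** The partial derivatives of [f] are given only below the graph. The tangential derivative on the
    graph is the limit of those on its downward translates, by [is_derive_trace]. *)
Lemma is_derive_boundary f df x i : C1 f df ->
  is_derive x (e_ i) (fun x => f (graph_map (x, 0))) (graph_deriv df i (x, 0)).
Proof.
move=> fdf.
have [cf cdf _] := fdf.
have cgr (g : 'rV[R]_(d + 1) -> R) : continuous g -> continuous (fun z => g (graph_map z)).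
  exact: continuous_funcomp continuous_graph_map.
apply: (@is_derive_trace _ _ (fun x s => f (graph_map (x, s)))
  (fun x s => graph_deriv df i (x, s))).
- by under eq_fun do rewrite -surjective_pairing; exact: cgr.
- under eq_fun do rewrite -surjective_pairing.
  exact: continuous_graph_deriv.
move=> y s s0; apply: is_derive_eq (is_derive_graph y (e_ i) fdf s0) _.
rewrite (bigD1 i)//= mxE !eqxx mul1r big1 ?addr0// => j ji.
by rewrite mxE (negbTE ji) mul0r.
Qed.

Variable A : 'M[R]_d.
Hypothesis A_unit : A \in unitmx.

Definition flat (z : 'rV[R]_d * R) : 'rV[R]_(d + 1) := graph_map (z.1 *m A, z.2).

Lemma continuous_mulmxr : continuous (fun t : 'rV[R]_d => t *m A).
Proof.
move=> t; apply: continuous_row => i.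
rewrite (_ : (fun w => _) = (fun w : 'rV[R]_d => \sum_j w 0 j * A j i)).
  apply: continuous_bigsum => j; apply: continuous_funM.
    exact: coord_continuous.
  exact: continuous_funcst.
by apply/funext => w; rewrite mxE.
Qed.

Lemma continuous_chart : continuous (fun z : 'rV[R]_d * R => z.1 *m A).
Proof.
move=> z; apply: (@continuous_comp _ _ _ fst (fun t : 'rV[R]_d => t *m A)).
  exact: cvg_fst.
exact: continuous_mulmxr.
Qed.

Lemma continuous_chart_pair :
  continuous (fun z : 'rV[R]_d * R => (z.1 *m A, z.2)).
Proof.
move=> z; apply: (@continuous_pair _ _ _ (fun z : 'rV[R]_d * R => z.1 *m A) snd).
  exact: continuous_chart.
exact: cvg_snd.
Qed.

Lemma continuous_flat : continuous flat.
Proof. exact: (continuous_funcomp continuous_chart_pair continuous_graph_map). Qed.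

Lemma continuous_on_flat f : continuous f -> continuous (fun z => f (flat z)).
Proof. exact: (continuous_funcomp continuous_flat). Qed.

Lemma subgraph_flat t (s : R) : s < 0 -> subgraph h (flat (t, s)).
Proof. exact: subgraph_graph_map. Qed.

Definition periodic_below f :=
  forall i z, subgraph h z -> f (z + xy_point (row i A) 0) = f z.

Hypothesis h_periodic : lattice_periodic A h.

(** In the chart [t |-> t *m A], differentiating in [t_j] is differentiating along the lattice
    vector [row j A], and such derivatives have mean zero. The coordinate directions are
    combinations of these vectors, with coefficients in [invmx A]. *)
Lemma cube_int_lattice (W : 'rV[R]_d -> R) (W' : 'I_d -> 'rV[R]_d -> R) i :
  continuous W -> (forall k, continuous (W' k)) ->
  (forall x w, is_derive x w W (\sum_k w 0 k * W' k x)) ->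
  lattice_periodic A W -> cube_int (fun t => W' i (t *m A)) = 0.
Proof.
move=> cW cW' Wd per.
pose D j t := \sum_k (row j A) 0 k * W' k (t *m A).
have cD j : continuous (D j).
  apply: continuous_bigsum => k; apply: continuous_funM; first exact: continuous_funcst.
  exact: (continuous_funcomp continuous_mulmxr).
have D0 j : cube_int (D j) = 0.
  apply: (@cube_int_derive _ _ (fun t => W (t *m A)) _ j) => //.
  - exact: (continuous_funcomp continuous_mulmxr).
  - move=> t; apply/is_derive_lineP.
    have /is_derive_lineP := Wd (t *m A) (row j A).
    rewrite (_ : (fun k : R => _) = (fun k : R => W ((k *: delta_mx 0 j + t) *m A)))//.
    by apply/funext => k; rewrite mulmxDl -scalemxAl -rowE.
  - by move=> t; rewrite mulmxDl -rowE addrC per.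
transitivity (cube_int (fun t => \sum_j invmx A i j * D j t)).
  apply: eq_cube_int => t ct; rewrite /D.
  under [RHS]eq_bigr do rewrite mulr_sumr.
  rewrite exchange_big/= (bigD1 i)//= [X in _ + X]big1 ?addr0.
    under eq_bigr do rewrite mxE mulrA.
    rewrite -mulr_suml; have := mulVmx A_unit => /matrixP/(_ i i).
    by rewrite !mxE eqxx => ->; rewrite mul1r.
  move=> k ki; under eq_bigr do rewrite mxE mulrA.
  rewrite -mulr_suml; have := mulVmx A_unit => /matrixP/(_ i k).
  by rewrite !mxE eq_sym (negbTE ki) => ->; rewrite mul0r.
rewrite cube_int_sum; last first.
  by move=> j; apply: continuous_funM; [exact: continuous_funcst|exact: cD].
by apply: big1 => j _; rewrite cube_intZ ?D0 ?mulr0.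
Qed.

Lemma cyl_int_graph_deriv S f df i : 0 < S -> C1 f df -> periodic_below f ->
  (forall j, supported S (fun z => df j (flat z))) ->
  cyl_int (fun z => graph_deriv df i (z.1 *m A, z.2)) = 0.
Proof.
move=> S0 fdf per supp.
have [cf cdf _] := fdf.
apply: (cyl_int_slices0 S0).
- apply: (continuous_funcomp continuous_chart_pair).
  exact: continuous_graph_deriv.
- by move=> t s ct sS; rewrite /graph_deriv !supp// mulr0 addr0.
move=> s s0; apply: (@cube_int_lattice (fun x => f (graph_map (x, s)))
  (fun k x => graph_deriv df k (x, s))).
- apply: (@continuous_slice R d (fun z => f (graph_map z))).
  exact: (continuous_funcomp continuous_graph_map).
- by move=> k; apply: (@continuous_slice R d (graph_deriv df k)); exact: continuous_graph_deriv.
- by move=> x w; exact: is_derive_graph.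
- move=> j x; rewrite -(per j _ (subgraph_graph_map x s0)) /graph_map/= -xy_pointD.
  by rewrite h_periodic addr0.
Qed.

(** Tangential derivatives integrate to zero on every slice, and the vertical derivative integrates
    to the flux at [s = 0]. The normal [(- grad h, 1)] is not normalised: its length is the area
    element, so the boundary integral is over the flat cube. *)
Lemma divergence S (X : 'I_(d + 1) -> 'rV[R]_(d + 1) -> R)
    (dX : 'I_(d + 1) -> 'I_(d + 1) -> 'rV[R]_(d + 1) -> R) : 0 < S ->
  (forall i, C1 (X i) (dX i)) -> (forall i, periodic_below (X i)) ->
  (forall i, supported S (fun z => X i (flat z))) ->
  (forall i j, supported S (fun z => dX i j (flat z))) ->
  cyl_int (fun z => \sum_i dX i i (flat z)) =
  cube_int (fun t => X ycoord (flat (t, 0)) -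
    \sum_i partial i h (t *m A) * X (lshift 1 i) (flat (t, 0))).
Proof.
move=> S0 XC per suppX suppdX.
have cX i : continuous (X i) by case: (XC i).
have cdX i j : continuous (dX i j) by case: (XC i).
pose hi (i : 'I_d) (z : 'rV[R]_d * R) := partial i h (z.1 *m A).
have chi i : continuous (hi i).
  apply: (continuous_funcomp continuous_chart).
  exact: smooth_partial_continuous.
pose V z := X ycoord (flat z) - \sum_i hi i z * X (lshift 1 i) (flat z).
pose V' z := dX ycoord ycoord (flat z) -
  \sum_i hi i z * dX (lshift 1 i) ycoord (flat z).
pose T (i : 'I_d) (z : 'rV[R]_d * R) :=
  graph_deriv (dX (lshift 1 i)) i (z.1 *m A, z.2).
have cV : continuous V.
  apply: continuous_funB; first exact: continuous_on_flat.
  apply: continuous_bigsum => i; apply: continuous_funM; first exact: chi.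
  exact: continuous_on_flat.
have cV' : continuous V'.
  apply: continuous_funB; first exact: continuous_on_flat.
  apply: continuous_bigsum => i; apply: continuous_funM; first exact: chi.
  exact: continuous_on_flat.
have sV' : supported S V'.
  move=> t s ct sS; rewrite /V' suppdX// big1 ?subr0// => i _.
  by rewrite suppdX// mulr0.
have cT i : continuous (T i).
  apply: continuous_funD; first exact: continuous_on_flat.
  by apply: continuous_funM; [exact: chi|exact: continuous_on_flat].
have sT i : supported S (T i).
  by move=> t s ct sS; rewrite /T /graph_deriv -/(flat (_, s)) !suppdX// mulr0 addr0.
(* [d_i X_i] is the tangential derivative [T i] minus [d_i h] times [d_y X_i]. These corrections and
   [d_y X_y] add up to [V'], the vertical derivative of the flux [V]. *)
transitivity (cyl_int (fun z => \sum_i T i z + V' z)).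
  apply: eq_cyl_int => t s ct s0; rewrite /V' addrCA big_split_ord/= big_ord1 addrC.
  rewrite -sumrB; congr (_ + _).
  by apply: eq_bigr => i _; rewrite /T /graph_deriv /hi/= addrK.
rewrite cyl_intD; last 2 first.
- apply: (supported_integrable S0); first exact: continuous_bigsum.
  by move=> t s ct sS; apply: big1 => i _; exact: sT.
- exact: (supported_integrable S0).
rewrite (cyl_int_sum _ S0)// big1 ?add0r => [|i _]; last first.
  by apply: (cyl_int_graph_deriv _ S0 (XC _)) => //.
apply: (cyl_int_vertical S0 cV cV') => //.
  move=> t s ct s0.
  have Xv i := is_derive_vertical (row_of_tuple t *m A) (XC i) s0.
  apply: (is_derive_funB (Xv ycoord)).
  apply: is_derive_funsum => i.
  apply: is_derive_eq (is_derive_funM (is_derive_funcst s 1 (hi i (row_of_tuple t, 0)))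
    (Xv (lshift 1 i))) _.
  by rewrite mulr0 addr0.
move=> t ct; rewrite /V (suppX _ _ _ ct)// big1 ?subr0// => i _.
by rewrite (suppX _ _ _ ct)// mulr0.
Qed.

End graph.

(** * Pointwise inequalities on Hessians *)

Section kato.
Context {R : realType} {n : nat}.
Implicit Types (a b v : 'I_n -> R) (M : 'I_n -> 'I_n -> R).

Lemma sum_prod a b : \sum_i \sum_j a i * b j = (\sum_i a i) * (\sum_j b j).
Proof. by rewrite big_distrl; apply: eq_bigr => i _; rewrite /= mulr_sumr. Qed.

(** Lagrange's identity: the double sum of [(a i * b j - a j * b i) ^+ 2] is twice the difference of
    the two sides. *)
Lemma cauchy_schwarz a b :
  (\sum_i a i * b i) ^+ 2 <= (\sum_i a i ^+ 2) * (\sum_i b i ^+ 2).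
Proof.
have : 0 <= \sum_i \sum_j (a i * b j - a j * b i) ^+ 2.
  by apply: sumr_ge0 => i _; apply: sumr_ge0 => j _; exact: sqr_ge0.
have -> : \sum_i \sum_j (a i * b j - a j * b i) ^+ 2 =
    \sum_i \sum_j a i ^+ 2 * b j ^+ 2 + \sum_i \sum_j b i ^+ 2 * a j ^+ 2
    - 2 * \sum_i \sum_j (a i * b i) * (a j * b j).
  rewrite mulr_sumr -big_split -sumrB /=; apply: eq_bigr => i _.
  rewrite mulr_sumr -big_split -sumrB /=; apply: eq_bigr => j _; ring.
rewrite !sum_prod; lra.
Qed.

Lemma sqr_sum_le a : (\sum_i a i) ^+ 2 <= n%:R * \sum_i a i ^+ 2.
Proof.
have := cauchy_schwarz (fun=> 1) a.
under eq_bigr do rewrite mul1r.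
by rewrite expr1n sumr_const card_ord.
Qed.

Lemma contraction_le v M :
  \sum_i (\sum_j v j * M i j) ^+ 2 <= (\sum_i v i ^+ 2) * (\sum_i \sum_j M i j ^+ 2).
Proof. by rewrite mulr_sumr ler_sum// => i _; exact: cauchy_schwarz. Qed.

(* With [p = |v|^2], [w = M v] and [m = v . w], apply [tr^2 <= n |.|^2] to
   [p^2 M - p (w v^T + v w^T) + m v v^T], whose trace is [- p m]. *)
Lemma kato v M : (forall i j, M i j = M j i) -> \sum_i M i i = 0 ->
  (n.+1%:R) * \sum_i (\sum_j v j * M i j) ^+ 2 <=
  n%:R * ((\sum_i v i ^+ 2) * (\sum_i \sum_j M i j ^+ 2)).
Proof.
move=> Msym Mtr.
have [w wE] : {w | forall i, w i = \sum_j v j * M i j} by exists (fun i => \sum_j v j * M i j).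
have [p pE] : {p | p = \sum_i v i ^+ 2} by eexists.
have [m mE] : {m | m = \sum_i v i * w i} by eexists.
have [g gE] : {g | g = \sum_i w i ^+ 2} by eexists.
have [H HE] : {H | H = \sum_i \sum_j M i j ^+ 2} by eexists.
(* [N] is [P M P] with [P = p I - v v^T], that is, [p ^+ 2] times the compression of [M] to the
   hyperplane orthogonal to [v]. *)
pose N i j := p ^+ 2 * M i j - p * (w i * v j + v i * w j) + m * (v i * v j).
under eq_bigr do rewrite -wE.
rewrite -pE -HE -gE.
have g0 : 0 <= g by rewrite gE; apply: sumr_ge0 => i _; exact: sqr_ge0.
have p0 : 0 <= p by rewrite pE; apply: sumr_ge0 => i _; exact: sqr_ge0.
have gp : g <= p * H.
  by rewrite gE pE HE; under eq_bigr do rewrite wE; exact: contraction_le.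
have mg : m ^+ 2 <= p * g by rewrite mE pE gE; exact: cauchy_schwarz.
have trN : \sum_i N i i = - (p * m).
  have -> : \sum_i N i i = p ^+ 2 * \sum_i M i i - 2 * p * \sum_i v i * w i
      + m * \sum_i v i ^+ 2.
    rewrite !mulr_sumr -sumrB -big_split /=; apply: eq_bigr => i _; rewrite /N; ring.
  by rewrite Mtr -mE -pE; ring.
have e1 : \sum_i \sum_j M i j * (w i * v j) = g.
  rewrite gE; apply: eq_bigr => i _; rewrite expr2 {3}wE mulr_sumr; apply: eq_bigr => j _; ring.
have e2 : \sum_i \sum_j M i j * (v i * w j) = g.
  rewrite exchange_big -e1 /=; apply: eq_bigr => i _; apply: eq_bigr => j _.
  rewrite Msym; ring.
have e3 : \sum_i \sum_j M i j * (v i * v j) = m.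
  rewrite mE; apply: eq_bigr => i _; rewrite wE mulr_sumr; apply: eq_bigr => j _; ring.
have normN : \sum_i \sum_j N i j ^+ 2 = p ^+ 4 * H - 2 * p ^+ 3 * g + p ^+ 2 * m ^+ 2.
  have -> : \sum_i \sum_j N i j ^+ 2 =
      p ^+ 4 * (\sum_i \sum_j M i j ^+ 2)
      - 2 * p ^+ 3 * (\sum_i \sum_j M i j * (w i * v j))
      - 2 * p ^+ 3 * (\sum_i \sum_j M i j * (v i * w j))
      + 2 * p ^+ 2 * m * (\sum_i \sum_j M i j * (v i * v j))
      + p ^+ 2 * (\sum_i \sum_j w i ^+ 2 * v j ^+ 2)
      + p ^+ 2 * (\sum_i \sum_j v i ^+ 2 * w j ^+ 2)
      + 2 * p ^+ 2 * (\sum_i \sum_j (v i * w i) * (v j * w j))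
      - 2 * p * m * (\sum_i \sum_j (v i * w i) * v j ^+ 2)
      - 2 * p * m * (\sum_i \sum_j v i ^+ 2 * (v j * w j))
      + m ^+ 2 * (\sum_i \sum_j v i ^+ 2 * v j ^+ 2).
    rewrite !mulr_sumr -!sumrB -!big_split -!sumrB -!big_split /=.
    apply: eq_bigr => i _; rewrite !mulr_sumr.
    rewrite -!sumrB -!big_split -!sumrB -!big_split /=.
    apply: eq_bigr => j _; rewrite /N; ring.
  rewrite !sum_prod e1 e2 e3 -pE -gE -mE -HE; ring.
have diag : \sum_i N i i ^+ 2 <= \sum_i \sum_j N i j ^+ 2.
  apply: ler_sum => i _; rewrite (bigD1 i)//= lerDl; apply: sumr_ge0 => j _.
  exact: sqr_ge0.
have key : p ^+ 2 * m ^+ 2 <= n%:R * (p ^+ 4 * H - 2 * p ^+ 3 * g + p ^+ 2 * m ^+ 2).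
  have := sqr_sum_le (fun i => N i i); rewrite trN sqrrN exprMn => /le_trans; apply.
  by rewrite ler_wpM2l ?ler0n// -normN.
have [pp|pp|p_eq0] := ltgtP p 0; first by move: p0; rewrite leNgt pp.
  have p20 : 0 < p ^+ 2 by rewrite exprn_gt0.
  have key2 : m ^+ 2 <= n%:R * (p ^+ 2 * H - 2 * p * g + m ^+ 2).
    rewrite -(ler_pM2l p20); apply: le_trans key _.
    by rewrite le_eqVlt; apply/orP; left; apply/eqP; ring.
  have n1 : 1 <= n%:R :> R \/ n%:R = 0 :> R.
    by case: (n) => [|k]; [right|left; rewrite ler1n].
  rewrite -(ler_pM2l pp) -natr1.
  case: n1 => [n1|n0]; last first.
    have : g = 0.
      by rewrite gE; move: n0 => /eqP; rewrite pnatr_eq0 => /eqP n0; apply: big1 => k;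
        have := leq_ltn_trans (leq0n _) (ltn_ord k); rewrite n0.
    by move=> ->; rewrite n0; lra.
  (* Inserted into [key2], this gives [2 n p g <= n p^2 H + (n - 1) p g], which is
     [(n + 1) g <= n p H] multiplied by [p]. *)
  have : (n%:R - 1) * m ^+ 2 <= (n%:R - 1) * (p * g) by rewrite ler_wpM2l// subr_ge0.
  nra.
have -> : g = 0.
  by apply/eqP; rewrite -[_ == 0]/(_ == _) eq_le g0 andbT (le_trans gp)// p_eq0 mul0r.
by rewrite p_eq0 mul0r !mulr0.
Qed.

(* At a boundary point: [H i j] are the second derivatives of [Q] in the
   directions of the base, [Hy i] the mixed and [Hyy] the vertical ones. *)
Lemma boundary_hessian (a : R) (h1 : 'I_n -> R) (h2 : 'I_n -> 'I_n -> R)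
    (H : 'I_n -> 'I_n -> R) (Hy : 'I_n -> R) (Hyy : R) :
  \sum_i H i i + Hyy = 0 ->
  (forall i j, H i j + h1 i * Hy j = a * h2 i j - h1 j * (Hy i + h1 i * Hyy)) ->
  Hyy - 2 * (\sum_i h1 i * Hy i) + \sum_i h1 i * \sum_j h1 j * H i j =
  - a * ((1 + \sum_i h1 i ^+ 2) * \sum_i h2 i i - \sum_i h1 i * \sum_j h1 j * h2 i j).
Proof.
move=> tr HE.
set S := \sum_i h1 i * Hy i; set g := \sum_i h1 i ^+ 2.
have HE' i j : H i j = a * h2 i j - h1 i * Hy j - h1 j * Hy i - h1 i * h1 j * Hyy.
  by have := HE i j; lra.
have trE : \sum_i H i i = a * (\sum_i h2 i i) - 2 * S - g * Hyy.
  rewrite /S /g !mulr_sumr mulr_suml -!sumrB /=; apply: eq_bigr => i _; rewrite HE'; ring.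
have hhE : \sum_i h1 i * \sum_j h1 j * H i j =
    a * (\sum_i h1 i * \sum_j h1 j * h2 i j) - 2 * (g * S) - g ^+ 2 * Hyy.
  have -> : g ^+ 2 * Hyy = \sum_i \sum_j h1 i ^+ 2 * (h1 j ^+ 2 * Hyy).
    by rewrite sum_prod -mulr_suml expr2 mulrA.
  have -> : 2 * (g * S) = \sum_i \sum_j h1 i ^+ 2 * (h1 j * Hy j) +
      \sum_i \sum_j h1 i * Hy i * h1 j ^+ 2.
    by rewrite !sum_prod -/S -/g; ring.
  rewrite mulr_sumr -!big_split -!sumrB /=; apply: eq_bigr => i _.
  rewrite !mulr_sumr -!big_split -!sumrB /=; apply: eq_bigr => j _; rewrite HE'; ring.
rewrite hhE; move: tr; rewrite trE => tr.
apply/eqP; rewrite -subr_eq0; apply/eqP.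
clearbody S g.
(* The quadratic form of [h2] along [h1] cancels, and the difference of the two sides is [1 + g]
   times the trace, which is zero by [tr]. *)
transitivity ((1 + g) * (a * (\sum_i h2 i i) - 2 * S - g * Hyy + Hyy)); first by ring.
by rewrite tr mulr0.
Qed.

End kato.

Lemma is_derive_unique {R : realType} {V : normedModType R} (f : V -> R) x v (a b : R) :
  is_derive x v f a -> is_derive x v f b -> a = b.
Proof. by move=> [_ <-] [_ <-]. Qed.

(** * Cutoffs and Green's formula *)

Section C1_calculus.
Context {R : realType} {d : nat}.
Variable h : 'rV[R]_d -> R.
Implicit Types (f g : 'rV[R]_(d + 1) -> R)
  (df dg : 'I_(d + 1) -> 'rV[R]_(d + 1) -> R).

Lemma C1_eq f df df' : C1 h f df -> (forall k z, df' k z = df k z) -> C1 h f df'.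
Proof.
move=> + dE; have -> // : df' = df.
by apply/funext => k; apply/funext => z; exact: dE.
Qed.

Lemma C1_cst (a : R) : C1 h (fun=> a) (fun _ _ => 0).
Proof.
split; do ?[move=> *; exact: continuous_funcst].
by move=> z _ i; exact: is_derive_funcst.
Qed.

Lemma C1_sub f df g dg : C1 h f df -> C1 h g dg ->
  C1 h (fun z => f z - g z) (fun k z => df k z - dg k z).
Proof.
move=> [cf cdf fd] [cg cdg gd]; split.
- exact: continuous_funB.
- by move=> k; exact: continuous_funB.
- by move=> z hz k; apply: is_derive_funB; [exact: fd|exact: gd].
Qed.

Lemma C1_mul f df g dg : C1 h f df -> C1 h g dg ->
  C1 h (fun z => f z * g z) (fun k z => f z * dg k z + g z * df k z).
Proof.
move=> [cf cdf fd] [cg cdg gd]; split.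
- exact: continuous_funM.
- by move=> k; apply: continuous_funD; exact: continuous_funM.
- by move=> z hz k; apply: is_derive_funM; [exact: fd|exact: gd].
Qed.

Lemma C1_scale (a : R) f df : C1 h f df ->
  C1 h (fun z => a * f z) (fun k z => a * df k z).
Proof.
move=> fdf; apply: C1_eq (C1_mul (C1_cst a) fdf) _ => k z.
by rewrite mulr0 addr0.
Qed.

Lemma C1_sum (I : Type) (r : seq I) (f : I -> 'rV[R]_(d + 1) -> R)
    (df : I -> 'I_(d + 1) -> 'rV[R]_(d + 1) -> R) :
  (forall i, C1 h (f i) (df i)) ->
  C1 h (fun z => \sum_(i <- r) f i z) (fun k z => \sum_(i <- r) df i k z).
Proof.
move=> fdf; split.
- by apply: continuous_bigsum => i; case: (fdf i).
- by move=> k; apply: continuous_bigsum => i; case: (fdf i).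
- by move=> z hz k; apply: is_derive_funsum => i; have [_ _] := fdf i; exact.
Qed.

Lemma C1_comp (F F' : R -> R) f df : continuous F -> continuous F' ->
  (forall y : R, is_derive y 1 F (F' y)) -> C1 h f df ->
  C1 h (fun z => F (f z)) (fun k z => F' (f z) * df k z).
Proof.
move=> cF cF' FF' [cf cdf fd]; split.
- exact: (continuous_funcomp cf).
- move=> k; apply: continuous_funM; last exact: cdf.
  exact: (continuous_funcomp cf).
- by move=> z hz k; exact: (is_derive_comp (FF' _) (fd z hz k)).
Qed.

Lemma C1_inv f df : (forall z, f z != 0) -> C1 h f df ->
  C1 h (fun z => (f z)^-1) (fun k z => - (df k z / f z ^+ 2)).
Proof.
move=> f0 [cf cdf fd]; split.
- exact: continuous_funV.
- move=> k; apply: continuous_funN; apply: continuous_funM => //.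
  apply: continuous_funV; last exact: continuous_funX.
  by move=> z; rewrite expf_neq0.
- by move=> z hz k; apply: is_derive_funV => //; exact: fd.
Qed.

Lemma C1_sqrt f df : (forall z, 0 < f z) -> C1 h f df ->
  C1 h (fun z => Num.sqrt (f z)) (fun k z => df k z / (2 * Num.sqrt (f z))).
Proof.
move=> f0 [cf cdf fd]; split.
- exact: continuous_fun_sqrt.
- move=> k; apply: continuous_funM => //; apply: continuous_funV.
    by move=> z; rewrite mulf_neq0 ?pnatr_eq0// gt_eqF// sqrtr_gt0.
  apply: continuous_funM; first exact: continuous_funcst.
  exact: continuous_fun_sqrt.
- by move=> z hz k; apply: is_derive_fun_sqrt => //; exact: fd.
Qed.

Lemma C1_coord (j : 'I_(d + 1)) :
  C1 h (fun z => z 0 j) (fun k _ => (k == j)%:R).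
Proof.
split; first exact: coord_continuous.
  by move=> k; exact: continuous_funcst.
move=> z _ k; apply/is_derive_lineP.
under eq_fun do rewrite !mxE eqxx/= eq_sym.
exact: is_derive_affine.
Qed.

End C1_calculus.

Section cutoff.
Context {R : realType} {d : nat}.
Variables (A : 'M[R]_d) (h : 'rV[R]_d -> R) (M L : R).
Hypothesis h_le : forall t, unit_cube t -> h (row_of_tuple t *m A) <= M.
Hypothesis L_gt0 : 0 < L.

(** The argument is the absolute height [y] and not the depth below the graph, so that the cutoff is
    lattice periodic and its Laplacian is a second [y]-derivative. Differentiation lowers the
    exponent, hence the whole family in [n]. *)
Definition cutoff n (z : 'rV[R]_(d + 1)) := ppow n (1 + (z 0 ycoord - M) / L).

Lemma cutoff_ge0 n z : 0 <= cutoff n z. Proof. exact: ppow_ge0. Qed.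

Lemma continuous_cutoff n : continuous (cutoff n).
Proof.
apply: (continuous_funcomp _ (@continuous_ppow _ n)); apply: continuous_funD.
  exact: continuous_funcst.
apply: continuous_funM; last exact: continuous_funcst.
by apply: continuous_funB; [exact: coord_continuous|exact: continuous_funcst].
Qed.

Lemma C1_cutoff n : C1 h (cutoff n.+2)
  (fun k z => (k == ycoord)%:R * (n.+2%:R / L * cutoff n.+1 z)).
Proof.
have c1 : C1 h (fun z => 1 + (z 0 ycoord - M) / L) (fun k _ => (k == ycoord)%:R / L).
  split.
  - apply: continuous_funD; first exact: continuous_funcst.
    apply: continuous_funM; last exact: continuous_funcst.
    by apply: continuous_funB; [exact: coord_continuous|exact: continuous_funcst].
  - by move=> k; exact: continuous_funcst.
  - move=> z hz k; have [_ _ /(_ z hz k) cd] := C1_coord h ycoord.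
    apply: is_derive_eq (is_derive_funD (is_derive_funcst z _ 1)
      (is_derive_funM (is_derive_funB cd (is_derive_funcst z _ M))
        (is_derive_funcst z _ L^-1))) _.
    by rewrite mulr0 !add0r subr0 mulrC.
have cp : continuous (fun x : R => n.+2%:R * ppow n.+1 x).
  by apply: continuous_funM; [exact: continuous_funcst|exact: continuous_ppow].
have c2 := C1_comp (@continuous_ppow _ n.+2) cp (is_derive_ppow n) c1.
by apply: C1_eq c2 _ => k z; rewrite /cutoff; ring.
Qed.

Lemma cutoff_supported n t (s : R) : unit_cube t -> s <= - L ->
  cutoff n.+1 (flat h A (row_of_tuple t, s)) = 0.
Proof.
move=> ct sL; apply: ppow0; rewrite xy_point_y/=.
have := h_le ct; move: (h _) => y yM.
rewrite -[X in X + _](@divff _ L) ?gt_eqF// -mulrDl pmulr_lle0 ?invr_gt0//.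
by lra.
Qed.

Lemma cutoff_le1 n t (s : R) : unit_cube t -> s <= 0 ->
  cutoff n (flat h A (row_of_tuple t, s)) <= 1.
Proof.
move=> ct s0; have := h_le ct; rewrite /cutoff xy_point_y/=; move: (h _) => y yM.
rewrite /ppow exprn_ile1// ?le_max ?lexx ?orbT// ge_max ler01 andbT.
by rewrite gerDl pmulr_lle0 ?invr_gt0//; lra.
Qed.

Lemma cutoff_periodic n : periodic_below h A (cutoff n).
Proof.
move=> i z _; rewrite /cutoff mxE xy_point_y addr0.
by [].
Qed.

Lemma cutoff_gt0 n t (s : R) : M - h (row_of_tuple t *m A) - s < L ->
  0 < cutoff n (flat h A (row_of_tuple t, s)).
Proof.
rewrite /cutoff xy_point_y/=; move: (h _) => y yL.
have c0 : 0 < 1 + (y + s - M) / L.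
  rewrite -[X in X + _](@divff _ L) ?gt_eqF// -mulrDl divr_gt0//; lra.
by rewrite ppow_pos ?exprn_gt0// ltW.
Qed.

End cutoff.

Lemma le_ppow {R : realType} n (x y : R) : x <= y -> ppow n x <= ppow n y.
Proof.
move=> xy; have m0 (z : R) : 0 <= Num.max z 0 by rewrite le_max lexx orbT.
by rewrite /ppow lerXn2r ?nnegrE ?m0// ge_max m0 andbT le_max xy.
Qed.

(** Below height [M] the quotient [(y - M) / L] is nonpositive, hence nondecreasing in [L]. *)
Lemma le_cutoff {R : realType} {d : nat} (A : 'M[R]_d) (h : 'rV[R]_d -> R) (M L L' : R) n
    t (s : R) : h (row_of_tuple t *m A) <= M -> s <= 0 -> 0 < L -> L <= L' ->
  cutoff M L n (flat h A (row_of_tuple t, s)) <=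
  cutoff M L' n (flat h A (row_of_tuple t, s)).
Proof.
move=> hM s0 L0 LL'; apply: le_ppow; rewrite xy_point_y/= lerD2l.
by rewrite ler_wnM2l ?lef_pV2 ?posrE ?(lt_le_trans L0)//; lra.
Qed.

Section green.
Context {R : realType} {d : nat}.
Variables (A : 'M[R]_d) (h : 'rV[R]_d -> R) (M L : R).
Hypothesis A_unit : A \in unitmx.
Hypothesis h_periodic : lattice_periodic A h.
Hypothesis h_smooth : smooth_on setT h.
Hypothesis h_le : forall t, unit_cube t -> h (row_of_tuple t *m A) <= M.
Hypothesis L_gt0 : 0 < L.
Local Notation cutoff := (cutoff M L).

Definition outward (f : 'I_(d + 1) -> 'rV[R]_(d + 1) -> R) (t : 'rV[R]_d) :=
  f ycoord (flat h A (t, 0)) -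
  \sum_i partial i h (t *m A) * f (lshift 1 i) (flat h A (t, 0)).

(** Divergence theorem for [chi grad u - u grad chi], where [chi] is [cutoff 3]. The divergence is
    [chi Delta u - u Delta chi]; the [y]-derivative of [chi] is [3 / L * cutoff 2] and its Laplacian
    is [6 / L ^+ 2 * cutoff 1]. *)
Lemma green (u : 'rV[R]_(d + 1) -> R) (u1 : 'I_(d + 1) -> 'rV[R]_(d + 1) -> R)
    (u2 : 'I_(d + 1) -> 'I_(d + 1) -> 'rV[R]_(d + 1) -> R) :
  C1 h u u1 -> (forall i, C1 h (u1 i) (u2 i)) ->
  periodic_below h A u -> (forall i, periodic_below h A (u1 i)) ->
  cyl_int (fun z => cutoff 3 (flat h A z) * (\sum_i u2 i i (flat h A z)) -
    6 / L ^+ 2 * cutoff 1 (flat h A z) * u (flat h A z)) =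
  cube_int (fun t => cutoff 3 (flat h A (t, 0)) * outward u1 t -
    3 / L * cutoff 2 (flat h A (t, 0)) * u (flat h A (t, 0))).
Proof.
move=> uC u1C uper u1per.
pose X i z := cutoff 3 z * u1 i z - (i == ycoord)%:R * (3 / L * (cutoff 2 z * u z)).
pose dX i k z := (cutoff 3 z * u2 i k z +
    u1 i z * ((k == ycoord)%:R * (3 / L * cutoff 2 z))) -
  (i == ycoord)%:R * (3 / L * (cutoff 2 z * u1 k z +
    u z * ((k == ycoord)%:R * (2 / L * cutoff 1 z)))).
have XC i : C1 h (X i) (dX i).
  exact: (C1_sub (C1_mul (C1_cutoff h M L 1) (u1C i))
    (C1_scale _ (C1_scale _ (C1_mul (C1_cutoff h M L 0) uC)))).
have Xper i : periodic_below h A (X i).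
  by move=> j z hz; rewrite /X !(@cutoff_periodic _ _ A h M L _ j z hz) u1per// uper.
have c0 n t s : unit_cube t -> s <= - L -> cutoff n.+1 (flat h A (row_of_tuple t, s)) = 0.
  exact: cutoff_supported.
have := divergence h_smooth A_unit h_periodic L_gt0 XC Xper.
have sX i : supported L (fun z => X i (flat h A z)).
  by move=> t s ct sL; rewrite /X !c0//; ring.
have sdX i j : supported L (fun z => dX i j (flat h A z)).
  by move=> t s ct sL; rewrite /dX !c0//; ring.
move=> /(_ sX sdX) divE.
transitivity (cyl_int (fun z => \sum_i dX i i (flat h A z))).
  congr cyl_int; apply/funext => z; move: (flat h A z) => {}z.
  rewrite mulr_sumr [in RHS](bigD1 ycoord)//= [in LHS](bigD1 ycoord)//= /dX eqxx.
  have -> : \sum_(i | i != ycoord) (cutoff 3 z * u2 i i z +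
      u1 i z * ((i == ycoord)%:R * (3 / L * cutoff 2 z)) -
      (i == ycoord)%:R * (3 / L * (cutoff 2 z * u1 i z +
      u z * ((i == ycoord)%:R * (2 / L * cutoff 1 z))))) =
      \sum_(i | i != ycoord) cutoff 3 z * u2 i i z.
    by apply: eq_bigr => i iy; rewrite (negbTE iy) /=; ring.
  by rewrite /=; field; rewrite gt_eqF.
rewrite divE; congr cube_int; apply/funext => t; rewrite /outward /X eqxx.
rewrite mulrBr mulr_sumr.
have -> : \sum_i partial i h (t *m A) *
    (cutoff 3 (flat h A (t, 0)) * u1 (lshift 1 i) (flat h A (t, 0)) -
     (lshift 1 i == ycoord)%:R *
     (3 / L * (cutoff 2 (flat h A (t, 0)) * u (flat h A (t, 0))))) =
  \sum_i cutoff 3 (flat h A (t, 0)) *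
    (partial i h (t *m A) * u1 (lshift 1 i) (flat h A (t, 0))).
  by apply: eq_bigr => i _; rewrite lshift_neq_ycoord /=; ring.
rewrite /=; ring.
Qed.

End green.

Section zeta.
Context {R : realType}.

(* A bounded nondecreasing [C^1] function vanishing exactly on [0, +oo[. *)
Definition zeta (y : R) := (1 + ppow 2 (- y))^-1 - 1.

Definition zeta' (y : R) := 2 * ppow 1 (- y) / (1 + ppow 2 (- y)) ^+ 2.

Let den_gt0 (y : R) : 0 < 1 + ppow 2 (- y).
Proof. by rewrite ltr_wpDr ?ppow_ge0. Qed.

Lemma continuous_ppowN n : continuous (fun y : R => ppow n (- y)).
Proof.
apply: (continuous_funcomp _ (@continuous_ppow _ n)).
by apply: continuous_funN => y; exact: cvg_id.
Qed.

Let continuous_den : continuous (fun y : R => 1 + ppow 2 (- y)).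
Proof. by apply: continuous_funD; [exact: continuous_funcst|exact: continuous_ppowN]. Qed.

Lemma continuous_zeta : continuous zeta.
Proof.
apply: continuous_funB; last exact: continuous_funcst.
by apply: continuous_funV => // y; rewrite gt_eqF.
Qed.

Lemma continuous_zeta' : continuous zeta'.
Proof.
apply: continuous_funM.
  by apply: continuous_funM; [exact: continuous_funcst|exact: continuous_ppowN].
apply: continuous_funV; last exact: continuous_funX.
by move=> y; rewrite expf_neq0// gt_eqF.
Qed.

Lemma is_derive_zeta (y : R) : is_derive y 1 zeta (zeta' y).
Proof.
have h1 : is_derive y 1 (fun y : R => - y) (-1).
  have := is_derive_affine y (-1) 0.
  by under eq_fun do rewrite mulrN1 addr0.
have h2 := is_derive_comp (is_derive_ppow 0 (- y)) h1.
have h3 := is_derive_funD (is_derive_funcst y 1 1) h2.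
have h4 := is_derive_funV (f := fun y : R => 1 + (ppow 2 \o -%R) y)
  (lt0r_neq0 (den_gt0 y)) h3.
apply: is_derive_eq (is_derive_funB h4 (is_derive_funcst y 1 1)) _.
by rewrite /zeta' /=; field; rewrite gt_eqF.
Qed.

Lemma zeta'_ge0 y : 0 <= zeta' y.
Proof. by rewrite divr_ge0 ?exprn_ge0 ?mulr_ge0 ?ppow_ge0// ltW. Qed.

Lemma zeta_le0 y : zeta y <= 0.
Proof. by rewrite subr_le0 invf_le1// lerDl ppow_ge0. Qed.

Lemma zeta_geN1 y : -1 <= zeta y.
Proof. by rewrite lerBrDl subrr invr_ge0 ltW. Qed.

Lemma zeta0 : zeta 0 = 0.
Proof. by rewrite /zeta oppr0 ppow0// addr0 invr1 subrr. Qed.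

Lemma zeta_eq0 y : zeta y = 0 -> 0 <= y.
Proof.
move=> /eqP; rewrite subr_eq0 => /eqP/(congr1 GRing.inv); rewrite invrK invr1.
move=> /eqP; rewrite -subr_eq0 addrAC subrr add0r => p0.
rewrite leNgt; apply/negP => y0; move: p0.
by rewrite ppow_pos ?oppr_ge0 ?(ltW y0)// expf_eq0/= oppr_eq0 lt_eqF.
Qed.

End zeta.

(** * Mean curvature as a divergence *)

Section curvature.
Context {R : realType} {d : nat}.
Variable h : 'rV[R]_d -> R.
Hypothesis h_smooth : smooth_on setT h.
Local Notation e_ i := (delta_mx 0 i).
Local Notation m x := (1 + grad_sqnorm h x).

Lemma grad_sqnorm_ge0 x : 0 <= grad_sqnorm h x.
Proof. by apply: sumr_ge0 => i _; exact: sqr_ge0. Qed.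

Lemma area_gt0 x : 0 < m x.
Proof. by rewrite ltr_wpDr ?grad_sqnorm_ge0. Qed.

Lemma continuous_area : continuous (fun x => m x).
Proof.
apply: continuous_funD; first exact: continuous_funcst.
apply: continuous_bigsum => i; apply: continuous_funX.
exact: smooth_partial_continuous.
Qed.

Definition unit_slope i x := partial i h x / Num.sqrt (m x).

Definition unit_slope' i k x := partial k (partial i h) x / Num.sqrt (m x) -
  partial i h x * (\sum_j partial j h x * partial k (partial j h) x) / Num.sqrt (m x) ^+ 3.

Let sqrt_neq0 x : Num.sqrt (m x) != 0.
Proof. by rewrite gt_eqF// sqrtr_gt0 area_gt0. Qed.

Lemma unit_slope_derive i k x : is_derive x (e_ k) (unit_slope i) (unit_slope' i k x).
Proof.
have md : is_derive x (e_ k) (fun x => m x)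
    (0 + \sum_j (partial j h x * partial k (partial j h) x +
      partial j h x * partial k (partial j h) x)).
  apply: (is_derive_funD (is_derive_funcst x (e_ k) 1)).
  apply: (is_derive_funsum _ (f := fun j x => partial j h x ^+ 2)) => j.
  have hd := smooth_is_derive2 h_smooth x k j.
  exact: (is_derive_funM hd hd).
have sd := is_derive_fun_sqrt (f := fun x => m x) (area_gt0 x) md.
have vd := is_derive_funV (f := fun x => Num.sqrt (m x)) (sqrt_neq0 x) sd.
apply: is_derive_eq (is_derive_funM (smooth_is_derive2 h_smooth x k i) vd) _.
rewrite /unit_slope' big_split/= add0r.
by field; exact: sqrt_neq0.
Qed.

Lemma continuous_unit_slope i : continuous (unit_slope i).
Proof.
apply: continuous_funM; first exact: smooth_partial_continuous.
by apply: continuous_funV => //; apply: continuous_fun_sqrt; exact: continuous_area.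
Qed.

Lemma continuous_unit_slope' i k : continuous (unit_slope' i k).
Proof.
have cs : continuous (fun x => Num.sqrt (m x)).
  by apply: continuous_fun_sqrt; exact: continuous_area.
apply: continuous_funB.
  apply: continuous_funM; first exact: smooth_partial2_continuous.
  exact: continuous_funV.
apply: continuous_funM; last first.
  apply: continuous_funV; last exact: continuous_funX.
  by move=> x; rewrite expf_neq0.
apply: continuous_funM; first exact: smooth_partial_continuous.
apply: continuous_bigsum => j; apply: continuous_funM.
  exact: smooth_partial_continuous.
exact: smooth_partial2_continuous.
Qed.

Lemma curvatureE x : curvature h x = - \sum_i unit_slope' i i x.
Proof.
congr (- _); apply: eq_bigr => i _.
by have [_ ] := unit_slope_derive i i x.
Qed.

Lemma continuous_curvature : continuous (curvature h).
Proof.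
rewrite (_ : curvature h = fun x => - \sum_i unit_slope' i i x); last first.
  by apply/funext => x; exact: curvatureE.
by apply: continuous_funN; apply: continuous_bigsum => i; exact: continuous_unit_slope'.
Qed.

(** Clearing the square roots brings the curvature to the expression that [boundary_hessian]
    produces. *)
Lemma curvature_sqrt3 x : curvature h x * Num.sqrt (m x) ^+ 3 =
  - (m x * (\sum_i partial i (partial i h) x) -
     \sum_i partial i h x * \sum_j partial j h x * partial i (partial j h) x).
Proof.
rewrite curvatureE mulNr; congr (- _).
rewrite [in RHS](_ : m x = Num.sqrt (m x) ^+ 2); last by rewrite sqr_sqrtr// ltW ?area_gt0.
rewrite mulr_suml mulr_sumr -sumrB; apply: eq_bigr => i _.
rewrite /unit_slope'; field; exact: sqrt_neq0.
Qed.

(** The curvature is minus the divergence of the periodic field [unit_slope], and each term of a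
    divergence has mean zero. *)
Lemma cube_int_curvature (A : 'M[R]_d) : A \in unitmx -> lattice_periodic A h ->
  cube_int (fun t => curvature h (t *m A)) = 0.
Proof.
move=> A_unit h_per.
have partial_per i : lattice_periodic A (partial i h).
  move=> j x; rewrite /partial /derive; set F1 := fun k => _; set F2 := fun k => _.
  suff -> : F1 = F2 by [].
  by apply/funext => k; rewrite /F1 /F2 /= addrA !h_per.
have c' i : continuous (fun t : 'rV[R]_d => unit_slope' i i (t *m A)).
  exact: (continuous_funcomp (@continuous_mulmxr R d A) (@continuous_unit_slope' i i)).
rewrite (_ : (fun t => _) = fun t => -1 * \sum_i unit_slope' i i (t *m A)); last first.
  by apply/funext => t; rewrite curvatureE mulN1r.
rewrite cube_intZ; last exact: continuous_bigsum.
rewrite cube_int_sum// big1 ?mulr0// => i _.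
apply: (@cube_int_lattice R d A A_unit (unit_slope i) (unit_slope' i) i).
- exact: continuous_unit_slope.
- by move=> k; exact: continuous_unit_slope'.
- move=> x w; apply/is_derive_lineP.
  have wd : is_derive (0 : R) 1 (fun k : R => k *: w + x) w.
    apply: is_derive_row => l.
    by under eq_fun do rewrite !mxE; exact: is_derive_affine.
  have := @is_derive_partials _ _ (unit_slope i) (unit_slope' i) _ _ 0 _ _ wd.
  rewrite scale0r add0r; apply.
    by near=> y => l; exact: unit_slope_derive.
  by move=> l; exact: continuous_unit_slope'.
- move=> j x; rewrite /unit_slope partial_per /grad_sqnorm.
  by under [in LHS]eq_bigr do rewrite partial_per.
Unshelve. all: by end_near. Qed.

End curvature.

(** * The harmonic extension *)

Section harmonic.
Context {R : realType} {d : nat}.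
Variables (A : 'M[R]_d) (h : 'rV[R]_d -> R).
Hypothesis A_unit : A \in unitmx.
Hypothesis h_periodic : lattice_periodic A h.
Hypothesis h_smooth : smooth_on setT h.
Local Notation e_ i := (delta_mx 0 i).
Local Notation flat := (flat h A).
Local Notation y_ := (@ycoord d).

(* [Phi [:: i; j; ...]] is a continuous extension to the whole space of the
   iterated partial derivative of the harmonic extension of [h]. *)
Variable Phi : seq 'I_(d + 1) -> 'rV[R]_(d + 1) -> R.
Hypothesis Phi_cont : forall s, continuous (Phi s).
Hypothesis Phi_derive : forall s z, subgraph h z -> forall i,
  is_derive z (e_ i) (Phi s) (Phi (i :: s) z).
Hypothesis Phi_periodic : forall s, periodic_below h A (Phi s).
Hypothesis Phi_laplace : forall z, subgraph h z -> \sum_i Phi [:: i; i] z = 0.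
Hypothesis Phi_boundary : forall x, Phi [::] (xy_point x (h x)) = h x.
Hypothesis Phi_energy : cyl_integrable (fun z => \sum_i Phi [:: i] (flat z) ^+ 2).

Lemma Phi_C1 s : C1 h (Phi s) (fun i => Phi (i :: s)).
Proof. by split => //; exact: Phi_derive. Qed.

Lemma Phi_sym s i j z : subgraph h z -> Phi (i :: j :: s) z = Phi (j :: i :: s) z.
Proof.
move=> hz; apply: (@schwarz _ _ (Phi s) (fun i => Phi (i :: s))
  (fun i j => Phi (i :: j :: s))).
- by near=> y => k; apply: Phi_derive; near: y; exact: near_subgraph.
- by near=> y => k l; apply: Phi_derive; near: y; exact: near_subgraph.
- by move=> k l; exact: Phi_cont.
Unshelve. all: by end_near. Qed.

Lemma near_derive_eq (f g : 'rV[R]_(d + 1) -> R) z i (a b : R) :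
  subgraph h z -> (forall y, subgraph h y -> f y = g y) ->
  is_derive z (e_ i) f a -> is_derive z (e_ i) g b -> a = b.
Proof.
move=> hz fg fa gb; apply: is_derive_unique gb.
apply: near_eq_is_derive fa; near=> y; apply: fg; near: y; exact: near_subgraph.
Unshelve. all: by end_near. Qed.

(** The partial derivatives of a harmonic function are harmonic: symmetry, used once under a
    derivative and once outside, brings [j] to the front, and then the Laplace equation is
    differentiated. *)
Lemma Phi_laplace3 j z : subgraph h z -> \sum_i Phi [:: i; i; j] z = 0.
Proof.
move=> hz.
transitivity (\sum_i Phi [:: j; i; i] z).
  apply: eq_bigr => i _; rewrite -(Phi_sym [:: i] i j hz).
  apply: (near_derive_eq hz _ (Phi_derive _ hz i) (Phi_derive _ hz i)) => y hy.
  exact: Phi_sym.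
apply: (near_derive_eq hz Phi_laplace _ (is_derive_funcst z (e_ j) 0)).
by apply: is_derive_funsum => i; exact: Phi_derive.
Qed.

Lemma boundary_eq (F G : 'rV[R]_(d + 1) -> R) x : continuous F -> continuous G ->
  (forall z, subgraph h z -> F z = G z) ->
  F (graph_map h (x, 0)) = G (graph_map h (x, 0)).
Proof.
move=> cF cG FG; apply/eqP; rewrite -subr_eq0 -normr_le0.
apply/ler_addgt0Pl => e e0; rewrite addr0.
pose K z := F (graph_map h z) - G (graph_map h z).
have cK : continuous K.
  by apply: continuous_funB; exact: (continuous_funcomp (continuous_graph_map h_smooth)).
have /cvg_at_left_filter/cvgrPdist_le/(_ e e0) := @continuous_section R d K x cK 0.
move=> Ke.
have [s [s0 se]] : exists s : R, s < 0 /\ `|K (x, 0) - K (x, s)| <= e.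
  by apply: (@filter_ex _ (0 : R)^'-); near=> s; split; near: s; [exact: nbhs_left_lt|].
move: se; rewrite {2}/K FG ?subrr ?subr0//.
exact: subgraph_graph_map.
Unshelve. all: by end_near. Qed.

(* [Qext], [dQ i], [dQ2], [dQhess i], [dQhess2] and [hess2] are [Q], [d_i Q],
   [|grad Q|^2], [sum_j d_j Q d_i d_j Q], [|grad Q . hess Q|^2] and [|hess Q|^2]. *)
Definition Qext z := Phi [::] z - z 0 y_.
Definition dQ (i : 'I_(d + 1)) z := Phi [:: i] z - (i == y_)%:R.

Lemma Qext_C1 : C1 h Qext dQ.
Proof. exact: (C1_sub (Phi_C1 [::]) (C1_coord h y_)). Qed.

Lemma dQ_C1 j : C1 h (dQ j) (fun i => Phi [:: i; j]).
Proof.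
apply: C1_eq (C1_sub (Phi_C1 [:: j]) (C1_cst h (j == y_)%:R)) _ => k z.
by rewrite subr0.
Qed.

Lemma Qext_periodic : periodic_below h A Qext.
Proof.
move=> i z hz; rewrite /Qext Phi_periodic// mxE xy_point_y addr0.
by [].
Qed.

Lemma dQ_periodic j : periodic_below h A (dQ j).
Proof. by move=> i z hz; rewrite /dQ Phi_periodic. Qed.

Lemma Qext_boundary x : Qext (graph_map h (x, 0)) = 0.
Proof. by rewrite /Qext /graph_map/= addr0 Phi_boundary xy_point_y subrr. Qed.

Lemma continuous_Qext : continuous Qext. Proof. by case: Qext_C1. Qed.
Lemma continuous_dQ i : continuous (dQ i). Proof. by case: (dQ_C1 i). Qed.

Definition dQ2 z := \sum_i dQ i z ^+ 2.

Lemma continuous_dQ2 : continuous dQ2.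
Proof. by apply: continuous_bigsum => i; apply: continuous_funX; exact: continuous_dQ. Qed.

(* [Q] vanishes on the graph, so [grad Q = slope * (grad h, -1)] there. *)
Definition slope x := - dQ y_ (graph_map h (x, 0)).

Lemma dQ_boundary x i :
  dQ (lshift 1 i) (graph_map h (x, 0)) = slope x * partial i h x.
Proof.
have Q0 : is_derive x (e_ i) (fun x => Qext (graph_map h (x, 0))) 0.
  by under eq_fun do rewrite Qext_boundary; exact: is_derive_funcst.
have := is_derive_unique (is_derive_boundary h_smooth x i Qext_C1) Q0.
by rewrite /graph_deriv/= /slope => /eqP; rewrite addr_eq0 => /eqP ->; ring.
Qed.

Lemma slope_derive x i :
  is_derive x (e_ i) slope (- graph_deriv h (fun k => Phi [:: k; y_]) i (x, 0)).
Proof.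
have := is_derive_funB (is_derive_funcst x (e_ i) 0)
  (is_derive_boundary h_smooth x i (dQ_C1 y_)).
by rewrite sub0r; under eq_fun do rewrite sub0r.
Qed.

(** This is [dQ_boundary] differentiated once more along the graph; it supplies the second
    hypothesis of [boundary_hessian]. *)
Lemma hess_boundary x i j :
  graph_deriv h (fun k => Phi [:: k; lshift 1 j]) i (x, 0) =
  slope x * partial i (partial j h) x -
  partial j h x * graph_deriv h (fun k => Phi [:: k; y_]) i (x, 0).
Proof.
have q1 := is_derive_boundary h_smooth x i (dQ_C1 (lshift 1 j)).
have q2 := is_derive_funM (slope_derive x i) (smooth_is_derive2 h_smooth x i j).
have := is_derive_unique q1 (_ : is_derive _ _ _ _); apply.
by under eq_fun do rewrite dQ_boundary; rewrite -mulrN.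
Qed.

Lemma Phi_sym_boundary i j x :
  Phi [:: i; j] (graph_map h (x, 0)) = Phi [:: j; i] (graph_map h (x, 0)).
Proof. by apply: boundary_eq => // z hz; exact: Phi_sym. Qed.

Lemma Phi_laplace_boundary x : \sum_i Phi [:: i; i] (graph_map h (x, 0)) = 0.
Proof.
apply: (@boundary_eq (fun z => \sum_i Phi [:: i; i] z) (fun=> 0)) => //.
- by apply: continuous_bigsum => i; exact: Phi_cont.
- exact: continuous_funcst.
Qed.

Definition dQhess i z := \sum_j dQ j z * Phi [:: i; j] z.

(** [dQhess] is the gradient of half of [dQ2], so the left side is a normal derivative. One factor
    [slope] comes from [grad Q = slope * (grad h, -1)], the other from [boundary_hessian], and
    [curvature_sqrt3] identifies the rest. *)
Lemma normal_derivative_boundary x :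
  dQhess y_ (graph_map h (x, 0)) -
    \sum_i partial i h x * dQhess (lshift 1 i) (graph_map h (x, 0)) =
  - slope x ^+ 2 * curvature h x * Num.sqrt (1 + grad_sqnorm h x) ^+ 3.
Proof.
set z := graph_map h (x, 0).
have := @boundary_hessian R d (slope x) (fun i => partial i h x)
  (fun i j => partial i (partial j h) x) (fun i j => Phi [:: lshift 1 i; lshift 1 j] z)
  (fun j => Phi [:: y_; lshift 1 j] z) (Phi [:: y_; y_] z).
have tr : \sum_i Phi [:: lshift 1 i; lshift 1 i] z + Phi [:: y_; y_] z = 0.
  by have := Phi_laplace_boundary x; rewrite big_split_ord/= big_ord1.
have HE i j : Phi [:: lshift 1 i; lshift 1 j] z + partial i h x * Phi [:: y_; lshift 1 j] z =
    slope x * partial i (partial j h) x -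
    partial j h x * (Phi [:: y_; lshift 1 i] z + partial i h x * Phi [:: y_; y_] z).
  by have := hess_boundary x i j; rewrite /graph_deriv/= (Phi_sym_boundary (lshift 1 i) y_).
move=> /(_ tr HE) bh.
have wE k : dQhess k z =
    slope x * (\sum_j partial j h x * Phi [:: k; lshift 1 j] z - Phi [:: k; y_] z).
  rewrite /dQhess big_split_ord/= big_ord1 mulrBr mulr_sumr.
  rewrite (_ : dQ (rshift d ord0) z = - slope x); last by rewrite opprK.
  rewrite mulNr; congr (_ - _); apply: eq_bigr => j _.
  by rewrite dQ_boundary mulrA.
transitivity (- slope x * (Phi [:: y_; y_] z -
  2 * (\sum_i partial i h x * Phi [:: y_; lshift 1 i] z) +
  \sum_i partial i h x * \sum_j partial j h x * Phi [:: lshift 1 i; lshift 1 j] z)).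
  have -> : \sum_i partial i h x * dQhess (lshift 1 i) z =
      slope x * (\sum_i partial i h x * \sum_j partial j h x * Phi [:: lshift 1 i; lshift 1 j] z) -
      slope x * (\sum_i partial i h x * Phi [:: y_; lshift 1 i] z).
    rewrite !mulr_sumr -sumrB; apply: eq_bigr => i _.
    by rewrite wE (Phi_sym_boundary y_); ring.
  rewrite wE; ring.
rewrite bh; have := curvature_sqrt3 h_smooth x; rewrite -mulrA => ->.
rewrite /grad_sqnorm; ring.
Qed.

Definition hess2 z := \sum_i \sum_j Phi [:: i; j] z ^+ 2.
Definition dQhess2 z := \sum_i dQhess i z ^+ 2.

Lemma continuous_dQhess i : continuous (dQhess i).
Proof.
apply: continuous_bigsum => j; apply: continuous_funM; last exact: Phi_cont.
exact: continuous_dQ.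
Qed.

Lemma continuous_hess2 : continuous hess2.
Proof.
apply: continuous_bigsum => i; apply: continuous_bigsum => j.
by apply: continuous_funX; exact: Phi_cont.
Qed.

Lemma continuous_dQhess2 : continuous dQhess2.
Proof. by apply: continuous_bigsum => i; apply: continuous_funX; exact: continuous_dQhess. Qed.

Lemma dQ2_ge0 z : 0 <= dQ2 z.
Proof. by apply: sumr_ge0 => i _; exact: sqr_ge0. Qed.

Lemma hess2_ge0 z : 0 <= hess2 z.
Proof. by apply: sumr_ge0 => i _; apply: sumr_ge0 => j _; exact: sqr_ge0. Qed.

Lemma dQhess2_le z : dQhess2 z <= dQ2 z * hess2 z.
Proof. exact: (contraction_le (fun j => dQ j z) (fun i j => Phi [:: i; j] z)). Qed.

Lemma dQhess2_kato z : subgraph h z ->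
  (d + 1).+1%:R * dQhess2 z <= (d + 1)%:R * (dQ2 z * hess2 z).
Proof.
move=> hz; apply: (@kato R (d + 1) (fun j => dQ j z) (fun i j => Phi [:: i; j] z)).
  by move=> i j; exact: Phi_sym.
exact: Phi_laplace.
Qed.

Definition dphi2 z := \sum_i Phi [:: i] z ^+ 2.

Lemma dQ2E z : dQ2 z = dphi2 z - 2 * Phi [:: y_] z + 1.
Proof.
rewrite /dQ2 /dphi2 (bigD1 y_)//= [in RHS](bigD1 y_)//= /dQ eqxx/=.
have -> : \sum_(i | i != y_) (Phi [:: i] z - (i == y_)%:R) ^+ 2 =
    \sum_(i | i != y_) Phi [:: i] z ^+ 2.
  by apply: eq_bigr => i iy; rewrite (negbTE iy) subr0.
ring.
Qed.

(** * The regularised gradient norm *)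

Section regularised.
Variable eps : R.
Hypothesis eps_gt0 : 0 < eps.

(** The [F] of the overview: the term [eps ^+ 2] keeps the square root differentiable where [grad Q]
    vanishes. *)
Definition rnorm z := Num.sqrt (eps ^+ 2 + dQ2 z).

Lemma rnorm_arg_gt0 z : 0 < eps ^+ 2 + dQ2 z.
Proof. by rewrite ltr_wpDr ?dQ2_ge0// exprn_gt0. Qed.

Lemma rnorm_gt0 z : 0 < rnorm z.
Proof. by rewrite sqrtr_gt0 rnorm_arg_gt0. Qed.

Lemma rnorm_neq0 z : rnorm z != 0. Proof. by rewrite gt_eqF ?rnorm_gt0. Qed.

Lemma rnorm_sqr z : rnorm z ^+ 2 = eps ^+ 2 + dQ2 z.
Proof. by rewrite sqr_sqrtr// ltW ?rnorm_arg_gt0. Qed.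

Lemma continuous_rnorm : continuous rnorm.
Proof.
apply: continuous_fun_sqrt; apply: continuous_funD; first exact: continuous_funcst.
exact: continuous_dQ2.
Qed.

Definition drnorm k z := dQhess k z / rnorm z.
Definition dQhess' i k z :=
  \sum_j (dQ j z * Phi [:: k; i; j] z + Phi [:: i; j] z * Phi [:: k; j] z).
Definition d2rnorm i k z := dQhess' i k z / rnorm z - dQhess i z * dQhess k z / rnorm z ^+ 3.

Lemma dQhess_C1 i : C1 h (dQhess i) (dQhess' i).
Proof.
by apply: C1_sum => j; exact: (C1_mul (dQ_C1 j) (Phi_C1 [:: i; j])).
Qed.

Lemma rnorm_C1 : C1 h rnorm drnorm.
Proof.
have pC : C1 h (fun z => eps ^+ 2 - - dQ2 z) (fun k z => 0 - - (2 * dQhess k z)).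
  apply: C1_sub; first exact: C1_cst.
  have := C1_scale (-1) (C1_sum (index_enum _) (fun j => C1_mul (dQ_C1 j) (dQ_C1 j))).
  rewrite (_ : (fun z => -1 * _) = fun z => - dQ2 z); last first.
    by apply/funext => z; rewrite mulN1r.
  move=> /C1_eq; apply=> k z; rewrite mulN1r /dQhess mulr_sumr; congr (- _).
  by apply: eq_bigr => j _; ring.
have p0 z : 0 < eps ^+ 2 - - dQ2 z by rewrite opprK rnorm_arg_gt0.
have := C1_sqrt p0 pC.
rewrite (_ : (fun z => _) = rnorm); last by apply/funext => z; rewrite opprK.
move=> /C1_eq; apply=> k z; rewrite /drnorm !opprK add0r -/(rnorm z); field.
exact: rnorm_neq0.
Qed.

Lemma drnorm_C1 i : C1 h (drnorm i) (d2rnorm i).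
Proof.
apply: C1_eq (C1_mul (dQhess_C1 i) (C1_inv rnorm_neq0 rnorm_C1)) _ => k z.
by rewrite /d2rnorm /drnorm; field; exact: rnorm_neq0.
Qed.

Lemma rnorm_laplace z : subgraph h z ->
  \sum_i d2rnorm i i z = ((eps ^+ 2 + dQ2 z) * hess2 z - dQhess2 z) / rnorm z ^+ 3.
Proof.
move=> hz; rewrite /d2rnorm sumrB -!mulr_suml -rnorm_sqr.
have -> : \sum_i dQhess i z * dQhess i z = dQhess2 z by [].
(* In the trace the third derivatives collect into [dQ j] times the Laplacian of [d_j phi], which is
   zero. *)
have -> : \sum_i dQhess' i i z = hess2 z.
  rewrite /dQhess' exchange_big/= /hess2 [RHS]exchange_big/=; apply: eq_bigr => j _.
  by rewrite big_split/= -mulr_sumr Phi_laplace3// mulr0 add0r.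
by field; exact: rnorm_neq0.
Qed.

Lemma dQhess_periodic i : periodic_below h A (dQhess i).
Proof.
move=> j z hz; rewrite /dQhess; apply: eq_bigr => k _.
by rewrite dQ_periodic// Phi_periodic.
Qed.

Lemma rnorm_periodic : periodic_below h A rnorm.
Proof.
move=> j z hz; rewrite /rnorm /dQ2; congr (Num.sqrt (_ + _)); apply: eq_bigr => k _.
by rewrite dQ_periodic.
Qed.

Lemma drnorm_periodic i : periodic_below h A (drnorm i).
Proof. by move=> j z hz; rewrite /drnorm dQhess_periodic// rnorm_periodic. Qed.

(** The constant is the value of [rnorm] where [grad phi = 0], since there [grad Q = (0, -1)].
    Subtracting it leaves the derivatives unchanged. *)
Definition rnorm_dev z := rnorm z - Num.sqrt (1 + eps ^+ 2).

(** Multiplication by the conjugate sum, which is at least [1], gives [dphi2 - 2 d_y phi], and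
    [2 |d_y phi| <= dphi2 + 1]. The bound is uniform in [eps]. *)
Lemma rnorm_dev_le z : `|rnorm_dev z| <= 2 * dphi2 z + 1.
Proof.
have s1 : 1 <= Num.sqrt (1 + eps ^+ 2).
  by rewrite -[leLHS]sqrtr1 ler_sqrt ?lerDl ?sqr_ge0// addr_ge0// sqr_ge0.
have S0 : 0 <= dphi2 z by apply: sumr_ge0 => i _; exact: sqr_ge0.
have F0 := rnorm_gt0 z.
have den : 1 <= rnorm z + Num.sqrt (1 + eps ^+ 2) by rewrite (le_trans s1)// lerDr ltW.
have e : rnorm_dev z * (rnorm z + Num.sqrt (1 + eps ^+ 2)) = dphi2 z - 2 * Phi [:: y_] z.
  rewrite /rnorm_dev -subr_sqr rnorm_sqr sqr_sqrtr ?addr_ge0 ?sqr_ge0// dQ2E; ring.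
have yS : Phi [:: y_] z ^+ 2 <= dphi2 z.
  by rewrite /dphi2 (bigD1 y_)//= lerDl sumr_ge0// => i _; exact: sqr_ge0.
apply: (@le_trans _ _ `|dphi2 z - 2 * Phi [:: y_] z|).
  rewrite -e normrM; rewrite -[leLHS]mulr1 ler_wpM2l//.
  by rewrite ger0_norm// (le_trans ler01).
have h1 := sqr_ge0 (Phi [:: y_] z - 1); have h2 := sqr_ge0 (Phi [:: y_] z + 1).
move: h1 h2; rewrite sqrrB sqrrD !expr1n !mulr1 => h1 h2.
by rewrite ler_norml; apply/andP; split; lra.
Qed.

(** The factor [d + 2] is [1 / (1 - c)] for the constant [c = (d + 1) / (d + 2)] of [dQhess2_kato]:
    the term [dQhess2] eats at most the fraction [c] of [dQ2 * hess2]. *)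
Lemma hess2_le z : subgraph h z ->
  hess2 z / rnorm z <= (d + 1).+1%:R * (((eps ^+ 2 + dQ2 z) * hess2 z - dQhess2 z) / rnorm z ^+ 3).
Proof.
move=> hz; have F0 := rnorm_gt0 z; have k := dQhess2_kato hz.
rewrite mulrA ler_pdivlMr ?exprn_gt0//.
rewrite (_ : hess2 z / rnorm z * rnorm z ^+ 3 = rnorm z ^+ 2 * hess2 z);
  last by field; exact: rnorm_neq0.
rewrite rnorm_sqr; move: k; rewrite -natr1.
have := hess2_ge0 z; have := dQ2_ge0 z; have := sqr_ge0 eps.
have := ler0n R (d + 1).
move: (_%:R) (dQ2 z) (hess2 z) (dQhess2 z) (eps ^+ 2) => n p H g e n0 e0 p0 H0 k.
have := mulr_ge0 n0 (mulr_ge0 e0 H0).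
nra.
Qed.

End regularised.

(** * Nonnegativity of [Q] and of the slope *)

Section bounded_by.
Variables (M : R).
Hypothesis h_le : forall t, unit_cube t -> h (row_of_tuple t *m A) <= M.

(* Flux of [cutoff * zeta(Q) * grad Q], which vanishes on the graph. *)
Lemma max_principle_bound L : 0 < L ->
  cyl_int (fun z => cutoff M L 3 (flat z) * (zeta' (Qext (flat z)) * dQ2 (flat z))) <=
  3 / (4 * L) * cyl_int (fun z => \sum_i Phi [:: i] (flat z) ^+ 2).
Proof.
move=> L0; pose c n := @cutoff R d M L n.
pose X i z := c 3%N z * (zeta (Qext z) * dQ i z).
pose dX i k z := c 3%N z * (zeta (Qext z) * Phi [:: k; i] z + dQ i z * (zeta' (Qext z) * dQ k z)) +
  (zeta (Qext z) * dQ i z) * ((k == y_)%:R * (3 / L * c 2%N z)).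
have zC := C1_comp continuous_zeta continuous_zeta' (@is_derive_zeta R) Qext_C1.
have XC i : C1 h (X i) (dX i).
  exact: (C1_mul (C1_cutoff h M L 1) (C1_mul zC (dQ_C1 i))).
have Xper i : periodic_below h A (X i).
  move=> j z hz; rewrite /X /c.
  by rewrite (@cutoff_periodic _ _ A h M L _ j z hz) Qext_periodic// dQ_periodic.
have c0 n t (s : R) : unit_cube t -> s <= - L -> c n.+1 (flat (row_of_tuple t, s)) = 0.
  exact: cutoff_supported.
have sX i : supported L (fun z => X i (flat z)).
  by move=> t s ct sL; rewrite /X !c0//; ring.
have sdX i j : supported L (fun z => dX i j (flat z)).
  by move=> t s ct sL; rewrite /dX !c0//; ring.
have := divergence h_smooth A_unit h_periodic L0 XC Xper sX sdX.
have X0 i t : X i (flat (t, 0)) = 0.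
  have -> : flat (t, 0) = graph_map h (t *m A, 0) by [].
  by rewrite /X Qext_boundary zeta0; ring.
rewrite (_ : cube_int _ = 0); last first.
  rewrite -[RHS](@cube_int_cst R d 0); congr cube_int; apply/funext => t.
  by rewrite X0 big1 ?subr0// => i _; rewrite X0 mulr0.
pose B z := c 2%N (flat z) * (zeta (Qext (flat z)) * dQ y_ (flat z)).
pose K z := c 3%N (flat z) * (zeta' (Qext (flat z)) * dQ2 (flat z)).
have cc n : continuous (c n) by exact: continuous_cutoff.
have cz : continuous (fun z => zeta (Qext z)).
  exact: (continuous_funcomp continuous_Qext continuous_zeta).
have cB : continuous B.
  apply: (@continuous_on_flat _ _ _ h_smooth A (fun z => c 2%N z * (zeta (Qext z) * dQ y_ z))).
  apply: continuous_funM; first exact: cc.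
  by apply: continuous_funM => //; exact: continuous_dQ.
have cK : continuous K.
  apply: (@continuous_on_flat _ _ _ h_smooth A (fun z => c 3%N z * (zeta' (Qext z) * dQ2 z))).
  apply: continuous_funM; first exact: cc.
  apply: continuous_funM; last exact: continuous_dQ2.
  exact: (continuous_funcomp continuous_Qext continuous_zeta').
have iB : cyl_integrable B.
  by apply: (supported_integrable L0) => // t s ct sL; rewrite /B c0//; ring.
have iK : cyl_integrable K.
  by apply: (supported_integrable L0) => // t s ct sL; rewrite /K c0//; ring.
(* Harmonicity removes [zeta(Q) Delta Q]. There remain [zeta'(Q) |grad Q|^2] under the cutoff and
   [zeta(Q) d_y Q] against the derivative of the cutoff. *)
have -> : cyl_int (fun z => \sum_i dX i i (flat z)) =
    cyl_int (fun z => K z - - (3 / L) * B z).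
  apply: eq_cyl_int => t s ct s0; rewrite /K /B; move: (subgraph_flat h A (row_of_tuple t) s0).
  move: (flat _) => z hz; rewrite /dX /dQ2.
  rewrite big_split/= -mulr_sumr big_split/= -mulr_sumr Phi_laplace// mulr0 add0r.
  congr (c 3%N z * _ + _).
    by rewrite mulr_sumr; apply: eq_bigr => i _; ring.
  rewrite (bigD1 y_)//= eqxx big1 => [|i iy]; last by rewrite (negbTE iy) /=; ring.
  rewrite /=; ring.
have iZ : cyl_integrable (fun z => - (3 / L) * B z).
  apply: (supported_integrable L0).
    by apply: continuous_funM; [exact: continuous_funcst|exact: cB].
  by move=> t s ct sL; rewrite /B c0//; ring.
rewrite cyl_intB// => /eqP; rewrite subr_eq0 => /eqP ->.
rewrite -cyl_intZ; last exact: Phi_energy.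
apply: le_cyl_int => //; first exact: cyl_integrableZ.
move=> t s ct s0; rewrite /B; set z := flat _.
have cle1 : c 2%N z <= 1 by apply: cutoff_le1 => //; exact: ltW.
have c_ge0 : 0 <= c 2%N z by exact: cutoff_ge0.
have z1 := zeta_geN1 (Qext z); have z2 := zeta_le0 (Qext z).
rewrite /dQ eqxx/=.
have ple : Phi [:: y_] z ^+ 2 <= \sum_i Phi [:: i] z ^+ 2.
  by rewrite (bigD1 y_)//= lerDl sumr_ge0// => i _; exact: sqr_ge0.
rewrite (_ : 3 / (4 * L) = 3 / L / 4); last by field; rewrite gt_eqF.
rewrite mulNr -mulrN -(mulrA (3 / L)) ler_wpM2l ?divr_ge0 ?(ltW L0)//.
(* With [w = - cutoff * zeta(Q)], which lies in [[0, 1]], and [f = d_y phi], the claim is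
   [w (f - 1) <= f^2 / 4]. It follows from [(f - 2)^2 >= 0] when [f > 1]; this is the [4] in
   [3 / (4 * L)]. *)
apply: (@le_trans _ _ (4^-1 * Phi [:: y_] z ^+ 2)); last by rewrite ler_wpM2l.
move: (Phi [:: y_] z) (c 2%N z) (zeta _) cle1 c_ge0 z1 z2 => f cc' ze ? ? ? ?.
have e1 : 0 <= cc' * - ze <= 1.
  by rewrite mulr_ge0 ?oppr_ge0//= -[leRHS]mulr1 ler_pM// ?oppr_ge0// lerNl.
have -> : - (cc' * (ze * (f - 1))) = (cc' * - ze) * (f - 1) by ring.
move: (cc' * - ze) e1 => w /andP[w0 w1].
have [f1|f1] := leP f 1; first by nra.
have w2 : w * (f - 1) <= f - 1 by nra.
have := sqr_ge0 (f - 2); rewrite (_ : (f - 2) ^+ 2 = f ^+ 2 - 4 * f + 4); last by ring.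
by lra.
Qed.

(** In [max_principle_bound] the right side tends to [0] as [L] grows, while the left side is
    nondecreasing in [L]. So the left side is zero for every [L], and its continuous nonnegative
    integrand vanishes. *)
Lemma zeta_energy_eq0 t (s : R) : unit_cube t -> s < 0 ->
  zeta' (Qext (flat (row_of_tuple t, s))) * dQ2 (flat (row_of_tuple t, s)) = 0.
Proof.
move=> ct s0.
pose E := cyl_int (fun z => \sum_i Phi [:: i] (flat z) ^+ 2).
have E0 : 0 <= E.
  by apply: Rintegral_ge0 => p _; apply: sumr_ge0 => i _; exact: sqr_ge0.
pose K L z := cutoff M L 3 (flat z) * (zeta' (Qext (flat z)) * dQ2 (flat z)).
have K0 L z : 0 <= K L z.
  apply: mulr_ge0; first exact: cutoff_ge0.
  apply: mulr_ge0; first exact: zeta'_ge0.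
  by apply: sumr_ge0 => i _; exact: sqr_ge0.
have cK L : continuous (K L).
  apply: (@continuous_on_flat _ _ _ h_smooth A
    (fun z => cutoff M L 3 z * (zeta' (Qext z) * dQ2 z))).
  apply: continuous_funM; first exact: continuous_cutoff.
  apply: continuous_funM; last exact: continuous_dQ2.
  exact: (continuous_funcomp continuous_Qext continuous_zeta').
have iK L : 0 < L -> cyl_integrable (K L).
  move=> L0; apply: (supported_integrable L0) => // t' s' ct' sL.
  by rewrite /K cutoff_supported// mul0r.
have intK0 L : 0 < L -> cyl_int (K L) = 0.
  move=> L0; apply/eqP; rewrite eq_le; apply/andP; split; last first.
    by apply: Rintegral_ge0 => p _; exact: K0.
  apply/ler_addgt0Pl => e e0; rewrite addr0.
  (* At this width the bound [3 / (4 * L') * E] is at most [e]. *)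
  pose L' := L + 3 / 4 * E / e.
  have LL' : L <= L' by rewrite lerDl divr_ge0 ?(ltW e0)// mulr_ge0// divr_ge0.
  have L'0 : 0 < L' by exact: lt_le_trans LL'.
  apply: (@le_trans _ _ (cyl_int (K L'))).
    apply: le_cyl_int; do ?exact: iK.
    move=> t' s' ct' s'0; rewrite ler_wpM2r//.
      apply: mulr_ge0; first exact: zeta'_ge0.
      by apply: sumr_ge0 => i _; exact: sqr_ge0.
    by apply: le_cutoff => //; [exact: h_le|exact: ltW].
  apply: le_trans (max_principle_bound L'0) _; rewrite -/E.
  rewrite (_ : 3 / (4 * L') * E = 3 / 4 * E / L'); last by field; rewrite gt_eqF.
  rewrite ler_pdivrMr// /L' mulrDr mulrCA divff ?gt_eqF// mulr1.
  by rewrite lerDr mulr_ge0// ltW.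
(* Wide enough for the cutoff to be positive at the given point. *)
pose L := M - h (row_of_tuple t *m A) - s + 1.
have L0 : 0 < L by have := h_le ct; rewrite /L; lra.
have := cyl_int_eq0 (cK L) (iK L L0) (fun t s _ _ => K0 L _) (intK0 L L0) ct s0.
move=> /eqP; rewrite mulf_eq0 => /orP[|/eqP//].
by rewrite gt_eqF// cutoff_gt0//; rewrite /L; lra.
Qed.

(** On a vertical line [zeta(Q)] has derivative [zeta'(Q) d_y Q], which is zero by
    [zeta_energy_eq0]. So [zeta(Q)] keeps the value [zeta 0 = 0] that it has on the graph, and
    [zeta] vanishes only on nonnegative numbers. *)
Lemma Qext_ge0 t (s : R) : unit_cube t -> s < 0 -> 0 <= Qext (flat (row_of_tuple t, s)).
Proof.
move=> ct s0; apply: zeta_eq0; set x := row_of_tuple t *m A.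
have zC := C1_comp continuous_zeta continuous_zeta' (@is_derive_zeta R) Qext_C1.
pose g (r : R) := zeta (Qext (graph_map h (x, r))).
have cg : continuous g.
  apply: (@continuous_section R d (fun z => zeta (Qext (graph_map h z))) x).
  have cz : continuous (fun z => zeta (Qext z)).
    exact: (continuous_funcomp continuous_Qext continuous_zeta).
  exact: (continuous_funcomp (continuous_graph_map h_smooth) cz).
have gd (r : R) : r \in `]s, 0[%R -> is_derive r 1 g 0.
  rewrite in_itv/= => /andP[_ r0]; apply: is_derive_eq (is_derive_vertical x zC r0) _.
  have /eqP := zeta_energy_eq0 ct r0; rewrite mulf_eq0 => /orP[/eqP->|]; first by rewrite mul0r.
  rewrite /dQ2 psumr_eq0 => [|i _]; last exact: sqr_ge0.
  by move=> /allP /(_ y_ (mem_index_enum _)) /=; rewrite sqrf_eq0 => /eqP ->; rewrite mulr0.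
have [|c _] := MVT_segment (ltW s0) gd; first exact: continuous_subspaceT.
rewrite mul0r {1}/g Qext_boundary zeta0 sub0r => /eqP; rewrite oppr_eq0 => /eqP.
exact.
Qed.

(** Were [d_y Q] positive at a point of the graph, where [Q = 0], then [Q] would be negative just
    below it. *)
Lemma slope_ge0 t : unit_cube t -> 0 <= slope (row_of_tuple t *m A).
Proof.
move=> ct; rewrite oppr_ge0 leNgt; apply/negP; set x := row_of_tuple t *m A => q0.
have cq : continuous (fun r : R => dQ y_ (graph_map h (x, r))).
  apply: (@continuous_section R d (fun z => dQ y_ (graph_map h z)) x).
  apply: (continuous_funcomp (continuous_graph_map h_smooth)); exact: continuous_dQ.
have cQ : continuous (fun r : R => Qext (graph_map h (x, r))).
  apply: (@continuous_section R d (fun z => Qext (graph_map h z)) x).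
  apply: (continuous_funcomp (continuous_graph_map h_smooth)); exact: continuous_Qext.
have /nbhs_ballP[r /= r0 rP] : \forall y \near (0 : R), 0 < dQ y_ (graph_map h (x, y)).
  exact: (cvgr_gt _ (cq 0)).
have r20 : - (r / 2) < 0 by rewrite oppr_lt0 divr_gt0.
have [||c] := @MVT R (fun r : R => Qext (graph_map h (x, r)))
  (fun r => dQ y_ (graph_map h (x, r))) _ _ r20.
- by move=> y; rewrite in_itv/= => /andP[_ y0]; exact: (is_derive_vertical x Qext_C1).
- exact: continuous_subspaceT.
rewrite in_itv/= => /andP[c1 c2]; rewrite Qext_boundary !sub0r opprK.
have qc : 0 < dQ y_ (graph_map h (x, c)).
  by apply: rP; rewrite -ball_normE/= sub0r normrN ltr0_norm//; lra.
have Q0 : 0 <= Qext (graph_map h (x, - (r / 2))) by exact: Qext_ge0.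
move=> e; have : 0 < dQ y_ (graph_map h (x, c)) * (r / 2) by rewrite mulr_gt0// divr_gt0.
by lra.
Qed.

(** * Green's formula for the regularised norm *)

Lemma cutoff_integrable (L : R) n f : 0 < L -> continuous f ->
  cyl_integrable (fun z => cutoff M L n.+1 (flat z) * f (flat z)).
Proof.
move=> L0 cf; apply: (supported_integrable L0).
  apply: (@continuous_on_flat _ _ _ h_smooth A (fun z => cutoff M L n.+1 z * f z)).
  by apply: continuous_funM => //; exact: continuous_cutoff.
by move=> t s ct sL; rewrite cutoff_supported// mul0r.
Qed.

(** [cutoff 1] is the [y]-derivative of [L / 2 * cutoff 2], which is at most [L / 2] on the
    graph. *)
Lemma cyl_int_cutoff1 (L : R) : 0 < L -> cyl_int (fun z => cutoff M L 1 (flat z)) <= L / 2.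
Proof.
move=> L0.
have cc n : continuous (fun z => cutoff M L n (flat z)).
  by apply: (@continuous_on_flat _ _ _ h_smooth A); exact: continuous_cutoff.
have c2 : continuous (fun z => L / 2 * cutoff M L 2 (flat z)).
  by apply: continuous_funM; [exact: continuous_funcst|exact: cc].
have -> : cyl_int (fun z => cutoff M L 1 (flat z)) =
    cube_int (fun t => L / 2 * cutoff M L 2 (flat (t, 0))).
  apply: (@cyl_int_vertical R d L (fun z => L / 2 * cutoff M L 2 (flat z))) => //.
  - move=> t s ct s0.
    have := is_derive_vertical (row_of_tuple t *m A) (C1_scale (L / 2) (C1_cutoff h M L 0)) s0.
    move=> /is_derive_eq; apply; rewrite eqxx/=.
    have -> : flat (row_of_tuple t, s) = graph_map h (row_of_tuple t *m A, s) by [].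
    by field; rewrite gt_eqF.
  - by move=> t ct; rewrite cutoff_supported// mulr0.
  - by move=> t s ct sL; rewrite cutoff_supported.
rewrite -[leRHS](@cube_int_cst R d (L / 2)); apply: le_cube_int.
- exact: (@continuous_slice R d (fun z => L / 2 * cutoff M L 2 (flat z)) 0 c2).
- exact: continuous_funcst.
- move=> t ct; rewrite -[leRHS]mulr1 ler_wpM2l ?divr_ge0 ?(ltW L0)//.
  by apply: cutoff_le1 => //; exact: ltW.
Qed.

(** The formula of [rnorm_laplace], continuous on the whole space; it is claimed to be the Laplacian
    of [rnorm] only below the graph. *)
Definition lap_rnorm eps z := ((eps ^+ 2 + dQ2 z) * hess2 z - dQhess2 z) / rnorm eps z ^+ 3.

Lemma continuous_rnormV eps n : 0 < eps -> continuous (fun z => (rnorm eps z ^+ n)^-1).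
Proof.
move=> e0; apply: continuous_funV; first by move=> z; rewrite expf_neq0// rnorm_neq0.
by apply: continuous_funX; exact: continuous_rnorm.
Qed.

Lemma continuous_lap_rnorm eps : 0 < eps -> continuous (lap_rnorm eps).
Proof.
move=> e0; apply: continuous_funM; last exact: continuous_rnormV.
apply: continuous_funB; last exact: continuous_dQhess2.
apply: continuous_funM; last exact: continuous_hess2.
by apply: continuous_funD; [exact: continuous_funcst|exact: continuous_dQ2].
Qed.

Lemma continuous_rnorm_dev eps : continuous (rnorm_dev eps).
Proof.
by apply: continuous_funB; [exact: continuous_rnorm|exact: continuous_funcst].
Qed.

Lemma continuous_dphi2 : continuous dphi2.
Proof. by apply: continuous_bigsum => i; apply: continuous_funX; exact: Phi_cont. Qed.

Lemma dphi2_ge0 z : 0 <= dphi2 z.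
Proof. by apply: sumr_ge0 => i _; exact: sqr_ge0. Qed.

Lemma green_rnorm (eps L : R) : 0 < eps -> 0 < L ->
  cyl_int (fun z => cutoff M L 3 (flat z) * lap_rnorm eps (flat z)) =
  6 / L ^+ 2 * cyl_int (fun z => cutoff M L 1 (flat z) * rnorm_dev eps (flat z)) +
  cube_int (fun t => cutoff M L 3 (flat (t, 0)) * outward A h (drnorm eps) t -
    3 / L * cutoff M L 2 (flat (t, 0)) * rnorm_dev eps (flat (t, 0))).
Proof.
move=> e0 L0.
have dC : C1 h (rnorm_dev eps) (drnorm eps).
  by apply: C1_eq (C1_sub (rnorm_C1 e0) (C1_cst h _)) _ => k z; rewrite subr0.
have dper : periodic_below h A (rnorm_dev eps).
  by move=> i z hz; rewrite /rnorm_dev rnorm_periodic.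
rewrite -(green A_unit h_periodic h_smooth h_le L0 dC (drnorm_C1 e0) dper (drnorm_periodic eps)).
have i1 : cyl_integrable (fun z => cutoff M L 1 (flat z) * rnorm_dev eps (flat z)).
  by apply: cutoff_integrable => //; exact: continuous_rnorm_dev.
rewrite -cyl_intZ// -cyl_intD; last 2 first.
- exact: cyl_integrableZ.
- have cF k l : continuous (d2rnorm eps k l).
    by case: (drnorm_C1 e0 k) => _.
  apply: (supported_integrable L0).
  apply: (@continuous_on_flat _ _ _ h_smooth A
    (fun z => cutoff M L 3 z * (\sum_i d2rnorm eps i i z) -
      6 / L ^+ 2 * cutoff M L 1 z * rnorm_dev eps z)).
    apply: continuous_funB; apply: continuous_funM.
    + exact: continuous_cutoff.
    + exact: continuous_bigsum.
    + by apply: continuous_funM; [exact: continuous_funcst|exact: continuous_cutoff].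
    + exact: continuous_rnorm_dev.
  by move=> t s ct sL; rewrite !cutoff_supported//; ring.
apply: eq_cyl_int => t s ct s0.
rewrite (rnorm_laplace e0 (subgraph_flat h A _ s0)) /lap_rnorm; ring.
Qed.

(** By [rnorm_dev_le] and since the cutoff is at most [1], the integrand is bounded by
    [cutoff 1 + 2 * dphi2], whose integral is at most [L / 2 + 2 * E]. *)
Lemma cutoff_rnorm_dev_bound (eps L : R) : 0 < eps -> 0 < L ->
  `|6 / L ^+ 2 * cyl_int (fun z => cutoff M L 1 (flat z) * rnorm_dev eps (flat z))| <=
  3 / L + 12 * cyl_int (fun z => dphi2 (flat z)) / L ^+ 2.
Proof.
move=> e0 L0; set E := cyl_int (fun z => dphi2 _).
have i1 : cyl_integrable (fun z => cutoff M L 1 (flat z) * rnorm_dev eps (flat z)).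
  by apply: cutoff_integrable => //; exact: continuous_rnorm_dev.
have ic : cyl_integrable (fun z => cutoff M L 1 (flat z)).
  have := @cutoff_integrable L 0 (fun=> 1) L0 (@continuous_funcst _ _ 1).
  by under eq_fun do rewrite mulr1.
have ig : cyl_integrable (fun z => 2 * dphi2 (flat z)) by exact: cyl_integrableZ.
have igc : cyl_integrable (fun z => cutoff M L 1 (flat z) + 2 * dphi2 (flat z)).
  exact: cyl_integrableD.
have bnd t s : unit_cube t -> s < 0 ->
    `|cutoff M L 1 (flat (row_of_tuple t, s)) * rnorm_dev eps (flat (row_of_tuple t, s))| <=
    cutoff M L 1 (flat (row_of_tuple t, s)) + 2 * dphi2 (flat (row_of_tuple t, s)).
  move=> ct s0; have c1 := cutoff_le1 h_le L0 1 ct (ltW s0).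
  rewrite normrM ger0_norm ?cutoff_ge0//.
  have c0 := cutoff_ge0 M L 1 (flat (row_of_tuple t, s)).
  apply: (le_trans (ler_wpM2l c0 (rnorm_dev_le e0 _))).
  rewrite mulrDr mulr1 addrC lerD2l -[leRHS]mul1r ler_wpM2r// mulr_ge0//.
  exact: dphi2_ge0.
have b1 : `|cyl_int (fun z => cutoff M L 1 (flat z) * rnorm_dev eps (flat z))| <= L / 2 + 2 * E.
  apply: (@le_trans _ _ (cyl_int (fun z => cutoff M L 1 (flat z) + 2 * dphi2 (flat z)))).
    rewrite ler_norml; apply/andP; split.
      rewrite -mulN1r -cyl_intZ//; apply: le_cyl_int => //; first exact: cyl_integrableZ.
      by move=> t s ct s0; have := bnd t s ct s0; rewrite ler_norml mulN1r => /andP[].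
    apply: le_cyl_int => // t s ct s0.
    by have := bnd t s ct s0; rewrite ler_norml => /andP[].
  by rewrite cyl_intD// cyl_intZ// lerD2r cyl_int_cutoff1.
rewrite normrM ger0_norm; last by rewrite divr_ge0// exprn_ge0// ltW.
have c6 : 0 <= 6 / L ^+ 2 by rewrite divr_ge0// exprn_ge0// ltW.
apply: (le_trans (ler_wpM2l c6 b1)).
rewrite le_eqVlt; apply/orP; left; apply/eqP; field.
by rewrite gt_eqF.
Qed.

Local Notation m x := (1 + grad_sqnorm h x).

Lemma dQ2_boundary x : dQ2 (graph_map h (x, 0)) = slope x ^+ 2 * m x.
Proof.
rewrite /dQ2 big_split_ord/= big_ord1.
rewrite (_ : dQ (rshift d ord0) _ = - slope x); last by rewrite opprK.
rewrite sqrrN mulrDr mulr1 addrC; congr (_ + _).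
rewrite /grad_sqnorm mulr_sumr; apply: eq_bigr => i _.
by rewrite dQ_boundary exprMn.
Qed.

Lemma outward_drnorm (eps : R) t : 0 < eps -> outward A h (drnorm eps) t =
  - slope (t *m A) ^+ 2 * curvature h (t *m A) * Num.sqrt (m (t *m A)) ^+ 3 /
  rnorm eps (flat (t, 0)).
Proof.
move=> e0; rewrite -normal_derivative_boundary /outward /drnorm.
have -> : flat (t, 0) = graph_map h (t *m A, 0) by [].
rewrite mulrBl; congr (_ - _); rewrite mulr_suml.
by apply: eq_bigr => i _; rewrite mulrA.
Qed.

(** On the graph the norm of [grad Q] is [b = slope * Num.sqrt m]; this is where [slope >= 0]
    enters. With [F] for [rnorm], the error is [b (F - b) / F] times the curvature and [Num.sqrt m],
    and [b <= F <= eps + b] bounds the quotient by [eps]. *)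
Lemma outward_drnorm_approx (eps : R) t x : 0 < eps -> unit_cube t ->
  x = row_of_tuple t *m A ->
  `|outward A h (drnorm eps) (row_of_tuple t) + curvature h x * slope x * m x| <=
  `|curvature h x| * Num.sqrt (m x) * eps.
Proof.
move=> e0 ct xE; rewrite outward_drnorm// -xE.
have a0 : 0 <= slope x by rewrite xE slope_ge0.
have := area_gt0 h x => m0.
set s := Num.sqrt (m x).
have s0 : 0 < s by rewrite sqrtr_gt0.
have mE : m x = s ^+ 2 by rewrite sqr_sqrtr// ltW.
have F0 : 0 < rnorm eps (flat (row_of_tuple t, 0)) by exact: rnorm_gt0.
have : rnorm eps (flat (row_of_tuple t, 0)) ^+ 2 = eps ^+ 2 + (slope x * s) ^+ 2.
  rewrite rnorm_sqr//.
  have -> : flat (row_of_tuple t, 0) = graph_map h (x, 0) by rewrite xE.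
  by rewrite dQ2_boundary mE exprMn.
rewrite mE; move: (rnorm _ _) F0 => F F0 FE.
have as0 : 0 <= slope x * s by rewrite mulr_ge0// ltW.
have F1 : slope x * s <= F.
  by rewrite -(ler_pXn2r (_ : 0 < 2)%N) ?nnegrE ?(ltW F0)// FE lerDr sqr_ge0.
have F2 : F <= eps + slope x * s.
  rewrite -(ler_pXn2r (_ : 0 < 2)%N) ?nnegrE ?(ltW F0)//; last by rewrite addr_ge0// ltW.
  by rewrite FE sqrrD lerD2r lerDl mulrn_wge0// mulr_ge0// ltW.
have -> : - slope x ^+ 2 * curvature h x * s ^+ 3 / F + curvature h x * slope x * s ^+ 2 =
    curvature h x * s * ((slope x * s) * (F - slope x * s) / F).
  by field; rewrite gt_eqF.
rewrite !normrM (ger0_norm (ltW s0)) ler_wpM2l ?mulr_ge0 ?(ltW s0)//.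
rewrite (ger0_norm a0) normfV (ger0_norm (ltW F0)) ler_pdivrMr// ger0_norm ?subr_ge0//.
rewrite mulrC ler_pM ?subr_ge0//; lra.
Qed.

(** With [y = (h - M) / L <= 0], expanding the cube gives [1 - (1 + y)^3 <= - 3 y] as long as
    [1 + y >= 0]; otherwise [- 3 y] already exceeds [1]. *)
Lemma cutoff3_boundary (L : R) t : 0 < L -> unit_cube t ->
  0 <= 1 - cutoff M L 3 (flat (row_of_tuple t, 0)) <= 3 * (M - h (row_of_tuple t *m A)) / L.
Proof.
move=> L0 ct; rewrite subr_ge0 cutoff_le1//=.
have hM := h_le ct; rewrite /cutoff.
have -> : flat (row_of_tuple t, 0) 0 y_ = h (row_of_tuple t *m A) by rewrite xy_point_y addr0.
set y := (_ - M) / L.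
have -> : 3 * (M - h (row_of_tuple t *m A)) / L = - (3 * y) by rewrite /y; field; rewrite gt_eqF.
have y0 : y <= 0 by rewrite mulr_le0_ge0 ?subr_le0 ?invr_ge0 ?(ltW L0).
have [y1|y1] := leP 0 (1 + y).
  rewrite ppow_pos//.
  have -> : 1 - (1 + y) ^+ 3 = - (3 * y) - y ^+ 2 * (3 + y) by ring.
  by rewrite gerBl mulr_ge0 ?sqr_ge0//; lra.
by have := ppow_ge0 3 (1 + y); lra.
Qed.

(** In the chart, the curvature minus this function is the integrand of [J_functional], by
    [dirichlet_neumannE]. *)
Definition flux t := curvature h (t *m A) * slope (t *m A) * m (t *m A).

Lemma continuous_slope : continuous slope.
Proof.
apply: continuous_funN.
apply: (@continuous_slice R d (fun z => dQ y_ (graph_map h z)) 0).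
by apply: (continuous_funcomp (continuous_graph_map h_smooth)); exact: continuous_dQ.
Qed.

Lemma continuous_flux : continuous flux.
Proof.
apply: (continuous_funcomp (@continuous_mulmxr R d A)
  (g := fun x => curvature h x * slope x * m x)).
apply: continuous_funM; last exact: continuous_area.
by apply: continuous_funM; [exact: continuous_curvature|exact: continuous_slope].
Qed.

Lemma continuous_outward f : (forall i, continuous (f i)) -> continuous (outward A h f).
Proof.
move=> cf.
have cflat i : continuous (fun t => f i (flat (t, 0))).
  apply: (@continuous_slice R d (fun z => f i (flat z)) 0).
  exact: continuous_on_flat.
apply: continuous_funB; first exact: cflat.
apply: continuous_bigsum => i; apply: continuous_funM => //.
apply: (continuous_funcomp (@continuous_mulmxr R d A)).
exact: smooth_partial_continuous.
Qed.

Lemma boundary_flux_bound : exists C, forall eps L : R, 0 < eps -> 0 < L -> eps <= L^-1 ->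
  `|cube_int (fun t => cutoff M L 3 (flat (t, 0)) * outward A h (drnorm eps) t -
      3 / L * cutoff M L 2 (flat (t, 0)) * rnorm_dev eps (flat (t, 0))) + cube_int flux|
  <= C / L.
Proof.
have cslice (f : 'rV[R]_(d + 1) -> R) : continuous f -> continuous (fun t => f (flat (t, 0))).
  move=> cf; apply: (@continuous_slice R d (fun z => f (flat z)) 0).
  exact: continuous_on_flat.
have cx (f : 'rV[R]_d -> R) : continuous f -> continuous (fun t : 'rV[R]_d => f (t *m A)).
  by move=> cf; exact: (continuous_funcomp (@continuous_mulmxr R d A)).
(* Up to the factor [1 / L], the three summands bound the error of [outward_drnorm_approx] (through
   [eps <= L^-1]), the deviation of the cutoff from [1] on the graph, and the term with the
   differentiated cutoff. *)
pose B t := `|curvature h (t *m A)| * Num.sqrt (m (t *m A)) +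
  3 * (M - h (t *m A)) * `|flux t| + 3 * (2 * dphi2 (flat (t, 0)) + 1).
have cnorm (f : 'rV[R]_d -> R) : continuous f -> continuous (fun t => `|f t|).
  by move=> cf; exact: (continuous_funcomp cf (@norm_continuous _ _)).
have cB : continuous B.
  apply: continuous_funD; first apply: continuous_funD.
  - apply: continuous_funM; first by apply: cnorm; apply: cx; exact: continuous_curvature.
    apply: (cx (fun x => Num.sqrt (m x))).
    by apply: continuous_fun_sqrt; exact: continuous_area.
  - apply: continuous_funM; last by apply: cnorm; exact: continuous_flux.
    apply: continuous_funM; first exact: continuous_funcst.
    apply: continuous_funB; first exact: continuous_funcst.
    by apply: cx; exact: smooth_continuous.
  - apply: continuous_funM; first exact: continuous_funcst.
    apply: continuous_funD; last exact: continuous_funcst.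
    apply: continuous_funM; first exact: continuous_funcst.
    exact: (cslice dphi2 continuous_dphi2).
exists (cube_int B) => eps L e0 L0 eL.
have cout : continuous (outward A h (drnorm eps)).
  by apply: continuous_outward => i; case: (drnorm_C1 e0 i).
set f := fun t => _ - _.
have cf : continuous f.
  apply: continuous_funB.
    by apply: continuous_funM => //; apply: (cslice (cutoff M L 3)); exact: continuous_cutoff.
  apply: continuous_funM; last exact: (cslice _ (@continuous_rnorm_dev eps)).
  apply: continuous_funM; first exact: continuous_funcst.
  by apply: (cslice (cutoff M L 2)); exact: continuous_cutoff.
have bnd t : unit_cube t -> `|f (row_of_tuple t) + flux (row_of_tuple t)| <=
    L^-1 * B (row_of_tuple t).
  move=> ct; rewrite /f.
  have /andP[c31 c3] := cutoff3_boundary L0 ct.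
  have c30 := cutoff_ge0 M L 3 (flat (row_of_tuple t, 0)).
  have c20 := cutoff_ge0 M L 2 (flat (row_of_tuple t, 0)).
  have c21 := cutoff_le1 h_le L0 2 ct (lexx 0).
  have ou := outward_drnorm_approx e0 ct erefl.
  have fd := rnorm_dev_le e0 (flat (row_of_tuple t, 0)).
  rewrite -/(flux _) in ou; move: ou fd; rewrite /B.
  have KS : 0 <= `|curvature h (row_of_tuple t *m A)| * Num.sqrt (m (row_of_tuple t *m A)).
    by rewrite mulr_ge0 ?sqrtr_ge0.
  move: (outward _ _ _ _) (flux _) (rnorm_dev _ _) (`|_| * _) KS (dphi2 _) (cutoff _ _ 3 _)
    (cutoff _ _ 2 _) c31 c3 c30 c20 c21 => o fx D K K0 gp c1 c2 c31 c3 c30 c20 c21 ou fd.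
  have -> : c1 * o - 3 / L * c2 * D + fx =
      c1 * (o + fx) + (1 - c1) * fx - 3 / L * (c2 * D) by ring.
  have LV : 0 < L^-1 by rewrite invr_gt0.
  apply: (le_trans (ler_normB _ _)).
  have -> x a b c : x * (a + b + c) = x * a + x * b + x * c :> R by ring.
  apply: lerD; first (apply: (le_trans (ler_normD _ _)); apply: lerD).
  - rewrite normrM (ger0_norm c30) -[leRHS]mul1r ler_pM//; first lra.
    by rewrite (le_trans ou)// mulrC ler_wpM2r.
  - by rewrite normrM (ger0_norm c31) mulrA ler_wpM2r// mulrC.
  - rewrite normrM (ger0_norm (_ : 0 <= 3 / L)); last by rewrite divr_ge0 ?ltW.
    rewrite mulrCA -mulrA ler_wpM2l// ler_wpM2l ?(ltW LV)//.
    by rewrite normrM (ger0_norm c20) -[leRHS]mul1r ler_pM.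
rewrite -cube_intD//; last exact: continuous_flux.
have cfD : continuous (fun t => f t + flux t).
  by apply: continuous_funD => //; exact: continuous_flux.
have -> : cube_int B / L = cube_int (fun t => L^-1 * B t) by rewrite cube_intZ// mulrC.
have cLB : continuous (fun t => L^-1 * B t).
  by apply: continuous_funM => //; exact: continuous_funcst.
rewrite ler_norml; apply/andP; split.
  rewrite -mulN1r -cube_intZ//; apply: le_cube_int => //.
    by apply: continuous_funM => //; exact: continuous_funcst.
  by move=> t ct; have := bnd t ct; rewrite ler_norml mulN1r => /andP[].
by apply: le_cube_int => // t ct; have := bnd t ct; rewrite ler_norml => /andP[].
Qed.

Lemma cyl_int_lap_rnorm_bound : exists C, forall eps L : R, 0 < eps -> 1 <= L -> eps <= L^-1 ->
  `|cyl_int (fun z => cutoff M L 3 (flat z) * lap_rnorm eps (flat z)) + cube_int flux| <= C / L.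
Proof.
have [C1 HC] := boundary_flux_bound.
exists (3 + 12 * cyl_int (fun z => dphi2 (flat z)) + C1) => eps L e0 L1 eL.
have L0 : 0 < L by exact: lt_le_trans L1.
rewrite green_rnorm// -addrA (le_trans (ler_normD _ _))// [leRHS]mulrDl lerD ?HC//.
apply: (le_trans (cutoff_rnorm_dev_bound e0 L0)); rewrite [leRHS]mulrDl lerD2l.
have E0 : 0 <= cyl_int (fun z => dphi2 (flat z)).
  by apply: Rintegral_ge0 => p _; exact: dphi2_ge0.
rewrite ler_wpM2l ?mulr_ge0// lef_pV2 ?posrE ?exprn_gt0// expr2 -[leLHS]mulr1.
by rewrite ler_wpM2l// ltW.
Qed.

(** * Passage to the limit *)

Definition eps_ k : R := 2^-1 ^+ k.
Definition main_term k z :=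
  cutoff M k.+1%:R 3 z * ((dQ2 z * hess2 z - dQhess2 z) / rnorm (eps_ k) z ^+ 3).
Definition error_term k z :=
  cutoff M k.+1%:R 3 z * (eps_ k ^+ 2 * hess2 z / rnorm (eps_ k) z ^+ 3).
Definition hess_term k z := cutoff M k.+1%:R 3 z * (hess2 z / rnorm (eps_ k) z).

Lemma eps_gt0 k : 0 < eps_ k.
Proof. by rewrite exprn_gt0 ?invr_gt0. Qed.

(** A geometric sequence is chosen because its square is a fixed multiple of its own decrement,
    which lets the errors telescope. *)
Lemma eps_S k : eps_ k.+1 = eps_ k / 2.
Proof. by rewrite /eps_ exprSr. Qed.

(** With [L = k.+1] this is the condition [eps <= L^-1] of the integral bounds. *)
Lemma eps_le k : eps_ k <= (k.+1%:R)^-1.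
Proof.
rewrite /eps_ exprVn lef_pV2 ?posrE ?exprn_gt0//.
by rewrite -natrX ler_nat ltn_expl.
Qed.

Lemma cvg_eps : eps_ @ \oo --> (0 : R).
Proof. by apply: cvg_expr; rewrite ger0_norm ?invr_ge0// invf_lt1// ltr1n. Qed.

Lemma le_rnorm k z : rnorm (eps_ k.+1) z <= rnorm (eps_ k) z.
Proof.
rewrite ler_wsqrtr// lerD2r eps_S ler_pXn2r ?nnegrE ?divr_ge0 ?(ltW (eps_gt0 k))//.
by rewrite ler_pdivrMr// ler_peMr ?(ltW (eps_gt0 k))// ler1n.
Qed.

Lemma continuous_main_term k : continuous (main_term k).
Proof.
apply: continuous_funM; first exact: continuous_cutoff.
apply: continuous_funM; last exact: continuous_rnormV (eps_gt0 k).
apply: continuous_funB; last exact: continuous_dQhess2.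
by apply: continuous_funM; [exact: continuous_dQ2|exact: continuous_hess2].
Qed.

Lemma main_term_ge0 k z : 0 <= main_term k z.
Proof.
rewrite mulr_ge0 ?cutoff_ge0// divr_ge0 ?subr_ge0 ?dQhess2_le// exprn_ge0//.
by rewrite ltW// rnorm_gt0// eps_gt0.
Qed.

Lemma le_cutoffS k t (s : R) : unit_cube t -> s <= 0 ->
  cutoff M k.+1%:R 3 (flat (row_of_tuple t, s)) <=
  cutoff M k.+2%:R 3 (flat (row_of_tuple t, s)).
Proof. by move=> ct s0; apply: le_cutoff => //; [exact: h_le|rewrite ler_nat]. Qed.

Lemma le_main_term k t (s : R) : unit_cube t -> s <= 0 ->
  main_term k (flat (row_of_tuple t, s)) <= main_term k.+1 (flat (row_of_tuple t, s)).
Proof.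
move=> ct s0; have F0 i z : 0 < rnorm (eps_ i) z by exact: rnorm_gt0 (eps_gt0 i) z.
apply: ler_pM.
- exact: cutoff_ge0.
- by rewrite divr_ge0 ?subr_ge0 ?dQhess2_le// exprn_ge0// ltW.
- exact: le_cutoffS.
- rewrite ler_wpM2l ?subr_ge0 ?dQhess2_le// lef_pV2 ?posrE ?exprn_gt0//.
  by rewrite ler_pXn2r ?nnegrE ?(ltW (F0 _ _))// le_rnorm.
Qed.

(** Let [F] and [F'] be the norms for [k] and [k.+1]. Then [eps_ k ^+ 2] is [4 / 3] times
    [F^2 - F'^2], and [F' <= F] gives [(F + F') / F^2 <= 2 / F']; this turns [4 / 3] into [8 / 3]
    times [1 / F' - 1 / F]. The growth of the cutoff only enlarges the right side. *)
Lemma error_term_le k t (s : R) : unit_cube t -> s <= 0 ->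
  error_term k (flat (row_of_tuple t, s)) <=
  8 / 3 * (hess_term k.+1 (flat (row_of_tuple t, s)) - hess_term k (flat (row_of_tuple t, s))).
Proof.
move=> ct s0; rewrite /error_term /hess_term.
have cS := le_cutoffS k ct s0; have c0 := cutoff_ge0 M k.+1%:R 3 (flat (row_of_tuple t, s)).
have := le_rnorm k (flat (row_of_tuple t, s)).
have := rnorm_sqr (eps_gt0 k) (flat (row_of_tuple t, s)).
have := rnorm_sqr (eps_gt0 k.+1) (flat (row_of_tuple t, s)).
have := rnorm_gt0 (eps_gt0 k) (flat (row_of_tuple t, s)).
have := rnorm_gt0 (eps_gt0 k.+1) (flat (row_of_tuple t, s)).
have := hess2_ge0 (flat (row_of_tuple t, s)).
move: (eps_S k); move: (eps_ k.+1) (eps_ k)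
  (rnorm (eps_ k.+1) _) (rnorm (eps_ k) _) (hess2 _) (dQ2 _) cS c0.
move: (cutoff M k.+1%:R _ _) (cutoff M k.+2%:R _ _)
  => c1 c2 e' e F' F H p cS c0 -> H0 F'0 F0 F'E FE FF'.
have e2 : e ^+ 2 = 4 / 3 * (F ^+ 2 - F' ^+ 2).
  by rewrite FE F'E; field.
apply: (@le_trans _ _ (8 / 3 * (c1 * (H / F') - c1 * (H / F)))); last first.
  by rewrite ler_wpM2l// lerD2r ler_wpM2r// divr_ge0// ltW.
have -> : 8 / 3 * (c1 * (H / F') - c1 * (H / F)) =
    c1 * (H * (8 / 3 * (F'^-1 - F^-1))) by ring.
rewrite ler_wpM2l// -[leLHS]mulrA mulrCA ler_wpM2l// e2.
have -> : 4 / 3 * (F ^+ 2 - F' ^+ 2) / F ^+ 3 =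
  (4 / 3 * (F - F') / F) * ((F + F') / F ^+ 2) by field; rewrite gt_eqF.
have -> : 8 / 3 * (F'^-1 - F^-1) = (4 / 3 * (F - F') / F) * (2 / F').
  by field; rewrite !gt_eqF.
rewrite ler_wpM2l//; first by rewrite divr_ge0 ?(ltW F0)// mulr_ge0 ?subr_ge0.
rewrite ler_pdivlMr// mulrAC ler_pdivrMr ?exprn_gt0//; nra.
Qed.

Lemma hess_term_integrable k : cyl_integrable (fun z => hess_term k (flat z)).
Proof.
apply: (@cutoff_integrable k.+1%:R 2 (fun z => hess2 z / rnorm (eps_ k) z)) => //.
apply: continuous_funM; first exact: continuous_hess2.
exact: (@continuous_rnormV _ 1 (eps_gt0 k)).
Qed.

Lemma error_term_integrable k : cyl_integrable (fun z => error_term k (flat z)).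
Proof.
apply: (@cutoff_integrable k.+1%:R 2
  (fun z => eps_ k ^+ 2 * hess2 z / rnorm (eps_ k) z ^+ 3)) => //.
apply: continuous_funM; last exact: continuous_rnormV (eps_gt0 k).
by apply: continuous_funM; [exact: continuous_funcst|exact: continuous_hess2].
Qed.

Lemma main_term_integrable k : cyl_integrable (fun z => main_term k (flat z)).
Proof.
apply: (@cutoff_integrable k.+1%:R 2
  (fun z => (dQ2 z * hess2 z - dQhess2 z) / rnorm (eps_ k) z ^+ 3)) => //.
apply: continuous_funM; last exact: continuous_rnormV (eps_gt0 k).
apply: continuous_funB; last exact: continuous_dQhess2.
by apply: continuous_funM; [exact: continuous_dQ2|exact: continuous_hess2].
Qed.

Lemma cyl_int_hess_term_bounded : exists C, forall k, cyl_int (fun z => hess_term k (flat z)) <= C.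
Proof.
have [C HC] := cyl_int_lap_rnorm_bound.
exists ((d + 1).+1%:R * (`|C| + `|cube_int flux|)) => k.
have k1 : 1 <= k.+1%:R :> R by rewrite ler1n.
have k0 : 0 < k.+1%:R :> R by [].
have iL : cyl_integrable (fun z => cutoff M k.+1%:R 3 (flat z) * lap_rnorm (eps_ k) (flat z)).
  by apply: cutoff_integrable => //; exact: continuous_lap_rnorm (eps_gt0 k).
apply: (@le_trans _ _ ((d + 1).+1%:R *
    cyl_int (fun z => cutoff M k.+1%:R 3 (flat z) * lap_rnorm (eps_ k) (flat z)))).
  rewrite -cyl_intZ//; apply: le_cyl_int.
  - exact: hess_term_integrable.
  - exact: cyl_integrableZ.
  - move=> t s ct s0; rewrite mulrCA ler_wpM2l ?cutoff_ge0//.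
    by apply: (hess2_le (eps_gt0 k)); exact: subgraph_flat.
rewrite ler_wpM2l//; have := HC _ _ (eps_gt0 k) k1 (eps_le k).
move: (cyl_int _) (cube_int _) => a b ab.
have : C / k.+1%:R <= `|C|.
  rewrite ler_pdivrMr// (le_trans (ler_norm _))// ler_peMr//.
move=> /(le_trans ab) abC; rewrite -(addrK b a) -[in leRHS](normrN b) lerD ?ler_norm//.
exact: le_trans (ler_norm _) abC.
Qed.

Lemma cvg_cyl_int_error_term : cyl_int (fun z => error_term k (flat z)) @[k --> \oo] --> (0 : R).
Proof.
have k0 k : 0 < k.+1%:R :> R by [].
have iD := hess_term_integrable.
have iB := error_term_integrable.
have iN k : cyl_integrable (fun z => hess_term k.+1 (flat z) + -1 * hess_term k (flat z)).
  by apply: cyl_integrableD => //; exact: cyl_integrableZ.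
pose D k := cyl_int (fun z => hess_term k (flat z)).
have DB k : cyl_int (fun z => error_term k (flat z)) <= 8 / 3 * (D k.+1 - D k).
  rewrite /D -cyl_intB// -cyl_intZ; last first.
    by have := iN k; under eq_fun do rewrite mulN1r.
  apply: le_cyl_int => //.
    apply: cyl_integrableZ; by have := iN k; under eq_fun do rewrite mulN1r.
  by move=> t s ct s0; exact: error_term_le (ltW s0).
have B0 k : 0 <= cyl_int (fun z => error_term k (flat z)).
  apply: Rintegral_ge0 => p _; rewrite mulr_ge0 ?cutoff_ge0// divr_ge0//.
    by rewrite mulr_ge0 ?sqr_ge0 ?hess2_ge0.
  by rewrite exprn_ge0// ltW// rnorm_gt0// eps_gt0.
(* Monotonicity is read off [DB], the error being nonnegative. *)
have ndD : nondecreasing_seq D.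
  apply/nondecreasing_seqP => k; rewrite -subr_ge0.
  by have := le_trans (B0 k) (DB k); rewrite pmulr_rge0.
have cD : cvgn D.
  apply: nondecreasing_is_cvgn => //; have [C HC] := cyl_int_hess_term_bounded.
  by exists C => _ [k _ <-]; exact: HC.
have cDS : D k.+1 - D k @[k --> \oo] --> (0 : R).
  rewrite -(subrr (limn D)); apply: cvgB => //.
  by rewrite (@cvg_shiftS _ D).
apply: (@squeeze_cvgr _ _ _ _ (fun=> 0) (fun k => 8 / 3 * (D k.+1 - D k))).
- by apply: nearW => k; rewrite B0 DB.
- exact: cvg_cst.
- by rewrite -(mulr0 (8 / 3)); apply: cvgM => //; exact: cvg_cst.
Qed.

Lemma lap_rnorm_split k z :
  cutoff M k.+1%:R 3 z * lap_rnorm (eps_ k) z - error_term k z = main_term k z.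
Proof. by rewrite /lap_rnorm /error_term /main_term; ring. Qed.

Lemma cvg_cyl_int_main_term :
  cyl_int (fun z => main_term k (flat z)) @[k --> \oo] --> - cube_int flux.
Proof.
have k0 k : 0 < k.+1%:R :> R by [].
have iB := error_term_integrable.
have iL k : cyl_integrable (fun z => cutoff M k.+1%:R 3 (flat z) * lap_rnorm (eps_ k) (flat z)).
  by apply: cutoff_integrable => //; exact: continuous_lap_rnorm (eps_gt0 k).
rewrite (_ : (fun k => _) = fun k =>
    cyl_int (fun z => cutoff M k.+1%:R 3 (flat z) * lap_rnorm (eps_ k) (flat z)) -
    cyl_int (fun z => error_term k (flat z))); last first.
  apply/funext => k; rewrite -cyl_intB//; congr cyl_int; apply/funext => z.
  by rewrite lap_rnorm_split.
rewrite -[- cube_int _]subr0; apply: cvgB; last exact: cvg_cyl_int_error_term.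
have [C HC] := cyl_int_lap_rnorm_bound.
apply/cvgrPdist_le => e e0.
near=> k; rewrite -opprD normrN addrC.
have k1 : 1 <= k.+1%:R :> R by rewrite ler1n.
apply: (le_trans (HC _ _ (eps_gt0 k) k1 (eps_le k))).
rewrite ler_pdivrMr// -ler_pdivrMl// (le_trans (ler_norm _))//.
near: k; exists (Num.truncn `|e^-1 * C|) => // k /= Nk.
rewrite ltW// (lt_le_trans (truncnS_gt _))// ler_nat ltnS//.
Unshelve. all: by end_near. Qed.

Lemma cvg_main_term z :
  main_term k z @[k --> \oo] --> (dQ2 z * hess2 z - dQhess2 z) / Num.sqrt (dQ2 z) ^+ 3.
Proof.
have [p0|p0] := eqVneq (dQ2 z) 0.
  have -> : dQ2 z * hess2 z - dQhess2 z = 0.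
    have := dQhess2_le z; rewrite p0 mul0r => g0; apply/eqP; rewrite sub0r oppr_eq0 eq_le g0.
    by apply: sumr_ge0 => i _; exact: sqr_ge0.
  rewrite mul0r (_ : (fun k => _) = fun=> 0); first exact: cvg_cst.
  apply/funext => k; apply/eqP; rewrite eq_le main_term_ge0 andbT /main_term.
  rewrite p0 mul0r sub0r mulNr mulrN oppr_le0 mulr_ge0 ?cutoff_ge0// divr_ge0//.
    by apply: sumr_ge0 => i _; exact: sqr_ge0.
  by rewrite exprn_ge0// ltW// rnorm_gt0// eps_gt0.
have {}p0 : 0 < dQ2 z by rewrite lt_neqAle eq_sym p0 dQ2_ge0.
rewrite -[X in _ --> X]mul1r; apply: cvgM.
  have p1 : ppow 3 (1 + (z 0 y_ - M) * 0) = 1 :> R.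
    by rewrite mulr0 addr0 ppow_pos// expr1n.
  rewrite -[X in _ --> X]p1.
  apply: (@cvg_comp _ _ _ (fun k : nat => 1 + (z 0 y_ - M) / k.+1%:R) (ppow 3)); last first.
    exact: continuous_ppow.
  apply: cvgD; first exact: cvg_cst.
  by apply: cvgM; [exact: cvg_cst|exact: cvg_harmonic].
apply: cvgM; first exact: cvg_cst.
apply: cvgV; first by rewrite expf_neq0// gt_eqF// sqrtr_gt0.
apply: (@cvg_comp _ _ _ (fun k => rnorm (eps_ k) z) (fun x => x ^+ 3));
  last exact: exprn_continuous.
apply: (@cvg_comp _ _ _ (fun k => eps_ k ^+ 2 + dQ2 z) Num.sqrt); last exact: sqrt_continuous.
suff : eps_ k ^+ 2 + dQ2 z @[k --> \oo] --> 0 + dQ2 z by rewrite add0r.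
apply: cvgD; last exact: cvg_cst.
suff : eps_ k ^+ 2 @[k --> \oo] --> (0 * 0 : R) by rewrite mulr0.
by apply: cvgM; exact: cvg_eps.
Qed.

(** The shear to the half-cylinder is applied to each continuous [main_term]; the monotone limit, a
    quotient whose denominator is no longer regularised, is taken on the region itself. *)
Lemma integral_subgraph_flux :
  (\int[lebesgue_tuple R d \x @lebesgue_measure R]_(p in
      [set p | unit_cube p.1 /\ (p.2 < h (row_of_tuple p.1 *m A))%R])
    ((dQ2 (xy_point (row_of_tuple p.1 *m A) p.2) * hess2 (xy_point (row_of_tuple p.1 *m A) p.2) -
      dQhess2 (xy_point (row_of_tuple p.1 *m A) p.2)) /
      Num.sqrt (dQ2 (xy_point (row_of_tuple p.1 *m A) p.2)) ^+ 3)%:E =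
  (- cube_int flux)%:E)%E.
Proof.
pose k t := h (t *m A).
have ck : continuous k.
  apply: (continuous_funcomp (@continuous_mulmxr R d A)); exact: smooth_continuous.
pose G i (z : 'rV[R]_d * R) := main_term i (xy_point (z.1 *m A) z.2).
have cG i : continuous (G i).
  apply: (continuous_funcomp (@continuous_chart_pair R d A)
    (g := fun z => main_term i (xy_point z.1 z.2))).
  apply: (continuous_funcomp (@continuous_xy_point R d)); exact: continuous_main_term.
have G0 i z : 0 <= G i z by exact: main_term_ge0.
have subG i := @integral_subgraph R d k (G i) ck (cG i) (G0 i).
set S := [set p | _].
have mS : measurable S by have [] := subG 0.
pose g i (p : d.-tuple (measurableTypeR R) * measurableTypeR R) := (G i (row_of_tuple p.1, p.2))%:E.
have mg i : measurable_fun S (g i).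
  apply/measurable_EFinP; apply: measurable_funS (measurable_continuous_pair (cG i)) => //.
have Sflat p : S p -> xy_point (row_of_tuple p.1 *m A) p.2 =
    flat (row_of_tuple p.1, p.2 - h (row_of_tuple p.1 *m A)).
  move=> _; have -> : flat (row_of_tuple p.1, p.2 - h (row_of_tuple p.1 *m A)) =
    graph_map h (row_of_tuple p.1 *m A, p.2 - h (row_of_tuple p.1 *m A)) by [].
  by rewrite /graph_map/= subrKC.
have ndg p : S p -> {homo (fun i => g i p) : i j / (i <= j)%N >-> (i <= j)%E}.
  move=> Sp; apply/nondecreasing_seqP => i; rewrite lee_fin /G/= (Sflat _ Sp).
  by case: Sp => ct s0; apply: le_main_term => //; rewrite subr_le0 ltW.
have g0 i p : S p -> (0 <= g i p)%E by rewrite lee_fin.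
have := @cvg_monotone_convergence _ _ _ (lebesgue_tuple R d \x @lebesgue_measure R)%E
  _ mS _ mg g0 ndg.
have -> : (fun i => \int[lebesgue_tuple R d \x @lebesgue_measure R]_(p in S) g i p)%E =
    (fun i => (cyl_int (fun z => main_term i (flat z)))%:E).
  apply/funext => i; have [_ ->] := subG i.
  rewrite -(integral_cyl (main_term_integrable i)); apply: eq_integral => p _.
  by rewrite /on_tuples /G.
have cA : (fun i => (cyl_int (fun z => main_term i (flat z)))%:E) @ \oo --> (- cube_int flux)%:E.
  by apply: cvg_EFin; [exact: nearW|exact: cvg_cyl_int_main_term].
move=> /(cvg_unique (@ereal_hausdorff R)) /(_ cA) <-.
apply: eq_integral => p _; apply/esym/cvg_lim; first exact: ereal_hausdorff.
by apply: cvg_EFin; [exact: nearW|exact: cvg_main_term].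
Qed.

End bounded_by.

End harmonic.

Lemma lty_pmul2l {R : realType} (c : R) (x : \bar R) : 0 < c -> (c%:E * x < +oo -> x < +oo)%E.
Proof. by move=> c0; case: x => [r||] //; rewrite ?ltry// gt0_muley ?lte_fin. Qed.

(** * From the given extension to the continuous family of its derivatives *)

Section extension.
Context {R : realType} {d : nat}.
Variables (A : 'M[R]_d) (h : 'rV[R]_d -> R).
Hypothesis A_unit : A \in unitmx.
Hypothesis h_periodic : lattice_periodic A h.
Hypothesis h_smooth : smooth_on setT h.
Local Notation e_ i := (delta_mx 0 i).
Local Notation U := (subgraph h).
Local Notation y_ := (@ycoord d).

Lemma closure_subgraph (z : 'rV[R]_(d + 1)) : z 0 y_ <= h (lsubmx z) -> closure U z.
Proof.
move=> zh B Bz.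
have cg : continuous (fun r : R => graph_map h (lsubmx z, r)).
  move=> r; apply: continuous_comp; last exact: continuous_graph_map.
  by apply: continuous_pair; [exact: cvg_cst|exact: cvg_id].
pose s := z 0 y_ - h (lsubmx z).
have zE : graph_map h (lsubmx z, s) = z.
  by rewrite /graph_map/= /s subrKC xy_point_eta.
have Bs : \forall r \near s, B (graph_map h (lsubmx z, r)).
  by apply: (cg s); rewrite zE.
have [r [rs Br]] : exists r : R, r < s /\ B (graph_map h (lsubmx z, r)).
  apply: (@filter_ex _ s^'-); near=> r; split; near: r; first exact: nbhs_left_lt.
  exact: cvg_within Bs.
exists (graph_map h (lsubmx z, r)); split => //.
by apply: subgraph_graph_map; rewrite (lt_le_trans rs)// subr_le0.
Unshelve. all: by end_near. Qed.

(** Retraction of the whole space onto the closed region along vertical lines. Composition with it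
    extends a function continuous on the closure to a continuous function everywhere. *)
Definition clip (z : 'rV[R]_(d + 1)) := xy_point (lsubmx z) (Num.min (z 0 y_) (h (lsubmx z))).

Lemma clip_id (z : 'rV[R]_(d + 1)) : z 0 y_ <= h (lsubmx z) -> clip z = z.
Proof. by move=> zh; rewrite /clip min_l// xy_point_eta. Qed.

Lemma closure_clip z : closure U (clip z).
Proof.
by apply: closure_subgraph; rewrite lsubmx_xy_point xy_point_y ge_min lexx orbT.
Qed.

Lemma continuous_clip : continuous clip.
Proof.
move=> z; apply: (@continuous_comp _ _ _
  (fun z : 'rV[R]_(d + 1) => (lsubmx z, Num.min (z 0 y_) (h (lsubmx z))))
  (fun z : 'rV[R]_d * R => xy_point z.1 z.2)); last exact: continuous_xy_point.
apply: continuous_pair; first exact: continuous_lsubmx1.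
apply: (@continuous_min R _ (fun z : 'rV[R]_(d + 1) => z 0 y_) (fun z => h (lsubmx z))).
  exact: coord_continuous.
by apply: (continuous_funcomp (@continuous_lsubmx1 R d)); exact: smooth_continuous.
Qed.

Lemma continuous_comp_clip (g : 'rV[R]_(d + 1) -> R) :
  {within closure U, continuous g} -> continuous (g \o clip).
Proof.
move=> /subspace_continuousP cg z.
apply: (@cvg_comp _ _ _ clip g _ (within (closure U) (nbhs (clip z)))); last first.
  by apply: cg; exact: closure_clip.
move=> B /= Bz.
have : \forall w \near z, closure U (clip w) -> B (clip w) by exact: continuous_clip Bz.
by apply: filterS => w; apply; exact: closure_clip.
Qed.

Lemma subgraph_shift i z : U z -> U (z + xy_point (row i A) 0).
Proof.
rewrite /subgraph/= -[in X in _ -> X](xy_point_eta z) -xy_pointD.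
by rewrite lsubmx_xy_point xy_point_y h_periodic addr0.
Qed.

Lemma iter_partial_periodic (f : 'rV[R]_(d + 1) -> R) s :
  periodic_below h A f -> periodic_below h A (iter_partial s f).
Proof.
elim: s => //= i s IHs fper j z hz; rewrite /partial.
transitivity ('D_(e_ i) (fun w => iter_partial s f (w + xy_point (row j A) 0)) z).
  rewrite /derive; set F1 := fun k => _; set F2 := fun k => _.
  suff -> : F1 = F2 by [].
  by apply/funext => k; rewrite /F1 /F2 /= addrA.
apply: near_eq_derive; near=> w; apply: IHs => //; near: w; exact: near_subgraph.
Unshelve. all: by end_near. Qed.

Variable phi : 'rV[R]_(d + 1) -> R.
Hypothesis phi_ext : harmonic_extension A h phi.

Let phi_smooth : smooth_on U phi. Proof. by case: phi_ext => -[]. Qed.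

Let ext s : {g : 'rV[R]_(d + 1) -> R | {within closure U, continuous g} &
  forall x, U x -> g x = iter_partial s phi x}.
Proof. by case: phi_ext => -[_ _ /(_ s)] H _ _ _ _; exact: cid2 H. Qed.

(** The chosen extensions are tied to [phi] only below the graph. For the empty list [phi] itself is
    kept, since its values on the graph are prescribed. *)
Definition Phi_ext s : 'rV[R]_(d + 1) -> R :=
  (if s is [::] then phi else s2val (ext s)) \o clip.

Lemma Phi_E s z : U z -> Phi_ext s z = iter_partial s phi z.
Proof.
move=> hz; rewrite /Phi_ext/= clip_id ?ltW//; case: s => // i s.
by case: (ext (i :: s)) => g /= _; apply.
Qed.

Lemma Phi_continuous s : continuous (Phi_ext s).
Proof.
apply: continuous_comp_clip; case: s => [|i s]; first by case: phi_ext => -[].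
by case: (ext (i :: s)).
Qed.

Lemma Phi_is_derive s z : U z -> forall i, is_derive z (e_ i) (Phi_ext s) (Phi_ext (i :: s) z).
Proof.
move=> hz i; rewrite Phi_E//=.
apply: (@near_eq_is_derive _ _ _ (iter_partial s phi)).
  by near=> w; rewrite Phi_E//; near: w; exact: near_subgraph.
by have [_ /(_ i)] := phi_smooth s hz => /derivableP.
Unshelve. all: by end_near. Qed.

Lemma Phi_periodic_below s : periodic_below h A (Phi_ext s).
Proof.
move=> i z hz; rewrite !Phi_E//; last exact: subgraph_shift.
apply: iter_partial_periodic => // j w hw.
case: phi_ext => _ per _ _ _; apply: per; exact: subset_closure.
Qed.

Lemma Phi_harmonic z : U z -> \sum_i Phi_ext [:: i; i] z = 0.
Proof.
move=> hz; case: phi_ext => _ _ _ /(_ z hz) lap _; rewrite -[RHS]lap.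
by apply: eq_bigr => i _; rewrite Phi_E.
Qed.

Lemma Phi_trace x : Phi_ext [::] (xy_point x (h x)) = h x.
Proof.
rewrite /Phi_ext/= clip_id; last by rewrite lsubmx_xy_point xy_point_y.
by case: phi_ext.
Qed.

Lemma subgraph_chartE : [set p : d.-tuple (measurableTypeR R) * R |
    unit_cube p.1 /\ U (xy_point (lattice_chart A p.1) p.2)] =
  [set p | unit_cube p.1 /\ (p.2 < h (row_of_tuple p.1 *m A))%R].
Proof.
by apply/seteqP; split => p [cp]; rewrite /subgraph/= lsubmx_xy_point xy_point_y.
Qed.

(** The finite Dirichlet integral is carried to the half-cylinder by [integral_subgraph]; the factor
    [|det A|] is positive and can be divided out. *)
Lemma Phi_finite_energy : cyl_integrable (fun z => \sum_i Phi_ext [:: i] (flat h A z) ^+ 2).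
Proof.
have cg : continuous (dphi2 Phi_ext) by exact: continuous_dphi2 Phi_continuous.
have cf : continuous (fun z => dphi2 Phi_ext (flat h A z)).
  exact: continuous_on_flat.
apply/integrableP; split.
  apply/measurable_EFinP; apply: measurable_funTS; exact: (measurable_continuous_pair cf).
pose k t := h (t *m A).
have ck : continuous k.
  apply: (continuous_funcomp (@continuous_mulmxr R d A)); exact: smooth_continuous.
pose G (z : 'rV[R]_d * R) := dphi2 Phi_ext (xy_point (z.1 *m A) z.2).
have cG : continuous G.
  apply: (continuous_funcomp (@continuous_chart_pair R d A)
    (g := fun z => dphi2 Phi_ext (xy_point z.1 z.2))).
  exact: (continuous_funcomp (@continuous_xy_point R d)).
have G0 z : 0 <= G z by exact: dphi2_ge0.
have [_ subG] := @integral_subgraph R d k G ck cG G0.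
have det_gt0 : 0 < `|\det A| by rewrite normr_gt0 -unitfE -unitmxE.
case: phi_ext => _ _ fin _ _; move: fin; rewrite /subgraph_integral subgraph_chartE.
move=> /(lty_pmul2l det_gt0).
have -> : (\int[lebesgue_tuple R d \x lebesgue_measure]_(p in
     [set p | unit_cube p.1 /\ (p.2 < h (row_of_tuple p.1 *m A))%R])
     (grad_sqnorm phi (xy_point (lattice_chart A p.1) p.2))%:E =
   \int[lebesgue_tuple R d \x lebesgue_measure]_(p in half_cylinder)
     (`| (EFin \o on_tuples (fun z => dphi2 Phi_ext (flat h A z))) p|))%E.
  transitivity (\int[lebesgue_tuple R d \x lebesgue_measure]_(p in
     [set p | unit_cube p.1 /\ (p.2 < k (row_of_tuple p.1))%R])
     (G (row_of_tuple p.1, p.2))%:E)%E.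
    apply: eq_integral => p /set_mem [cp hp]; congr EFin.
    have hz : U (xy_point (row_of_tuple p.1 *m A) p.2).
      by rewrite /subgraph/= lsubmx_xy_point xy_point_y.
    by apply: eq_bigr => i _; rewrite (Phi_E _ hz).
  rewrite subG; apply: eq_integral => p _.
  by rewrite /= (ger0_norm (dphi2_ge0 _ _)).
exact.
Qed.

(** The limit is taken within the open region, where [partial i phi] coincides with a function
    continuous at the boundary point; that point lies in the closure, so the limit is unique. *)
Lemma boundary_valueE i x :
  boundary_value U (partial i phi) (xy_point x (h x)) = Phi_ext [:: i] (xy_point x (h x)).
Proof.
have cl : closure U (xy_point x (h x)).
  by apply: closure_subgraph; rewrite lsubmx_xy_point xy_point_y.
have proper_within := within_nbhs_proper cl.
apply: cvg_lim => //.
apply: (@cvg_trans _ (Phi_ext [:: i] @ within U (nbhs (xy_point x (h x))))); last first.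
  apply: (@cvg_comp _ _ _ id (Phi_ext [:: i])); first exact: cvg_within.
  exact: Phi_continuous.
apply: near_eq_cvg; rewrite near_withinE; apply: nearW => w hw.
by rewrite Phi_E.
Qed.

(** Since [phi = Q + y], on the graph [d_y phi = 1 - slope] and [d_i phi = slope * d_i h]. *)
Lemma dirichlet_neumannE x :
  dirichlet_neumann h phi x = 1 - slope h Phi_ext x * (1 + grad_sqnorm h x).
Proof.
rewrite /dirichlet_neumann boundary_valueE.
have gE : graph_map h (x, 0) = xy_point x (h x) by rewrite /graph_map/= addr0.
have -> : Phi_ext [:: y_] (xy_point x (h x)) = 1 - slope h Phi_ext x.
  by rewrite /slope /dQ gE eqxx/=; ring.
rewrite mulrDr mulr1 opprD addrA; congr (_ - _).
rewrite /grad_sqnorm mulr_sumr; apply: eq_bigr => i _; rewrite boundary_valueE.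
have := dQ_boundary h_smooth Phi_continuous Phi_is_derive Phi_trace x i.
rewrite gE /dQ lshift_neq_ycoord subr0 => ->; ring.
Qed.

Local Notation Q := (fun z : 'rV[R]_(d + 1) => phi z - z 0 y_).

Lemma partial_Q i z : U z -> partial i Q z = dQ Phi_ext i z.
Proof.
move=> hz; have [_ _ /(_ _ hz i) [_ <-]] := Qext_C1 Phi_continuous Phi_is_derive.
apply: near_eq_derive; near=> w; rewrite /Qext Phi_E//; near: w; exact: near_subgraph.
Unshelve. all: by end_near. Qed.

Lemma partial2_Q i j z : U z -> partial i (partial j Q) z = Phi_ext [:: i; j] z.
Proof.
move=> hz; have [_ _ /(_ _ hz i) [_ <-]] := dQ_C1 Phi_continuous Phi_is_derive j.
apply: near_eq_derive; near=> w; rewrite partial_Q//; near: w; exact: near_subgraph.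
Unshelve. all: by end_near. Qed.

Lemma subgraph_integrand z : U z ->
  (grad_norm Q z ^+ 2 * hess_sqnorm Q z - grad_hess_sqnorm Q z) / grad_norm Q z ^+ 3 =
  (dQ2 Phi_ext z * hess2 Phi_ext z - dQhess2 Phi_ext z) / Num.sqrt (dQ2 Phi_ext z) ^+ 3.
Proof.
move=> hz; rewrite /grad_norm.
have -> : grad_sqnorm Q z = dQ2 Phi_ext z.
  by apply: eq_bigr => i _; rewrite partial_Q.
have -> : hess_sqnorm Q z = hess2 Phi_ext z.
  by apply: eq_bigr => i _; apply: eq_bigr => j _; rewrite partial2_Q.
have -> : grad_hess_sqnorm Q z = dQhess2 Phi_ext z.
  apply: eq_bigr => i _; congr (_ ^+ 2); apply: eq_bigr => j _.
  by rewrite partial_Q// partial2_Q.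
by rewrite sqr_sqrtr ?dQ2_ge0.
Qed.

Lemma J_functionalE : J_functional A h phi = (`|\det A| * - cube_int (flux A h Phi_ext))%:E.
Proof.
rewrite /J_functional /torus_integral EFinM; congr (_ * _)%E.
have ck : continuous (fun t : 'rV[R]_d => curvature h (t *m A)).
  apply: (continuous_funcomp (@continuous_mulmxr R d A)); exact: continuous_curvature.
have cfl := continuous_flux (A := A) h_smooth Phi_continuous Phi_is_derive.
(* The zero inserted here is the integral of the curvature, which completes the integrand to
   curvature minus flux. *)
rewrite -[- cube_int _]sub0r -(cube_int_curvature h_smooth A_unit h_periodic).
rewrite -cube_intB// -integral_cube; last exact: continuous_funB.
apply: eq_integral => t _; rewrite dirichlet_neumannE /flux.
by congr EFin; rewrite mulrBr mulr1 mulrA.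
Qed.

Lemma subgraph_integralE :
  subgraph_integral A h (fun z =>
    (grad_norm Q z ^+ 2 * hess_sqnorm Q z - grad_hess_sqnorm Q z) / grad_norm Q z ^+ 3) =
  (`|\det A| * - cube_int (flux A h Phi_ext))%:E.
Proof.
rewrite /subgraph_integral EFinM; congr (_ * _)%E; rewrite subgraph_chartE.
have ck : continuous (fun t : 'rV[R]_d => h (t *m A)).
  apply: (continuous_funcomp (@continuous_mulmxr R d A)); exact: smooth_continuous.
(* The graph is bounded above over one cell by compactness, which provides the reference height of
   the cutoffs. *)
have [M hM] := bounded_on_cube ck.
have h_le t : unit_cube t -> h (row_of_tuple t *m A) <= M.
  by move=> ct; rewrite (le_trans (ler_norm _))// hM.
rewrite -(integral_subgraph_flux A_unit h_periodic h_smooth Phi_continuous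
  Phi_is_derive Phi_periodic_below Phi_harmonic Phi_trace Phi_finite_energy h_le).
apply: eq_integral => p /set_mem [cp hp]; rewrite subgraph_integrand//.
by rewrite /subgraph/= lsubmx_xy_point xy_point_y.
Qed.

End extension.

Theorem proposition3p4 (R : realType) (d : nat) (d_ge1 : (1 <= d)%N)
    (A : 'M[R]_d) (A_unit : A \in unitmx)
    (h : 'rV[R]_d -> R) (h_periodic : lattice_periodic A h)
    (h_smooth : smooth_on setT h)
    (phi : 'rV[R]_(d + 1) -> R) (phi_ext : harmonic_extension A h phi) :
  let Q := fun z : 'rV[R]_(d + 1) => phi z - z 0 ycoord in
  let I := subgraph_integral A h (fun z =>
    (grad_norm Q z ^+ 2 * hess_sqnorm Q z - grad_hess_sqnorm Q z)
      / grad_norm Q z ^+ 3) in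
  J_functional A h phi = I /\ (0 <= I)%E.
Proof.
move=> Q I; split.
  by rewrite (J_functionalE A_unit h_periodic h_smooth phi_ext) -subgraph_integralE.
apply: mule_ge0; first by rewrite lee_fin.
(* The numerator is nonnegative by Cauchy-Schwarz, row by row of the Hessian; where the gradient
   vanishes the quotient is [0]. *)
apply: integral_ge0 => p [_ hp].
rewrite lee_fin (subgraph_integrand h_smooth phi_ext hp).
by rewrite divr_ge0 ?subr_ge0 ?dQhess2_le// exprn_ge0// sqrtr_ge0.
Qed.
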